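(* Let $SK$, $SK_1$, $\mathscr{Z}$, $\mathcal{P}^{\mathbb{N}}$ and $\sigma$ be as in the context. (a) The ring $SK$ of special quasi-elliptic functions is a polynomial ring in one variable over $SK_1$, namely $SK=SK_1[\mathscr{Z}]$. Moreover, $SK$ is a free module over $SK_1$ with basis $\{\mathscr{Z}^k \mid k\ge 0\}$. (b) The image of $\sigma$ on $SK$ satisfies $\operatorname{im}(\sigma)\subseteq \mathcal{P}^{\mathbb{N}}$. (c) The induced map $\sigma: SK/\mathbb{C}\to\mathcal{P}^{\mathbb{N}}$ is an isomorphism (of complex vector spaces).
   Context: Fix $\tau\in\mathbb{C}$ with $\operatorname{Im}(\tau)>0$ and let $\Lambda=\mathbb{Z}+\tau\mathbb{Z}$. For a meromorphic function $f$ on $\mathbb{C}$ of period $1$ put $\Delta f(x)=f(x+\tau)-f(x)$. For $k\ge 0$ let $K_k=\ker\Delta^k$ (inside the space of meromorphic functions on $\mathbb{C}$ of period $1$; $\Delta^0$ is the identity) and $K=\bigcup_{k\ge0}K_k$, the quasi-elliptic functions. $K_1$ is the field of elliptic functions for $\Lambda$. $SK\subset K$ denotes the special quasi-elliptic functions, i.e. those all of whose poles lie in $\Lambda$, and $SK_k=SK\cap K_k$. The ring structure is pointwise multiplication. $\mathscr{Z}(x)=\zeta(x)-e_2x$, where $\zeta$ is the Weierstrass zeta function of $\Lambda$ and $e_2=\zeta(x+1)-\zeta(x)$ (a constant); it has period $1$ and satisfies $\mathscr{Z}(x+\tau)-\mathscr{Z}(x)=-2\pi i$. For a meromorphic $1$-periodic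 $f$ with poles only in $\Lambda$ and $m\in\mathbb{Z}$, write the Laurent expansion at $x=m\tau$ as $f(x)=\sum_{\ell\in\mathbb{N}}\frac{f_\ell(m)}{(x-m\tau)^\ell}+(\text{regular})$, $\mathbb{N}=\{1,2,\dots\}$, so $f_\ell\in\mathrm{Map}(\mathbb{Z},\mathbb{C})$. Let $\mathbb{C}^{\mathbb{N}}$ have basis $\mathbf{e}_\ell$, $\ell\in\mathbb{N}$, and put $\sigma(f)=\sum_{\ell\in\mathbb{N}}f_\ell\,\mathbf{e}_\ell\in\mathrm{Map}(\mathbb{Z},\mathbb{C}^{\mathbb{N}})$ (the singular part of $f$). Let $\mathcal{P}\subset\mathrm{Map}(\mathbb{Z},\mathbb{C})$ be the space $\mathbb{C}[m]$ of polynomial maps, and $\mathcal{P}^{\mathbb{N}}=\bigoplus_{\ell=1}^\infty\mathcal{P}\,\mathbf{e}_\ell$. Since $\sigma$ kills additive constants, it descends to $SK/\mathbb{C}$ (functions modulo additive constants), where it is again denoted $\sigma$. *)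

(* Defs.v *)
From HB Require Import structures.
From mathcomp Require Import all_boot all_order all_algebra.
From mathcomp Require Import generic_quotient ring_quotient complex finmap.
From mathcomp Require Import boolp classical_sets functions reals.
From mathcomp Require Import topology normedtype derive.
From mathcomp Require Import showcase.summability.

Set Implicit Arguments.
Unset Strict Implicit.
Unset Printing Implicit Defensive.

Import GRing.Theory Num.Theory.
Import numFieldTopology.Exports numFieldNormedType.Exports.

Local Open Scope classical_set_scope.
Local Open Scope quotient_scope.
Local Open Scope ring_scope.

(* The theorem takes C := R[i] with R : realType.  The definitions only need  *)
(* a numFieldType, and working over an abstract one keeps unification from    *)
(* unfolding the complex numbers.                                             *)

Section AnalyticFunctions.
Variable C : numFieldType.
Implicit Types (f g : C -> C) (z : C).

Definition holomorphic_at f z := \forall w \near z, derivable f w 1.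

(* f has a holomorphic extension across z; the value f z is irrelevant. *)
Definition regular_at f z :=
  exists2 g, holomorphic_at g z & \forall w \near z^', f w = g w.

Definition meromorphic_at f z :=
  exists n, regular_at (fun w => (w - z) ^+ n * f w) z.

Definition vanishes_off_discrete f := forall z, \forall w \near z^', f w = 0.

Definition negligible : pred (C -> C) :=
  fun f => `[< vanishes_off_discrete f >].

Lemma dnbhs_neq z : \forall w \near z^', w != z.
Proof. by rewrite /dnbhs; apply: withinT; exact: nbhs_filter. Qed.

Lemma negligible_idealr : idealr_closed negligible.
Proof.
split.
- by apply/asboolP => z; apply: filterE.
- apply/negP => /asboolP/(_ 0) h.
  suff [w /eqP] : exists w : C, (1 : C) = 0 by rewrite oner_eq0.
  by have [w hw] := filter_ex h; exists w.
- move=> a u v /asboolP hu /asboolP hv; apply/asboolP => z.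
  near=> w; rewrite /= !fctE.
  have -> : u w = 0 by near: w; exact: hu.
  have -> : v w = 0 by near: w; exact: hv.
  by rewrite mulr0 addr0.
Unshelve. all: by end_near. Qed.

HB.instance Definition _ :=
  isIdealr.Build (C -> C) negligible negligible_idealr.

Lemma regular_ext f g z :
  (\forall w \near z^', f w = g w) -> regular_at f z -> regular_at g z.
Proof.
move=> fg [h hh fh]; exists h => //.
by near=> w; rewrite -(near fg w) // (near fh w).
Unshelve. all: by end_near. Qed.

Lemma holomorphic_regular f z : holomorphic_at f z -> regular_at f z.
Proof. by move=> hf; exists f => //; apply: filterE. Qed.

Lemma regularD f g z :
  regular_at f z -> regular_at g z -> regular_at (f + g) z.
Proof.
move=> [f' hf ff'] [g' hg gg']; exists (f' + g').
  near=> w; apply: derivableD; first exact: (near hf w).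
  exact: (near hg w).
by near=> w; rewrite !fctE (near ff' w) // (near gg' w).
Unshelve. all: by end_near. Qed.

Lemma regularM f g z :
  regular_at f z -> regular_at g z -> regular_at (f * g) z.
Proof.
move=> [f' hf ff'] [g' hg gg']; exists (f' * g').
  near=> w; apply: derivableM; first exact: (near hf w).
  exact: (near hg w).
by near=> w; rewrite !fctE (near ff' w) // (near gg' w).
Unshelve. all: by end_near. Qed.

Lemma regular_cst (c : C) z : regular_at (cst c) z.
Proof.
by apply: holomorphic_regular; apply: filterE => w; exact: derivable_cst.
Qed.

Lemma regular_exp (a : C) n z : regular_at (fun w => (w - a) ^+ n) z.
Proof.
elim: n => [|n IH]; first exact: (regular_cst 1).
have h1 : regular_at (fun w => w - a) z.
  have h0 : regular_at id z.
    by apply: holomorphic_regular; apply: filterE => w; exact: derivable_id.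
  by apply: regular_ext (regularD h0 (regular_cst (- a) z)); apply: filterE.
by apply: regular_ext (regularM h1 IH); apply: filterE => w; rewrite exprS.
Qed.

Lemma meromorphic_ext f g z :
  (\forall w \near z^', f w = g w) -> meromorphic_at f z -> meromorphic_at g z.
Proof.
move=> fg [n fn]; exists n; apply: regular_ext fn.
by near=> w; rewrite (near fg w).
Unshelve. all: by end_near. Qed.

Lemma regular_meromorphic f z : regular_at f z -> meromorphic_at f z.
Proof.
move=> fz; exists 0; apply: regular_ext fz.
by apply: filterE => w; rewrite expr0 mul1r.
Qed.

Lemma meromorphicD f g z :
  meromorphic_at f z -> meromorphic_at g z -> meromorphic_at (f + g) z.
Proof.
move=> [n fn] [m gm]; exists (n + m)%N.
apply: regular_ext (regularD (regularM (regular_exp z m z) fn)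
                             (regularM (regular_exp z n z) gm)).
apply: filterE => w; rewrite !fctE exprD mulrDr !mulrA; congr (_ + _).
by rewrite [_ ^+ m * _]mulrC.
Qed.

Lemma meromorphicM f g z :
  meromorphic_at f z -> meromorphic_at g z -> meromorphic_at (f * g) z.
Proof.
move=> [n fn] [m gm]; exists (n + m)%N.
apply: regular_ext (regularM fn gm).
by apply: filterE => w; rewrite !fctE exprD mulrACA.
Qed.

Lemma vanishes_shift f a :
  vanishes_off_discrete f -> vanishes_off_discrete (fun w => f (w + a)).
Proof.
move=> hf z; have := hf (z + a).
move=> /nbhs_ballP[e /= e0 he]; apply/nbhs_ballP; exists e => //= w zw wz.
apply: he; last by rewrite (inj_eq (addIr a)).
by move: zw; rewrite -!ball_normE /= opprD addrACA subrr addr0.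
Qed.

(* Functions defined off a closed discrete set, with the pointwise ring       *)
(* structure: total functions, two of them being identified when they agree   *)
(* on a punctured neighbourhood of every point.  Meromorphic functions live   *)
(* here, whatever junk values their representatives take at the poles.        *)
Definition pfun := {ideal_quot (negligible : idealr (C -> C))}.

HB.instance Definition _ := GRing.ComNzRing.on pfun.

Definition pfun_class f : pfun := \pi_pfun f.

Lemma pfun_classP f g : reflect (forall z, \forall w \near z^', f w = g w)
  (pfun_class f == pfun_class g).
Proof.
apply: (iffP idP).
  rewrite /pfun_class piE /Quotient.equiv => /asboolP h z; move: (h z).
  by apply: filterS => w /eqP; rewrite !fctE subr_eq0 => /eqP.
move=> h; rewrite /pfun_class piE /Quotient.equiv; apply/asboolP => z.
move: (h z).
by apply: filterS => w fg; rewrite !fctE /= fg subrr.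
Qed.

End AnalyticFunctions.

Section PfunTheory.
Variable C : numFieldType.
Implicit Types (F G : pfun C) (f g : C -> C) (a z : C).

Lemma repr_class f z : \forall w \near z^', repr (pfun_class f) w = f w.
Proof. by apply/(pfun_classP _ _); rewrite /pfun_class reprK. Qed.

Lemma pfun_classD f g : pfun_class (f + g) = pfun_class f + pfun_class g.
Proof. exact: rmorphD. Qed.

Lemma pfun_classB f g : pfun_class (f - g) = pfun_class f - pfun_class g.
Proof. exact: rmorphB. Qed.

Lemma pfun_classM f g : pfun_class (f * g) = pfun_class f * pfun_class g.
Proof. exact: rmorphM. Qed.

Lemma pfun_class1 : pfun_class (1 : C -> C) = 1.
Proof. exact: rmorph1. Qed.

Lemma pfunP F : exists f, F = pfun_class f.
Proof. by exists (repr F); rewrite /pfun_class reprK. Qed.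

Definition pfun_scale (a : C) F : pfun C := pfun_class (cst a) * F.

Fact pfun_scaleA a b F : pfun_scale a (pfun_scale b F) = pfun_scale (a * b) F.
Proof. by rewrite /pfun_scale mulrA -pfun_classM. Qed.

Fact pfun_scale1 : left_id 1 pfun_scale.
Proof.
by move=> F; rewrite /pfun_scale (_ : cst 1 = 1) // pfun_class1 mul1r.
Qed.

Fact pfun_scaleDr : right_distributive pfun_scale +%R.
Proof. by move=> a F G; rewrite /pfun_scale mulrDr. Qed.

Fact pfun_scaleDl F : {morph pfun_scale^~ F : a b / a + b}.
Proof. by move=> a b; rewrite /pfun_scale -mulrDl -pfun_classD. Qed.

HB.instance Definition _ := GRing.Zmodule_isLmodule.Build C (pfun C)
  pfun_scaleA pfun_scale1 pfun_scaleDr pfun_scaleDl.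

Lemma pfun_classZ a f : pfun_class (a *: f) = a *: pfun_class f.
Proof. exact: (pfun_classM (cst a) f). Qed.

Definition regular F z := regular_at (repr F) z.

Definition meromorphic F := forall z, meromorphic_at (repr F) z.

Definition is_pole F z := ~ regular F z.

Lemma regular_pfun_class f z : regular (pfun_class f) z <-> regular_at f z.
Proof.
split; apply: regular_ext; first exact: repr_class.
by apply: filterS (repr_class f z) => w ->.
Qed.

Lemma meromorphic_class f :
  meromorphic (pfun_class f) <-> forall z, meromorphic_at f z.
Proof.
split=> hf z; apply: meromorphic_ext (hf z); first exact: repr_class.
by apply: filterS (repr_class f z) => w ->.
Qed.

Definition translate a F : pfun C := pfun_class (fun w => repr F (w + a)).

Lemma translate_class a f :
  translate a (pfun_class f) = pfun_class (fun w => f (w + a)).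
Proof.
apply/eqP/pfun_classP.
have h : vanishes_off_discrete (repr (pfun_class f) - f).
  move=> z; apply: filterS (repr_class f z) => w.
  by rewrite !fctE => ->; rewrite subrr.
move=> z; apply: filterS (vanishes_shift a h z) => w.
by rewrite !fctE => /eqP; rewrite subr_eq0 => /eqP.
Qed.

Fact translate_is_zmod_morphism a : zmod_morphism (translate a).
Proof.
move=> F G; have [f ->] := pfunP F; have [g ->] := pfunP G.
by rewrite -pfun_classB !translate_class -pfun_classB.
Qed.

Fact translate_is_monoid_morphism a : monoid_morphism (translate a).
Proof.
split; first by rewrite -pfun_class1 translate_class.
move=> F G; have [f ->] := pfunP F; have [g ->] := pfunP G.
by rewrite -pfun_classM !translate_class -pfun_classM.
Qed.

HB.instance Definition _ a := GRing.isZmodMorphism.Build (pfun C) (pfun C)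
  (translate a) (translate_is_zmod_morphism a).
HB.instance Definition _ a := GRing.isMonoidMorphism.Build (pfun C) (pfun C)
  (translate a) (translate_is_monoid_morphism a).

Lemma translate_cst a c : translate a (pfun_class (cst c)) = pfun_class (cst c).
Proof. by rewrite translate_class. Qed.

End PfunTheory.

Section QuasiElliptic.
Variables (C : numFieldType) (tau : C).
Implicit Types (F G : pfun C) (k : nat) (z : C).

Definition lattice : set C :=
  [set z | exists m n : int, z = m%:~R + n%:~R * tau].

Definition Delta F : pfun C := translate tau F - F.

Definition Kn k F : Prop :=
  [/\ meromorphic F, translate 1 F = F & iter k Delta F = 0].

Definition quasi_elliptic F : Prop := exists k, Kn k F.

Definition special F : Prop := forall z, is_pole F z -> lattice z.

Definition SK : pred (pfun C) :=
  fun F => `[< quasi_elliptic F /\ special F >].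

Definition SKn k : pred (pfun C) :=
  fun F => `[< Kn k F /\ special F >].

Lemma Delta_is_zmod_morphism : zmod_morphism Delta.
Proof. by move=> F G; rewrite /Delta rmorphB !opprD !opprK addrACA. Qed.
HB.instance Definition _ := GRing.isZmodMorphism.Build (pfun C) (pfun C)
  Delta Delta_is_zmod_morphism.

Lemma iterDelta_is_zmod_morphism k : zmod_morphism (iter k Delta).
Proof. by elim: k => [|k IH] F G //; rewrite !iterS IH raddfB. Qed.
HB.instance Definition _ k := GRing.isZmodMorphism.Build (pfun C) (pfun C)
  (iter k Delta) (iterDelta_is_zmod_morphism k).

Lemma DeltaM F G : Delta (F * G) = translate tau F * Delta G + Delta F * G.
Proof. by rewrite /Delta rmorphM /= mulrBr mulrBl addrA subrK. Qed.

Lemma Delta_translate F : Delta (translate tau F) = translate tau (Delta F).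
Proof. by rewrite /Delta rmorphB. Qed.

Lemma iterDelta_translate k F :
  iter k Delta (translate tau F) = translate tau (iter k Delta F).
Proof. by elim: k => // k IH; rewrite !iterS IH Delta_translate. Qed.

Lemma iterDelta_leq k l F :
  (k <= l)%N -> iter k Delta F = 0 -> iter l Delta F = 0.
Proof. by move=> /subnK <- kF; rewrite iterD kF raddf0. Qed.

Lemma iterDeltaM k l F G : iter k Delta F = 0 -> iter l Delta G = 0 ->
  iter (k + l) Delta (F * G) = 0.
Proof.
have [n kl] : exists n, (k + l)%N = n by exists (k + l)%N.
elim: n k l F G kl => [|n IH] k l F G kl hF hG.
  by case: k kl hF => // _ /= ->; rewrite mul0r raddf0.
case: k kl hF => [_ /= ->|k kl hF]; first by rewrite mul0r raddf0.
case: l kl hG => [_ hG|l kl hG].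
  by rewrite (hG : G = 0) mulr0 (raddf0 (iter _ Delta)).
have e1 : (k.+1 + l)%N = n by move: kl; rewrite addnS => /succn_inj.
have e2 : (k + l.+1)%N = n by move: kl; rewrite addSn => /succn_inj.
rewrite kl iterSr DeltaM raddfD /= -{1}e1 IH //; last 2 first.
- by rewrite iterDelta_translate hF raddf0.
- by rewrite -iterSr.
by rewrite add0r -e2 IH // -iterSr.
Qed.

Lemma class_cst_SKn c : SKn 1 (pfun_class (cst c)).
Proof.
apply/asboolP; split; first split.
- apply/meromorphic_class => z; apply: regular_meromorphic.
  exact: regular_cst.
- by rewrite translate_cst.
- by rewrite /= /Delta translate_cst subrr.
- by move=> z []; apply/regular_pfun_class; exact: regular_cst.
Qed.

Lemma KnB k l F G : Kn k F -> Kn l G -> Kn (maxn k l) (F - G).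
Proof.
move=> [mF pF kF] [mG pG kG]; split.
- have [f Ff] := pfunP F; have [g Gg] := pfunP G.
  move: mF mG; rewrite Ff Gg -pfun_classB !meromorphic_class => mf mg z.
  rewrite -(mulN1r g); apply: meromorphicD; first exact: mf.
  apply: meromorphicM (mg z); apply: regular_meromorphic.
  exact: (regular_cst (-1)).
- by rewrite rmorphB /= pF pG.
- rewrite raddfB /= (iterDelta_leq (leq_maxl k l) kF).
  by rewrite (iterDelta_leq (leq_maxr k l) kG) subrr.
Qed.

Lemma KnM k l F G : Kn k F -> Kn l G -> Kn (k + l) (F * G).
Proof.
move=> [mF pF kF] [mG pG kG]; split.
- have [f Ff] := pfunP F; have [g Gg] := pfunP G.
  move: mF mG; rewrite Ff Gg -pfun_classM !meromorphic_class => mf mg z.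
  exact: meromorphicM (mf z) (mg z).
- by rewrite rmorphM /= pF pG.
- exact: iterDeltaM.
Qed.

Lemma special_regular F z : special F -> ~ lattice z -> regular F z.
Proof. by move=> sF nz; apply: contrapT => /sF. Qed.

Lemma specialB F G : special F -> special G -> special (F - G).
Proof.
move=> sF sG z hz; apply: contrapT => nz; apply: hz.
have := special_regular sF nz; have := special_regular sG nz.
have [f ->] := pfunP F; have [g ->] := pfunP G.
rewrite -pfun_classB !regular_pfun_class => hg hf.
rewrite -(mulN1r g); apply: regularD => //; apply: regularM hg.
exact: (regular_cst (-1)).
Qed.

Lemma specialM F G : special F -> special G -> special (F * G).
Proof.
move=> sF sG z hz; apply: contrapT => nz; apply: hz.
have := special_regular sF nz; have := special_regular sG nz.
have [f ->] := pfunP F; have [g ->] := pfunP G.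
by rewrite -pfun_classM !regular_pfun_class => hg hf; exact: regularM.
Qed.

Lemma SKnSK k F : F \in SKn k -> F \in SK.
Proof. by move=> /asboolP[kF sF]; apply/asboolP; split=> //; exists k. Qed.

Lemma SK_subring_closed : subring_closed SK.
Proof.
split.
- by apply: (@SKnSK 1); rewrite -pfun_class1; exact: (class_cst_SKn 1).
- move=> F G /asboolP[[k kF] sF] /asboolP[[l kG] sG].
  apply/asboolP; split; last exact: specialB.
  by exists (maxn k l); exact: KnB.
- move=> F G /asboolP[[k kF] sF] /asboolP[[l kG] sG].
  apply/asboolP; split; last exact: specialM.
  by exists (k + l)%N; exact: KnM.
Qed.
HB.instance Definition _ :=
  GRing.isSubringClosed.Build (pfun C) SK SK_subring_closed.

Lemma SK_scaler_closed : GRing.scaler_closed SK.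
Proof.
by move=> a F hF; rewrite rpredM // (@SKnSK 1) //; exact: (class_cst_SKn a).
Qed.
HB.instance Definition _ := GRing.isScaleClosed.Build C (pfun C) SK
  SK_scaler_closed.

Lemma SK1_subring_closed : subring_closed (SKn 1).
Proof.
split.
- by rewrite -pfun_class1; exact: (class_cst_SKn 1).
- move=> F G /asboolP[kF sF] /asboolP[kG sG].
  by apply/asboolP; split; [exact: KnB kF kG | exact: specialB].
- move=> F G /asboolP[kF sF] /asboolP[kG sG].
  apply/asboolP; split; last exact: specialM.
  have [mFG pFG _] := KnM kF kG; split=> //.
  have [_ _ /= dF] := kF; have [_ _ /= dG] := kG.
  by rewrite /= DeltaM dF dG mulr0 mul0r addr0.
Qed.
HB.instance Definition _ :=
  GRing.isSubringClosed.Build (pfun C) (SKn 1) SK1_subring_closed.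

Record SK_type := SKType { SKval :> pfun C; SKvalP : SKval \in SK }.
HB.instance Definition _ := [isSub for SKval].
HB.instance Definition _ := [Choice of SK_type by <:].
HB.instance Definition _ := [SubChoice_isSubComNzRing of SK_type by <:].
HB.instance Definition _ := [SubZmodule_isSubLmodule of SK_type by <:].

Record SK1_type := SK1Type { SK1val :> pfun C; SK1valP : SK1val \in SKn 1 }.
HB.instance Definition _ := [isSub for SK1val].
HB.instance Definition _ := [Choice of SK1_type by <:].
HB.instance Definition _ := [SubChoice_isSubComNzRing of SK1_type by <:].

Definition SK1_SK (a : SK1_type) : SK_type := SKType (SKnSK (SK1valP a)).

Lemma SK1_SK_is_zmod_morphism : zmod_morphism SK1_SK.
Proof. by move=> a b; exact: val_inj. Qed.
Lemma SK1_SK_is_monoid_morphism : monoid_morphism SK1_SK.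
Proof. by split=> [|a b]; exact: val_inj. Qed.
HB.instance Definition _ := GRing.isZmodMorphism.Build SK1_type SK_type
  SK1_SK SK1_SK_is_zmod_morphism.
HB.instance Definition _ := GRing.isMonoidMorphism.Build SK1_type SK_type
  SK1_SK SK1_SK_is_monoid_morphism.

(* SK with its SK_1-module structure, as SK_type is already a C-module. *)
Definition SK_module := SK_type.
HB.instance Definition _ := GRing.ComNzRing.on SK_module.

Definition SK1_scale (a : SK1_type) (f : SK_module) : SK_module := SK1_SK a * f.

Fact SK1_scaleA a b f : SK1_scale a (SK1_scale b f) = SK1_scale (a * b) f.
Proof. by rewrite /SK1_scale mulrA -rmorphM. Qed.
Fact SK1_scale1 : left_id 1 SK1_scale.
Proof. by move=> f; rewrite /SK1_scale rmorph1 mul1r. Qed.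
Fact SK1_scaleDr : right_distributive SK1_scale +%R.
Proof. by move=> a f g; rewrite /SK1_scale mulrDr. Qed.
Fact SK1_scaleDl f : {morph SK1_scale^~ f : a b / a + b}.
Proof. by move=> a b; rewrite /SK1_scale -mulrDl -rmorphD. Qed.
HB.instance Definition _ := GRing.Zmodule_isLmodule.Build SK1_type SK_module
  SK1_scaleA SK1_scale1 SK1_scaleDr SK1_scaleDl.

Definition constants : {pred SK_type} := fun f =>
  `[< exists c : C, f = c *: (1 : SK_type) >].

Lemma constants_submod_closed : submod_closed constants.
Proof.
split; first by apply/asboolP; exists 0; rewrite scale0r.
move=> a f g /asboolP[c ->] /asboolP[d ->]; apply/asboolP; exists (a * c + d).
by rewrite scalerDl scalerA.
Qed.
HB.instance Definition _ := GRing.isZmodClosed.Build SK_type constants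
  (GRing.submod_closedB constants_submod_closed).

Definition SK_mod_C := Quotient.quot (constants : zmodClosed SK_type).
HB.instance Definition _ := GRing.Zmodule.on SK_mod_C.

Definition SK_class (f : SK_type) : SK_mod_C := \pi_SK_mod_C f.

Lemma SK_classP f g :
  SK_class f = SK_class g <-> exists c : C, f - g = c *: (1 : SK_type).
Proof.
rewrite /SK_class; split=> [/eqP|h].
  by rewrite piE /Quotient.equiv => /asboolP.
by apply/eqP; rewrite piE /Quotient.equiv; apply/asboolP.
Qed.

Lemma SK_classD f g : SK_class (f + g) = SK_class f + SK_class g.
Proof. exact: raddfD. Qed.

Definition SK_mod_C_scale (a : C) (x : SK_mod_C) := SK_class (a *: repr x).

Lemma SK_class_scale a f : SK_mod_C_scale a (SK_class f) = SK_class (a *: f).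
Proof.
apply/SK_classP.
have /SK_classP[c hc] : SK_class (repr (SK_class f)) = SK_class f.
  by rewrite /SK_class reprK.
by exists (a * c); rewrite -scalerBr hc scalerA.
Qed.

Lemma SK_mod_CP (x : SK_mod_C) : exists f, x = SK_class f.
Proof. by exists (repr x); rewrite /SK_class reprK. Qed.

Fact SK_mod_C_scaleA a b x :
  SK_mod_C_scale a (SK_mod_C_scale b x) = SK_mod_C_scale (a * b) x.
Proof. by have [f ->] := SK_mod_CP x; rewrite !SK_class_scale scalerA. Qed.
Fact SK_mod_C_scale1 : left_id 1 SK_mod_C_scale.
Proof.
by move=> x; have [f ->] := SK_mod_CP x; rewrite SK_class_scale scale1r.
Qed.
Fact SK_mod_C_scaleDr : right_distributive SK_mod_C_scale +%R.
Proof.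
move=> a x y; have [f ->] := SK_mod_CP x; have [g ->] := SK_mod_CP y.
by rewrite -SK_classD !SK_class_scale scalerDr SK_classD.
Qed.
Fact SK_mod_C_scaleDl x : {morph SK_mod_C_scale^~ x : a b / a + b}.
Proof.
move=> a b; have [f ->] := SK_mod_CP x.
by rewrite !SK_class_scale scalerDl SK_classD.
Qed.
HB.instance Definition _ := GRing.Zmodule_isLmodule.Build C SK_mod_C
  SK_mod_C_scaleA SK_mod_C_scale1 SK_mod_C_scaleDr SK_mod_C_scaleDl.

(* The sum over the nonzero lattice points is the limit over the finite       *)
(* subsets of int * int.                                                      *)
Definition zeta z : C :=
  z^-1 + sum (fun p : int * int =>
    let w := p.1%:~R + p.2%:~R * tau in
    if p == 0 then 0 else (z - w)^-1 + w^-1 + z / w ^+ 2).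

(* zeta (z + 1) - zeta z does not depend on z; it is read off at z = 1/2. *)
Definition e2 : C := zeta (2^-1 + 1) - zeta 2^-1.

Definition scrZ : pfun C := pfun_class (fun z => zeta z - e2 * z).

(* p`_l is the coefficient of (w - z)^-(l + 1). *)
Definition is_singular_part F z (p : {poly C}) : Prop :=
  regular_at
    (fun w => repr F w - \sum_(l < size p) p`_l / (w - z) ^+ l.+1) z.

Definition singular_part F z : {poly C} :=
  xget 0 [set p | is_singular_part F z p].

(* A map s : Z -> C^N is encoded as l, m |-> coefficient of e_(l + 1) in s(m).*)
Definition sigma F : nat -> int -> C :=
  fun l m => (singular_part F (m%:~R * tau))`_l.

End QuasiElliptic.

Section PolynomialMaps.
Variable C : numFieldType.

Definition polynomial_map (s : int -> C) : Prop :=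
  exists p : {poly C}, forall m, s m = p.[m%:~R].

Definition PN : pred (nat -> int -> C) := fun s =>
  `[< (exists N, forall l, (N <= l)%N -> s l = 0) /\
      (forall l, polynomial_map (s l)) >].

Lemma PN_submod_closed : submod_closed PN.
Proof.
split.
  by apply/asboolP; split=> [|l]; [exists 0 | exists 0 => m; rewrite horner0].
move=> a s t /asboolP[[N hN] hs] /asboolP[[M hM] ht]; apply/asboolP; split.
  exists (maxn N M) => l; rewrite geq_max => /andP[Nl Ml].
  have -> : (a *: s + t) l = a *: s l + t l by [].
  by rewrite hN // hM // scaler0 addr0.
move=> l; have [p hp] := hs l; have [q hq] := ht l; exists (a *: p + q) => m.
by rewrite hornerD hornerZ -hp -hq.
Qed.
HB.instance Definition _ :=
  GRing.isZmodClosed.Build (nat -> int -> C) PN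
    (GRing.submod_closedB PN_submod_closed).
Lemma PN_scaler_closed : GRing.scaler_closed PN.
Proof.
move=> a s hs; rewrite -[_ *: _]addr0; apply: PN_submod_closed.2 => //.
exact: PN_submod_closed.1.
Qed.
HB.instance Definition _ :=
  GRing.isScaleClosed.Build C (nat -> int -> C) PN PN_scaler_closed.

Record PN_type := PNType { PNval :> nat -> int -> C; PNvalP : PNval \in PN }.
HB.instance Definition _ := [isSub for PNval].
HB.instance Definition _ := [Choice of PN_type by <:].
HB.instance Definition _ := [SubChoice_isSubZmodule of PN_type by <:].
HB.instance Definition _ := [SubZmodule_isSubLmodule of PN_type by <:].

End PolynomialMaps.

Definition is_basis (A : nzRingType) (V : lmodType A) (b : nat -> V) : Prop :=
  (forall v, exists n (a : 'I_n -> A), v = \sum_(i < n) a i *: b i) /\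
  (forall n (a : 'I_n -> A), \sum_(i < n) a i *: b i = 0 -> forall i, a i = 0).

(* Main.v *)
Require Import Defs.
From HB Require Import structures.
From mathcomp Require Import all_boot all_order all_algebra.
From mathcomp Require Import generic_quotient complex finmap.
From mathcomp Require Import boolp classical_sets functions reals ereal.
From mathcomp Require Import topology normedtype derive.
From mathcomp Require Import measure lebesgue_measure lebesgue_integral.
From mathcomp Require Import showcase.summability.
From mathcomp Require Import zify ring lra.

Set Implicit Arguments.
Unset Strict Implicit.
Unset Printing Implicit Defensive.
Import Order.TTheory GRing.Theory Num.Theory.
Import numFieldTopology.Exports numFieldNormedType.Exports.
Local Open Scope classical_set_scope.
Local Open Scope ring_scope.

(** The proof rests on the theory of one complex variable, which is built from
    the vanishing of the integral of a differentiable function around a rectangle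
    (goursat).  It gives Cauchy's formula on squares (cauchy_formula), hence the
    holomorphy of derivatives and of difference quotients (holomorphic_derive,
    holomorphic_quotient) and Liouville's theorem, first for bounded functions
    and then for entire functions with period 1 and an additive period tau
    (quasi_periodic_entire).

    The zeta function is computed by summing over the boxes |m|, |n| <= N.
    Translation by a period changes such a sum, up to telescoping, by sums over
    two sides of the box; so zeta(x + w) - zeta(x) is constant (zeta_shift), and
    the function Z has period 1 and satisfies Z(x + tau) = Z(x) + c.  The constant
    c is nonzero: otherwise Z would be an odd elliptic function with simple poles
    at the lattice points, and the addition theorem of such a function would
    contradict its vanishing at 1/2 (no_odd_elliptic_simple_pole).

    For (a), Delta acts on polynomials in Z over the elliptic functions as a
    difference operator: Delta^n Z^n = n! c^n.  If Delta^(n+1) F = 0, then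
    a = Delta^n F / (n! c^n) is elliptic and Delta^n kills F - a Z^n; so F is a
    polynomial in Z (evalZ_onto).  Applying Delta^n to a polynomial of degree n
    recovers its leading coefficient, which gives freeness (evalZ_eq0).

    For (b), the singular part of Delta F at m tau is the difference in m of that
    of F.  A map killed by an iterated difference is a polynomial, and vanishes as
    soon as it does at sufficiently many consecutive integers; the latter bounds
    the orders of the poles uniformly (sigma_PN).

    For (c), a function with zero singular parts has no poles; by induction on its
    order it is constant, Liouville's theorem being applied at each step to a
    solution of F(x + tau) = F(x) + const (sigma_eq0).  Conversely, let the
    coefficients of s have degree at most k in m.  The k-th difference of Z^(k+1)
    is affine in Z, with slope (k+1)! c^k; so the k-th difference of its l-th
    derivative has at every m tau the same singular part, a nonzero multiple of
    (x - m tau)^-(l+1).  A combination of these derivatives has the same leading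
    coefficients as s, and what remains has lower degree (sigma_onto). *)

(** * Moduli and complex derivatives *)

(** Real-valued, so that estimates are inequalities in the total order of R and
    not in the partial order of the complex numbers. *)
HB.lock Definition modulus (R : realType) (z : R[i]) : R :=
  ComplexField.Normc.normc z.

Section Metric.
Variable R : realType.
Local Notation C := (complex_complex__canonical__Num_NumField R).
Local Notation Re := (@complex.Re R).
Local Notation Im := (@complex.Im R).
Local Notation modulus := (@modulus R).
Implicit Types (z w : C) (f g : C -> C) (P : C -> Prop).

Lemma normr_modulus z : `|z| = (modulus z)%:C%C.
Proof. by rewrite unlock. Qed.

Lemma modulus_ge0 z : 0 <= modulus z.
Proof. by rewrite -ler0c -normr_modulus. Qed.

Lemma modulus0 : modulus 0 = 0.
Proof. by apply: (@complexI R); rewrite -normr_modulus normr0. Qed.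

Lemma modulusN z : modulus (- z) = modulus z.
Proof. by apply: (@complexI R); rewrite -!normr_modulus normrN. Qed.

Lemma modulusM z w : modulus (z * w) = modulus z * modulus w.
Proof. by apply: (@complexI R); rewrite rmorphM /= -!normr_modulus normrM. Qed.

Lemma modulusV z : modulus z^-1 = (modulus z)^-1.
Proof. by apply: (@complexI R); rewrite fmorphV /= -!normr_modulus normfV. Qed.

Lemma modulusB z w : modulus (z - w) = modulus (w - z).
Proof. by rewrite -modulusN opprB. Qed.

Lemma modulus_eq0 z : (modulus z == 0) = (z == 0).
Proof. by rewrite -(inj_eq (@complexI R)) -normr_modulus normr_eq0. Qed.

Lemma modulus_gt0 z : (0 < modulus z) = (z != 0).
Proof. by rewrite lt0r modulus_eq0 modulus_ge0 andbT. Qed.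

Lemma modulusD z w : modulus (z + w) <= modulus z + modulus w.
Proof. by rewrite -lecR rmorphD /= -!normr_modulus ler_normD. Qed.

Lemma modulusX z n : modulus (z ^+ n) = modulus z ^+ n.
Proof.
by apply: (@complexI R); rewrite -normr_modulus normrX normr_modulus rmorphXn.
Qed.

Lemma modulus_dist z w u : modulus (z - u) <= modulus (z - w) + modulus (w - u).
Proof. by rewrite -{1}(subrK w z) -addrA; exact: modulusD. Qed.

Lemma modulus_pt x y : modulus (x +i* y)%C = Num.sqrt (x ^+ 2 + y ^+ 2).
Proof. by rewrite unlock. Qed.

Lemma modulusR (x : R) : modulus x%:C%C = `|x|.
Proof. by rewrite modulus_pt expr0n addr0 sqrtr_sqr. Qed.

Lemma modulusi : modulus 'i%C = 1.
Proof. by rewrite modulus_pt expr0n expr1n add0r sqrtr1. Qed.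

Lemma normr_Re z : `|Re z| <= modulus z.
Proof. by rewrite -lecR; rewrite -normr_modulus; exact: normc_ge_Re. Qed.

Lemma normr_Im z : `|Im z| <= modulus z.
Proof.
have := normr_Re (- (z * 'i%C)).
by rewrite raddfN /= ReiNIm opprK modulusN modulusM modulusi mulr1.
Qed.

Lemma modulus_ReIm z : modulus z <= `|Re z| + `|Im z|.
Proof.
rewrite {1}(complexE z); apply: le_trans (modulusD _ _) _.
by rewrite modulusM modulusi mul1r !modulusR.
Qed.

Lemma modulus_small z : (forall e : R, 0 < e -> modulus z <= e) -> z = 0.
Proof.
move=> h; apply/eqP; rewrite -modulus_eq0; apply/eqP.
apply/eqP; rewrite eq_le modulus_ge0 andbT; apply/ler_addgt0Pr => e e0.
by rewrite add0r; exact: h.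
Qed.

Lemma near_modulus z P : (\forall w \near z, P w) <->
  exists2 e : R, 0 < e & forall w, modulus (w - z) < e -> P w.
Proof.
split.
- move=> /nbhs_ballP[e /= e0 h].
  have re : (Re e)%:C%C = e by apply: RRe_real; apply: gtr0_real.
  exists (Re e); first by rewrite -ltcR re.
  move=> w hw; apply: h.
  by rewrite -ball_normE /= distrC -re normr_modulus ltcR.
- move=> [e e0 h]; apply/nbhs_ballP.
  exists (e%:C%C : C) => /=; first by rewrite ltcR.
  by move=> w; rewrite -ball_normE /= distrC normr_modulus ltcR; apply: h.
Qed.

Lemma dnear_modulus z P : (\forall w \near z^', P w) <->
  exists2 e : R, 0 < e & forall w, modulus (w - z) < e -> w != z -> P w.
Proof. exact: near_modulus. Qed.

(** Differentiability as a first-order expansion, without difference quotients: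
    the form in which estimates are made and transferred. *)
Definition has_deriv f z d := forall e : R, 0 < e ->
  exists2 r : R, 0 < r & forall w, modulus (w - z) < r ->
    modulus (f w - f z - d * (w - z)) <= e * modulus (w - z).

Lemma has_derivP f z (d : C) :
  (fun h : C => h^-1 *: (f (h *: (1 : C) + z) - f z)) @ 0^' --> d <->
  has_deriv f z d.
Proof.
split=> [/cvgrPdist_le h e e0|h].
- have e0' : (0 : C) < e%:C%C by rewrite ltcR.
  have /dnear_modulus[r r0 hr] := h _ e0'.
  exists r => // w wr; have [->|wz] := eqVneq w z.
    by rewrite !subrr mulr0 subr0 modulus0 mulr0.
  have := hr (w - z); rewrite subr0 subr_eq0 => /(_ wr wz).
  rewrite normr_modulus lecR => {}hr.
  have -> : f w - f z - d * (w - z) =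
    - ((d - (w - z)^-1 *: (f ((w - z) *: 1 + z) - f z)) * (w - z)).
    have wz' : w - z != 0 by rewrite subr_eq0.
    rewrite -[(w - z) *: 1]/((w - z) * 1) mulr1 subrK.
    by rewrite -[_ *: _]/((w - z)^-1 * (f w - f z)); field.
  by rewrite modulusN modulusM ler_wpM2r // modulus_ge0.
- apply/cvgrPdist_le => e e0.
  have re : (Re e)%:C%C = e by apply: RRe_real; apply: gtr0_real.
  have e0' : 0 < Re e by rewrite -ltcR re.
  have [r r0 hr] := h _ e0'.
  apply/dnear_modulus; exists r => // w; rewrite subr0 => wr w0.
  rewrite -re normr_modulus lecR.
  have := hr (w + z); rewrite addrK => /(_ wr) {}hr.
  have -> : d - w^-1 *: (f (w *: 1 + z) - f z) =
     - ((f (w + z) - f z - d * w) * w^-1).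
    rewrite -[w *: 1]/(w * 1) mulr1 -[_ *: _]/(w^-1 * (f (w + z) - f z)).
    by field.
  rewrite modulusN modulusM modulusV //.
  by rewrite ler_pdivrMr ?modulus_gt0.
Qed.

Lemma has_deriv_derivable f z d : has_deriv f z d -> derivable f z 1.
Proof. by move=> /has_derivP h; apply/cvg_ex; exists d. Qed.

Lemma derivable_has_deriv f z : derivable f z 1 -> exists d, has_deriv f z d.
Proof. by move=> /cvg_ex[d h]; exists d; apply/has_derivP. Qed.

End Metric.

(** * Integrals over segments *)

Section SegmentIntegral.
Variable R : realType.
Local Notation C := (complex_complex__canonical__Num_NumField R).
Local Notation Re := (@complex.Re R).
Local Notation Im := (@complex.Im R).
Local Notation modulus := (@modulus R).
Local Notation mu := (@lebesgue_measure R).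
Implicit Types (a b c x : R) (u v : R -> R) (f g : R -> C).

Definition rintegrable a b u := mu.-integrable `[a, b] (EFin \o u).
Definition rint a b u := (\int[mu]_(x in `[a, b]) u x)%R.

Lemma rintegrableD a b u v : rintegrable a b u -> rintegrable a b v -> rintegrable a b (fun x => u x + v x).
Proof. by move=> hu hv; apply: eq_integrable (integrableD _ hu hv). Qed.

Lemma rintegrableZ a b c u : rintegrable a b u -> rintegrable a b (fun x => c * u x).
Proof. by move=> hu; apply: eq_integrable (integrableZl _ c hu). Qed.

Lemma rintegrable_sub a b a' b' u : a <= a' -> b' <= b -> rintegrable a b u -> rintegrable a' b' u.
Proof.
move=> aa bb; apply: integrableS => // x /=; rewrite !in_itv /= => /andP[h1 h2].
by rewrite (le_trans aa h1) (le_trans h2 bb).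
Qed.

Lemma rintegrable_cont a b u : (forall x, a <= x <= b -> {for x, continuous u}) ->
  rintegrable a b u.
Proof.
move=> h; apply: continuous_compact_integrable; first exact: segment_compact.
apply: continuous_in_subspaceT => x; rewrite inE /= in_itv /=; exact: h.
Qed.

Lemma eq_rint a b u v : (forall x, a <= x <= b -> u x = v x) ->
  rint a b u = rint a b v.
Proof.
by move=> h; apply: eq_Rintegral => x; rewrite inE /= in_itv; exact: h.
Qed.

Lemma rintD a b u v : rintegrable a b u -> rintegrable a b v ->
  rint a b (fun x => u x + v x) = rint a b u + rint a b v.
Proof. by move=> hu hv; exact: RintegralD. Qed.

Lemma rintZ a b c u : rintegrable a b u -> rint a b (fun x => c * u x) = c * rint a b u.
Proof. by move=> hu; exact: RintegralZl. Qed.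

Lemma rintegrable_cst a b c : rintegrable a b (fun=> c).
Proof. by apply: rintegrable_cont => x _; exact: cst_continuous. Qed.

Lemma rint_cst a b c : a <= b -> rint a b (fun=> c) = c * (b - a).
Proof.
move=> ab; rewrite /rint Rintegral_cst //= lebesgue_measure_itv /= lte_fin.
by case: ltP => //= ba; rewrite (le_anti (introT andP (conj ab ba))) subrr.
Qed.

Lemma le_rint a b u v : rintegrable a b u -> rintegrable a b v ->
  (forall x, a <= x <= b -> u x <= v x) -> rint a b u <= rint a b v.
Proof.
by move=> hu hv h; apply: le_Rintegral => // x /=; rewrite in_itv; exact: h.
Qed.

Lemma normr_rint a b u M : a <= b -> rintegrable a b u ->
  (forall x, a <= x <= b -> `|u x| <= M) -> `|rint a b u| <= M * (b - a).
Proof.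
move=> ab hu h; rewrite ler_norml -mulNr -!rint_cst //; apply/andP; split.
- apply: le_rint => //; [exact: rintegrable_cst|].
  by move=> x /h; rewrite ler_norml => /andP[].
- apply: le_rint => //; [exact: rintegrable_cst|].
  by move=> x /h; rewrite ler_norml => /andP[].
Qed.

Lemma rint_split a b c u : a <= b -> b <= c -> rintegrable a c u ->
  rint a c u = rint a b u + rint b c u.
Proof.
move=> ab bc hu; rewrite /rint.
have hB : rintegrable b c u by apply: rintegrable_sub hu.
rewrite -(@Rintegral_itv_obnd_cbnd _ b); last first.
  by apply: integrableS hB => // x /=; rewrite !in_itv /= => /andP[/ltW -> ->].
by rewrite -(@Rintegral_itvB _ u _ _ b hu) ?bnd_simp // addrC subrK.
Qed.

Definition cintegrable a b f := rintegrable a b (Re \o f) /\ rintegrable a b (Im \o f).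
Definition cint a b f : C := (rint a b (Re \o f) +i* rint a b (Im \o f))%C.

Lemma Re_add (z w : C) : Re (z + w) = Re z + Re w. Proof. by case: z; case: w. Qed.
Lemma Im_add (z w : C) : Im (z + w) = Im z + Im w. Proof. by case: z; case: w. Qed.
Lemma Re_mul (z w : C) : Re (z * w) = Re z * Re w - Im z * Im w.
Proof. by case: z; case: w. Qed.
Lemma Im_mul (z w : C) : Im (z * w) = Re z * Im w + Im z * Re w.
Proof. by case: z; case: w => *; rewrite /= addrC. Qed.

Lemma cintegrableD a b f g : cintegrable a b f -> cintegrable a b g -> cintegrable a b (fun x => f x + g x).
Proof.
move=> [f1 f2] [g1 g2]; split.
- rewrite [X in rintegrable _ _ X](_ : _ = fun x => Re (f x) + Re (g x)).
    exact: rintegrableD.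
  by apply/funext => x; exact: Re_add.
- rewrite [X in rintegrable _ _ X](_ : _ = fun x => Im (f x) + Im (g x)).
    exact: rintegrableD.
  by apply/funext => x; exact: Im_add.
Qed.

Lemma cintD a b f g : cintegrable a b f -> cintegrable a b g ->
  cint a b (fun x => f x + g x) = cint a b f + cint a b g.
Proof.
move=> [f1 f2] [g1 g2].
apply/eqP; rewrite eq_complex; apply/andP; split; apply/eqP.
  rewrite Re_add /= -rintD //; apply: eq_rint => x _; exact: Re_add.
rewrite Im_add /= -rintD //; apply: eq_rint => x _; exact: Im_add.
Qed.

Lemma cintegrableZ a b (c : C) f : cintegrable a b f -> cintegrable a b (fun x => c * f x).
Proof.
move=> [f1 f2]; split.
- rewrite [X in rintegrable _ _ X](_ : _ = fun x => Re c * Re (f x) + (- Im c) * Im (f x)).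
    by apply: rintegrableD; exact: rintegrableZ.
  by apply/funext => x; rewrite mulNr -Re_mul.
- rewrite [X in rintegrable _ _ X](_ : _ = fun x => Re c * Im (f x) + Im c * Re (f x)).
    by apply: rintegrableD; exact: rintegrableZ.
  by apply/funext => x; rewrite -Im_mul.
Qed.

Lemma cintZ a b (c : C) f : cintegrable a b f ->
  cint a b (fun x => c * f x) = c * cint a b f.
Proof.
move=> [f1 f2]; apply/eqP; rewrite eq_complex; apply/andP; split; apply/eqP.
  rewrite Re_mul /= -mulNr -!rintZ // -rintD; [|exact: rintegrableZ..].
  by apply: eq_rint => x _; rewrite mulNr; exact: Re_mul.
rewrite Im_mul /= -!rintZ // -rintD; [|exact: rintegrableZ..].
by apply: eq_rint => x _; exact: Im_mul.
Qed.

Lemma cintegrableB a b f g : cintegrable a b f -> cintegrable a b g -> cintegrable a b (fun x => f x - g x).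
Proof.
move=> hf hg; rewrite (_ : (fun x => _) = fun x => f x + (-1) * g x).
  by apply: cintegrableD => //; exact: cintegrableZ.
by apply/funext => x; rewrite mulN1r.
Qed.

Lemma eq_cint a b f g : (forall x, a <= x <= b -> f x = g x) ->
  cint a b f = cint a b g.
Proof. by move=> h; congr (_ +i* _)%C; apply: eq_rint => x /h /= ->. Qed.

Lemma cint_cst a b (c : C) : a <= b -> cint a b (fun=> c) = c * (b - a)%:C%C.
Proof.
move=> ab; rewrite /cint [Re \o _](_ : _ = fun=> Re c) //.
rewrite [Im \o _](_ : _ = fun=> Im c) // !rint_cst //.
by case: c => x y /=; apply/eqP; rewrite eq_complex /= !mulr0 subr0 add0r !eqxx.
Qed.

Lemma cint_split a b c f : a <= b -> b <= c -> cintegrable a c f ->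
  cint a c f = cint a b f + cint b c f.
Proof. by move=> ab bc [hf hg]; rewrite /cint (rint_split ab bc hf) (rint_split ab bc hg). Qed.

(** The factor 2 comes from bounding real and imaginary parts separately. *)
Lemma modulus_cint a b f M : a <= b -> cintegrable a b f ->
  (forall x, a <= x <= b -> modulus (f x) <= M) ->
  modulus (cint a b f) <= 2 * M * (b - a).
Proof.
move=> ab [hf hg] h; apply: le_trans (modulus_ReIm _) _ => /=.
have h1 : `|rint a b (Re \o f)| <= M * (b - a).
  by apply: normr_rint => // x /h; apply: le_trans; exact: normr_Re.
have h2 : `|rint a b (Im \o f)| <= M * (b - a).
  by apply: normr_rint => // x /h; apply: le_trans; exact: normr_Im.
by apply: le_trans (lerD h1 h2) _; rewrite -mulrDl; lra.
Qed.

Definition ccont f x := forall e : R, 0 < e -> exists2 r : R, 0 < r &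
  forall y, `|y - x| < r -> modulus (f y - f x) <= e.

Lemma cintegrable_cont a b f : (forall x, a <= x <= b -> ccont f x) -> cintegrable a b f.
Proof.
move=> h; split; apply: rintegrable_cont => x /h fx; apply/cvgrPdist_le => e /fx[r r0 hr];
  apply/nbhs_ballP; exists r => // y; rewrite /ball /= distrC => /hr;
  apply: le_trans; rewrite distrC.
- rewrite -[- Re _]raddfN -Re_add; exact: normr_Re.
- rewrite -[- Im _]raddfN -Im_add; exact: normr_Im.
Qed.

End SegmentIntegral.

(** * Integrals over boundaries of rectangles *)

Section RectangleIntegral.
Variable R : realType.
Local Notation C := (complex_complex__canonical__Num_NumField R).
Local Notation Re := (@complex.Re R).
Local Notation Im := (@complex.Im R).
Local Notation modulus := (@modulus R).
Implicit Types (a b c d x y : R) (z w : C) (f g : C -> C).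

Definition pt x y : C := (x +i* y)%C.

Definition cont_at f z := forall e : R, 0 < e ->
  exists2 r : R, 0 < r & forall w, modulus (w - z) < r -> modulus (f w - f z) <= e.

Lemma has_deriv_bound f z (d : C) : has_deriv f z d -> exists2 r : R, 0 < r &
  forall w, modulus (w - z) < r -> modulus (f w - f z) <= (modulus d + 1) * modulus (w - z).
Proof.
move=> /(_ 1 ltr01)[r r0 h]; exists r => // w /h; rewrite mul1r => {}h.
rewrite -[f w - f z](subrK (d * (w - z))).
by apply: le_trans (modulusD _ _) _; rewrite modulusM mulrDl mul1r addrC lerD2l.
Qed.

Lemma derivable_cont f z : derivable f z 1 -> cont_at f z.
Proof.
move=> /derivable_has_deriv[d /has_deriv_bound[r r0 h]] e e0.
have d0 : 0 < modulus d + 1 by have := modulus_ge0 d; lra.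
exists (Num.min r (e / (modulus d + 1))); first by rewrite lt_min r0 divr_gt0.
move=> w; rewrite lt_min => /andP[/h wr]; rewrite ltr_pdivlMr // mulrC => we.
by apply: le_trans wr _; exact: ltW.
Qed.

Definition bdry a b c d : set C := [set z |
  (a <= Re z <= b) /\ (Im z = c \/ Im z = d) \/
  (c <= Im z <= d) /\ (Re z = a \/ Re z = b)].

Definition rcont f a b c d := forall z, bdry a b c d z -> cont_at f z.

(** The contour integral counterclockwise; each pair of parallel sides is
    traversed together, which turns it into two integrals of differences. *)
Definition rectint f a b c d : C :=
  cint a b (fun x => f (pt x c) - f (pt x d)) +
  'i%C * cint c d (fun y => f (pt b y) - f (pt a y)).

Lemma ccont_h f y x : cont_at f (pt x y) -> ccont (fun t => f (pt t y)) x.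
Proof.
move=> h e /h[r r0 hr]; exists r => // t tr; apply: hr.
by rewrite /pt -[X in modulus X]/((t - x) +i* (y - y))%C modulus_pt subrr expr0n addr0 sqrtr_sqr.
Qed.

Lemma ccont_v f y x : cont_at f (pt x y) -> ccont (fun t => f (pt x t)) y.
Proof.
move=> h e /h[r r0 hr]; exists r => // t tr; apply: hr.
by rewrite /pt -[X in modulus X]/((x - x) +i* (t - y))%C modulus_pt subrr expr0n add0r sqrtr_sqr.
Qed.

Lemma bdry_sides a b c d x y : a <= b -> c <= d ->
  (a <= x <= b -> bdry a b c d (pt x c) /\ bdry a b c d (pt x d)) /\
  (c <= y <= d -> bdry a b c d (pt a y) /\ bdry a b c d (pt b y)).
Proof. by move=> ab cd; split=> h; split; rewrite /bdry /=; auto. Qed.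

Section Sides.
Variables (f : C -> C) (a b c d : R).
Hypotheses (ab : a <= b) (cd : c <= d) (fc : rcont f a b c d).

Lemma cintegrable_bot : cintegrable a b (fun x => f (pt x c)).
Proof.
by apply: cintegrable_cont => x /(bdry_sides x 0 ab cd).1[/fc h _]; exact: ccont_h.
Qed.
Lemma cintegrable_top : cintegrable a b (fun x => f (pt x d)).
Proof.
by apply: cintegrable_cont => x /(bdry_sides x 0 ab cd).1[_ /fc h]; exact: ccont_h.
Qed.
Lemma cintegrable_left : cintegrable c d (fun y => f (pt a y)).
Proof.
by apply: cintegrable_cont => y /(bdry_sides 0 y ab cd).2[/fc h _]; exact: ccont_v.
Qed.
Lemma cintegrable_right : cintegrable c d (fun y => f (pt b y)).
Proof.
by apply: cintegrable_cont => y /(bdry_sides 0 y ab cd).2[_ /fc h]; exact: ccont_v.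
Qed.

End Sides.

Lemma rectD f g a b c d : a <= b -> c <= d -> rcont f a b c d -> rcont g a b c d ->
  rectint (fun z => f z + g z) a b c d = rectint f a b c d + rectint g a b c d.
Proof.
move=> ab cd fc gc; rewrite /rectint addrACA -mulrDr -!cintD.
- by congr (_ + _ * _); apply: eq_cint => x _; rewrite opprD addrACA.
- by apply: cintegrableB; [exact: cintegrable_right fc|exact: cintegrable_left fc].
- by apply: cintegrableB; [exact: cintegrable_right gc|exact: cintegrable_left gc].
- by apply: cintegrableB; [exact: cintegrable_bot fc|exact: cintegrable_top fc].
- by apply: cintegrableB; [exact: cintegrable_bot gc|exact: cintegrable_top gc].
Qed.

Lemma rectZ f (k : C) a b c d : a <= b -> c <= d -> rcont f a b c d ->
  rectint (fun z => k * f z) a b c d = k * rectint f a b c d.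
Proof.
move=> ab cd fc; rewrite /rectint mulrDr mulrCA; congr (_ + _ * _).
- rewrite -cintZ; first by apply: eq_cint => x _; rewrite mulrBr.
  by apply: cintegrableB; [exact: cintegrable_bot fc|exact: cintegrable_top fc].
- rewrite -cintZ; first by apply: eq_cint => x _; rewrite mulrBr.
  by apply: cintegrableB; [exact: cintegrable_right fc|exact: cintegrable_left fc].
Qed.

Lemma eq_rect f g a b c d : a <= b -> c <= d ->
  (forall z, bdry a b c d z -> f z = g z) -> rectint f a b c d = rectint g a b c d.
Proof.
move=> ab cd h; rewrite /rectint; congr (_ + _ * _); apply: eq_cint => x.
  by move=> /(bdry_sides x 0 ab cd).1[/h -> /h ->].
by move=> /(bdry_sides 0 x ab cd).2[/h -> /h ->].
Qed.

Lemma modulus_rect f a b c d M : a <= b -> c <= d -> rcont f a b c d ->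
  (forall z, bdry a b c d z -> modulus (f z) <= M) ->
  modulus (rectint f a b c d) <= 4 * M * ((b - a) + (d - c)).
Proof.
move=> ab cd fc h; apply: le_trans (modulusD _ _) _.
rewrite modulusM modulusi mul1r mulrDr (_ : 4 * M = 2 * (M + M)); last by ring.
apply: lerD; apply: modulus_cint => //.
- by apply: cintegrableB; [exact: cintegrable_bot fc|exact: cintegrable_top fc].
- move=> x /(bdry_sides x 0 ab cd).1[/h h1 /h h2].
  by apply: le_trans (modulusD _ _) _; rewrite modulusN lerD.
- by apply: cintegrableB; [exact: cintegrable_right fc|exact: cintegrable_left fc].
- move=> x /(bdry_sides 0 x ab cd).2[/h h1 /h h2].
  by apply: le_trans (modulusD _ _) _; rewrite modulusN lerD.
Qed.

Lemma rect_vsplit f a b c d e : a <= e -> e <= b -> c <= d ->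
  rcont f a e c d -> rcont f e b c d ->
  rectint f a b c d = rectint f a e c d + rectint f e b c d.
Proof.
move=> ae eb cd f1 f2; have ab := le_trans ae eb.
have fc : rcont f a b c d.
  move=> z [[/andP[za zb] zcd]|[zcd [za|zb]]].
  - have [ze|ez] := leP (Re z) e.
      by apply: f1; left; rewrite za ze.
    by apply: f2; left; rewrite zb (ltW ez).
  - by apply: f1; right; auto.
  - by apply: f2; right; auto.
rewrite /rectint addrACA -mulrDr; congr (_ + _ * _).
  by apply: cint_split => //; apply: cintegrableB; [exact: cintegrable_bot fc|exact: cintegrable_top fc].
rewrite -cintD; [by apply: eq_cint => y _; ring| |].
- by apply: cintegrableB; [exact: cintegrable_right f1|exact: cintegrable_left f1].
- by apply: cintegrableB; [exact: cintegrable_right f2|exact: cintegrable_left f2].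
Qed.

Lemma rect_hsplit f a b c d e : c <= e -> e <= d -> a <= b ->
  rcont f a b c e -> rcont f a b e d ->
  rectint f a b c d = rectint f a b c e + rectint f a b e d.
Proof.
move=> ce ed ab f1 f2; have cd := le_trans ce ed.
have fc : rcont f a b c d.
  move=> z [[zab [zc|zd]]|[/andP[zc zd] zab]].
  - by apply: f1; left; auto.
  - by apply: f2; left; auto.
  - have [ze|ez] := leP (Im z) e.
      by apply: f1; right; rewrite zc ze.
    by apply: f2; right; rewrite zd (ltW ez).
rewrite /rectint addrACA -mulrDr; congr (_ + _ * _); last first.
  by apply: cint_split => //; apply: cintegrableB; [exact: cintegrable_right fc|exact: cintegrable_left fc].
rewrite -cintD; [by apply: eq_cint => y _; ring| |].
- by apply: cintegrableB; [exact: cintegrable_bot f1|exact: cintegrable_top f1].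
- by apply: cintegrableB; [exact: cintegrable_bot f2|exact: cintegrable_top f2].
Qed.

(** The differences over opposite sides are constant, and the two contributions
    cancel. *)
Lemma rect_affine (A B : C) a b c d : a <= b -> c <= d ->
  rectint (fun z => A + B * z) a b c d = 0.
Proof.
move=> ab cd; rewrite /rectint.
rewrite (@eq_cint _ a b _ (fun=> B * pt 0 (c - d))); last first.
  move=> x _; rewrite opprD addrACA subrr add0r -mulrBr; congr (_ * _).
  by rewrite /pt /=; apply/eqP; rewrite eq_complex /= subrr !eqxx.
rewrite (@eq_cint _ c d _ (fun=> B * pt (b - a) 0)); last first.
  move=> x _; rewrite opprD addrACA subrr add0r -mulrBr; congr (_ * _).
  by rewrite /pt /=; apply/eqP; rewrite eq_complex /= subrr !eqxx.
rewrite !cint_cst // mulrCA -!mulrA -mulrDr; apply/eqP; rewrite mulf_eq0; apply/orP; right.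
by rewrite eq_complex /=; apply/andP; split; apply/eqP; ring.
Qed.

End RectangleIntegral.

(** * Goursat's lemma *)

Section PointwiseRules.
Variable C : numFieldType.
Implicit Types (f g : C -> C) (z k : C).

Lemma drv_cst k z : derivable (fun=> k : C) z (1 : C).
Proof. exact: derivable_cst. Qed.

Lemma drv_id z : derivable (fun w : C => w) z 1.
Proof. exact: derivable_id. Qed.

Lemma drvD f g z : derivable f z 1 -> derivable g z 1 ->
  derivable (fun w => f w + g w) z 1.
Proof. exact: derivableD. Qed.

Lemma drvN f z : derivable f z 1 -> derivable (fun w => - f w) z 1.
Proof. exact: derivableN. Qed.

Lemma drvB f g z : derivable f z 1 -> derivable g z 1 ->
  derivable (fun w => f w - g w) z 1.
Proof. exact: derivableB. Qed.

Lemma drvM f g z : derivable f z 1 -> derivable g z 1 ->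
  derivable (fun w => f w * g w) z 1.
Proof. exact: derivableM. Qed.

Lemma drvV f z : f z != 0 -> derivable f z 1 -> derivable (fun w => (f w)^-1) z 1.
Proof. exact: derivableV. Qed.

Lemma drvX f n z : derivable f z 1 -> derivable (fun w => f w ^+ n) z 1.
Proof.
move=> hf; elim: n => [|n IH]; first exact: drv_cst.
rewrite (_ : (fun w => _) = fun w => f w * f w ^+ n); first exact: drvM.
by apply/funext => w; rewrite exprS.
Qed.

Lemma drv_invB z w : z != w -> derivable (fun s : C => (s - w)^-1) z 1.
Proof.
move=> zw; apply: drvV; first by rewrite subr_eq0.
by apply: drvB; [exact: drv_id|exact: drv_cst].
Qed.

End PointwiseRules.
Arguments drv_cst {C} k z.
Arguments drv_id {C} z.
Arguments drvD {C f g z} _ _.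
Arguments drvN {C f z} _.
Arguments drvB {C f g z} _ _.
Arguments drvM {C f g z} _ _.
Arguments drvV {C f z} _ _.
Arguments drvX {C f} n {z} _.
Arguments drv_invB {C z w} _.

Section Cauchy.
Variable R : realType.
Local Notation C := (complex_complex__canonical__Num_NumField R).
Local Notation Re := (@complex.Re R).
Local Notation Im := (@complex.Im R).
Local Notation modulus := (@modulus R).
Local Notation pt := (@pt R).
Implicit Types (a b c d x y e r : R) (z w : C) (f g : C -> C).

Lemma midpoint_itv a b : a <= b -> a <= (a + b) / 2 /\ (a + b) / 2 <= b.
Proof. by move=> ab; split; lra. Qed.

Lemma halves a b : (a + b) / 2 - a = (b - a) / 2 /\ b - (a + b) / 2 = (b - a) / 2.
Proof. by split; field. Qed.

Lemma nested_intervals (a b : nat -> R) :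
  (forall n, [/\ a n <= a n.+1, b n.+1 <= b n & a n <= b n]) ->
  exists x, forall n, a n <= x <= b n.
Proof.
move=> h.
have an m n : (m <= n)%N -> a m <= a n.
  move=> /subnK <-; elim: (n - m)%N => [|k IH] //.
  by apply: le_trans IH _; case: (h (k + m)%N).
have bn m n : (m <= n)%N -> b n <= b m.
  move=> /subnK <-; elim: (n - m)%N => [|k IH] //.
  by apply: le_trans IH; case: (h (k + m)%N).
have ab m n : a m <= b n.
  have [_ _ H] := h (maxn m n).
  apply: le_trans (an _ _ (leq_maxl m n)) _; apply: le_trans H _.
  exact: bn (leq_maxr m n).
have hs : has_sup (range a).
  split; first by exists (a 0%N), 0%N.
  by exists (b 0%N) => _ [n _ <-].
exists (sup (range a)) => n; apply/andP; split.
  by apply: sup_upper_bound => //; exists n.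
by apply: ge_sup => [|_ [m _ <-]] //; exists (a 0%N), 0%N.
Qed.

Lemma halving_small (l r : R) : 0 < r -> exists n, l / 2 ^+ n < r.
Proof.
move=> r0; pose n := Num.bound `|l / r|; exists n.
have h : l / r < 2 ^+ n.
  apply: le_lt_trans (ler_norm _) _; apply: lt_trans (archi_boundP (normr_ge0 _)) _.
  rewrite -/n.
  by rewrite -natrX ltr_nat ltn_expl.
by rewrite ltr_pdivrMr ?exprn_gt0 //; move: h; rewrite ltr_pdivrMr // mulrC.
Qed.

(** Compactness of a rectangle in a form suited to both uses below: a property
    inherited from the four quarters of a rectangle, and true of all small
    rectangles around any given point, holds.  Otherwise repeated halving gives
    nested rectangles where it fails, shrinking to a point. *)
Lemma quadrisection (P : R -> R -> R -> R -> Prop) a0 b0 c0 d0 :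
  a0 <= b0 -> c0 <= d0 ->
  (forall a b c d, a0 <= a -> a <= b -> b <= b0 -> c0 <= c -> c <= d -> d <= d0 ->
    let m := (a + b) / 2 in let n := (c + d) / 2 in
    P a m c n -> P m b c n -> P a m n d -> P m b n d -> P a b c d) ->
  (forall x y, a0 <= x <= b0 -> c0 <= y <= d0 -> exists2 r, 0 < r &
    forall a b c d, a0 <= a -> b <= b0 -> c0 <= c -> d <= d0 ->
      a <= x <= b -> c <= y <= d -> b - a < r -> d - c < r -> P a b c d) ->
  P a0 b0 c0 d0.
Proof.
move=> ab0 cd0 hstep hloc; apply: contrapT => nP0.
pose T : Type := (R * R * (R * R))%type.
pose bad (s : T) := let: ((a, b), (c, d)) := s in
  [/\ a0 <= a, a <= b & b <= b0] /\ [/\ c0 <= c, c <= d & d <= d0] /\ ~ P a b c d.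
pose sub (s t : T) := let: ((a, b), (c, d)) := s in let: ((a', b'), (c', d')) := t in
  [/\ a <= a', b' <= b & b' - a' = (b - a) / 2] /\
  [/\ c <= c', d' <= d & d' - c' = (d - c) / 2].
have step (s : {s | bad s}) : exists t : {s | bad s}, sub (sval s) (sval t).
  case: s => [[[a b] [c d]] /= [[h1 h2 h3] [[k1 k2 k3] nP]]].
  apply: contrapT => nex; apply: nP.
  have H t : sub ((a, b), (c, d)) t -> ~ bad t.
    by move=> st bt; apply: nex; exists (exist _ t bt).
  have Q a' b' c' d' : a <= a' -> a' <= b' -> b' <= b -> b' - a' = (b - a) / 2 ->
     c <= c' -> c' <= d' -> d' <= d -> d' - c' = (d - c) / 2 -> P a' b' c' d'.
    move=> p1 p2 p3 p4 q1 q2 q3 q4; apply: contrapT => nP.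
    apply: (H ((a', b'), (c', d'))); first by [].
    split; first by split=> //; [exact: le_trans p1|exact: le_trans h3].
    by split=> //; split=> //; [exact: le_trans q1|exact: le_trans k3].
  have [m1 m2] := midpoint_itv h2; have [n1 n2] := midpoint_itv k2.
  have [? ?] := halves a b; have [? ?] := halves c d.
  by apply: hstep => //; apply: Q.
have [F hF] := choice step.
have bad0 : bad ((a0, b0), (c0, d0)) by [].
pose u n := sval (iter n F (exist _ _ bad0)).
have us n : sub (u n) (u n.+1) by exact: hF.
have ub n : bad (u n) by exact: (proj2_sig (iter n F _)).
pose a n := (u n).1.1; pose b n := (u n).1.2; pose c n := (u n).2.1; pose d n := (u n).2.2.
have Hs n : [/\ a n <= a n.+1, b n.+1 <= b n & b n.+1 - a n.+1 = (b n - a n) / 2] /\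
  [/\ c n <= c n.+1, d n.+1 <= d n & d n.+1 - c n.+1 = (d n - c n) / 2].
  by have := us n; rewrite /a /b /c /d; case: (u n) => [[? ?] [? ?]]; case: (u n.+1) => [[? ?] [? ?]].
have Hb n : [/\ a0 <= a n, a n <= b n & b n <= b0] /\
  [/\ c0 <= c n, c n <= d n & d n <= d0] /\ ~ P (a n) (b n) (c n) (d n).
  by have := ub n; rewrite /a /b /c /d; case: (u n) => [[? ?] [? ?]].
have [x hx] : exists x, forall n, a n <= x <= b n.
  apply: nested_intervals => n; have [[h1 h2 _] _] := Hs n.
  by have [[_ h3 _] _] := Hb n.
have [y hy] : exists y, forall n, c n <= y <= d n.
  apply: nested_intervals => n; have [_ [h1 h2 _]] := Hs n.
  by have [_ [[_ h3 _] _]] := Hb n.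
have wab n : b n - a n = (b0 - a0) / 2 ^+ n.
  elim: n => [|n IH]; first by rewrite expr0 divr1.
  by have [[_ _ ->] _] := Hs n; rewrite IH exprSr invfM mulrA.
have wcd n : d n - c n = (d0 - c0) / 2 ^+ n.
  elim: n => [|n IH]; first by rewrite expr0 divr1.
  by have [_ [_ _ ->]] := Hs n; rewrite IH exprSr invfM mulrA.
have [r r0 hr] := hloc x y (hx 0%N) (hy 0%N).
have [n hn] := halving_small (b0 - a0 + (d0 - c0)) r0.
have [[? ? ?] [[? ? ?] nP]] := Hb n.
have p0 : 0 < (2 : R) ^- n by rewrite invr_gt0 exprn_gt0.
have h1 : 0 <= (b0 - a0) / 2 ^+ n by apply: mulr_ge0; [rewrite subr_ge0|exact: ltW].
have h2 : 0 <= (d0 - c0) / 2 ^+ n by apply: mulr_ge0; [rewrite subr_ge0|exact: ltW].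
by apply: nP; apply: hr => //; rewrite ?wab ?wcd; move: hn h1 h2; rewrite mulrDl; lra.
Qed.

Definition in_rect a b c d z := (a <= Re z <= b) /\ (c <= Im z <= d).

Lemma in_rect_sub a b c d a' b' c' d' z : a <= a' -> b' <= b -> c <= c' -> d' <= d ->
  in_rect a' b' c' d' z -> in_rect a b c d z.
Proof.
move=> h1 h2 h3 h4 [/andP[p1 p2] /andP[p3 p4]]; split; apply/andP; split.
- exact: le_trans p1. - exact: le_trans h2.
- exact: le_trans p3. - exact: le_trans h4.
Qed.

Lemma bdry_in_rect a b c d z : a <= b -> c <= d -> bdry a b c d z -> in_rect a b c d z.
Proof.
by move=> ab cd [[h [e|e]]|[h [e|e]]]; split=> //; rewrite e lexx ?ab ?cd.
Qed.

Lemma derivable_rcont f a b c d : a <= b -> c <= d ->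
  (forall z, in_rect a b c d z -> derivable f z 1) -> rcont f a b c d.
Proof.
by move=> ab cd h z /(bdry_in_rect ab cd) /h; exact: derivable_cont.
Qed.

Lemma rcont_D f g a b c d : rcont f a b c d -> rcont g a b c d ->
  rcont (fun z => f z + g z) a b c d.
Proof.
move=> fc gc z bz e e0; have e2 : 0 < e / 2 by rewrite divr_gt0.
have [r r0 hr] := fc z bz _ e2; have [s s0 hs] := gc z bz _ e2.
exists (Num.min r s); first by rewrite lt_min r0.
move=> w; rewrite lt_min => /andP[/hr h1 /hs h2].
rewrite opprD addrACA; apply: le_trans (modulusD _ _) _; lra.
Qed.

(** The bound to be proved is a small multiple of the square of the perimeter:
    halving the sides divides it by four, and near a point the integral of f is
    that of the remainder of its first-order expansion, as affine functions
    integrate to zero. *)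
Lemma goursat f a b c d : a <= b -> c <= d ->
  (forall z, in_rect a b c d z -> derivable f z 1) -> rectint f a b c d = 0.
Proof.
move=> ab cd hf; apply: modulus_small => e e0.
pose L := (b - a) + (d - c).
have L0 : 0 <= L by rewrite /L; lra.
pose e' := e / (4 * L ^+ 2 + 1).
have q0 : 0 < 4 * L ^+ 2 + 1 by have := sqr_ge0 L; lra.
have e'0 : 0 < e' by rewrite divr_gt0.
suff : modulus (rectint f a b c d) <= 4 * e' * L ^+ 2.
  move=> h; apply: le_trans h _.
  have -> : e = e' * (4 * L ^+ 2 + 1) by rewrite /e' divfK // gt_eqF.
  by rewrite mulrDr mulr1 mulrA [e' * 4]mulrC lerDl ltW.
rewrite /L.
apply: (quadrisection (P := fun a b c d => modulus (rectint f a b c d) <= 4 * e' * (b - a + (d - c)) ^+ 2)) => //.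
- move=> a1 b1 c1 d1 h1 h2 h3 k1 k2 k3 m n P1 P2 P3 P4.
  have cont a' b' c' d' : a1 <= a' -> a' <= b' -> b' <= b1 -> c1 <= c' ->
      c' <= d' -> d' <= d1 -> rcont f a' b' c' d'.
    move=> e1 e2 e3 e4 e5 e6; apply: derivable_rcont => // z /in_rect_sub hz; apply: hf.
    by apply: hz; [exact: le_trans e1|exact: le_trans h3|exact: le_trans e4|exact: le_trans k3].
  have [am mb] := midpoint_itv h2; have [cn nd] := midpoint_itv k2.
  rewrite (rect_vsplit am mb k2); [|by apply: cont..].
  rewrite (rect_hsplit cn nd am); [|by apply: cont..].
  rewrite (rect_hsplit cn nd mb); [|by apply: cont..].
  have nD (z w : C) x y : modulus z <= x -> modulus w <= y -> modulus (z + w) <= x + y.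
    by move=> hz hw; apply: le_trans (modulusD _ _) _; exact: lerD.
  apply: le_trans (nD _ _ _ _ (nD _ _ _ _ P1 P3) (nD _ _ _ _ P2 P4)) _.
  rewrite le_eqVlt; apply/orP; left; apply/eqP; rewrite /m /n; by field.
- move=> x y hx hy.
  have /derivable_has_deriv[k hk] : derivable f (pt x y) 1 by apply: hf.
  have [r r0 hr] := hk _ e'0.
  exists (r / 2); first by rewrite divr_gt0.
  move=> a1 b1 c1 d1 h1 h2 h3 h4 hx1 hy1 w1 w2.
  have ab1 : a1 <= b1 by case/andP: hx1 => p q; exact: le_trans p q.
  have cd1 : c1 <= d1 by case/andP: hy1 => p q; exact: le_trans p q.
  pose p := pt x y; pose g z := f z - f p - k * (z - p).
  pose h z := (f p - k * p) + k * z.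
  have fc : rcont f a1 b1 c1 d1.
    by apply: derivable_rcont => // z /in_rect_sub hz; apply: hf; exact: hz.
  have hc : rcont (fun z => - h z) a1 b1 c1 d1.
    apply: (derivable_rcont ab1 cd1) => z _.
    exact: (drvN (drvD (drv_cst (f p - k * p) z) (drvM (drv_cst k z) (drv_id z)))).
  have gE : g = fun z => f z + - h z by apply/funext => z; rewrite /g /h; ring.
  have gc : rcont g a1 b1 c1 d1 by rewrite gE; exact: rcont_D.
  have fE : f = fun z => g z + h z by apply/funext => z; rewrite /g /h; ring.
  have hc' : rcont h a1 b1 c1 d1.
    move=> z bz e1 /(hc z bz)[s s0 hs]; exists s => // w /hs.
    by rewrite -opprD modulusN.
  rewrite [in rectint f]fE rectD // [X in _ + X]rect_affine // addr0.
  rewrite expr2 mulrA -[4 * e' * _]mulrA; apply: modulus_rect => // z /(bdry_in_rect ab1 cd1)[/andP[? ?] /andP[? ?]].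
  case/andP: hx1 => ? ?; case/andP: hy1 => ? ?.
  have zp : modulus (z - p) <= (b1 - a1) + (d1 - c1).
    apply: le_trans (modulus_ReIm _) _; rewrite Re_add Im_add !raddfN /=.
    by apply: lerD; rewrite ler_norml; apply/andP; split; lra.
  apply: le_trans (hr _ _) _; first by apply: le_lt_trans zp _; lra.
  by rewrite ler_wpM2l // ltW.
Qed.

End Cauchy.

(** * The Cauchy kernel *)

Section CauchyFormula.
Variable R : realType.
Local Notation C := (complex_complex__canonical__Num_NumField R).
Local Notation Re := (@complex.Re R).
Local Notation Im := (@complex.Im R).
Local Notation modulus := (@modulus R).
Implicit Types (a b c d x y e r : R) (z w : C) (f g : C -> C).

(** The contour may be moved inwards: the frame between the two rectangles is
    cut into four rectangles, on each of which the integral vanishes. *)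
Lemma rect_frame f a b c d a1 b1 c1 d1 :
  a <= a1 -> a1 <= b1 -> b1 <= b -> c <= c1 -> c1 <= d1 -> d1 <= d ->
  (forall z, in_rect a b c d z ->
    [\/ Re z <= a1, b1 <= Re z, Im z <= c1 | d1 <= Im z] -> derivable f z 1) ->
  rectint f a b c d = rectint f a1 b1 c1 d1.
Proof.
move=> aa ab bb cc cd dd hf.
have HB a' b' c' d' : a <= a' -> a' <= a1 -> b1 <= b' -> b' <= b ->
    c <= c' -> c' <= c1 -> d1 <= d' -> d' <= d -> rcont f a' b' c' d'.
  move=> h1 h2 h3 h4 h5 h6 h7 h8 z zb; apply: derivable_cont; apply: hf.
    have a'b' : a' <= b' by apply: le_trans h2 (le_trans ab h3).
    have c'd' : c' <= d' by apply: le_trans h6 (le_trans cd h7).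
    exact: in_rect_sub (bdry_in_rect a'b' c'd' zb).
  by case: zb => -[_ [->|->]]; [apply: Or43|apply: Or44|apply: Or41|apply: Or42].
have HG a' b' c' d' : a <= a' -> a' <= b' -> b' <= b -> c <= c' -> c' <= d' -> d' <= d ->
    (forall z, in_rect a' b' c' d' z ->
      [\/ Re z <= a1, b1 <= Re z, Im z <= c1 | d1 <= Im z]) ->
    rcont f a' b' c' d' /\ rectint f a' b' c' d' = 0.
  move=> h1 h2 h3 h4 h5 h6 hz.
  have H z : in_rect a' b' c' d' z -> derivable f z 1.
    by move=> zr; apply: hf; [exact: in_rect_sub zr|exact: hz].
  by split; [exact: derivable_rcont|exact: goursat].
have a1b := le_trans ab bb; have c1d := le_trans cd dd.
have cd' := le_trans cc c1d; have ab' := le_trans aa a1b.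
have [k1 e1] : rcont f a a1 c d /\ rectint f a a1 c d = 0.
  by apply: HG => // z [/andP[_ h] _]; exact: Or41.
have [k2 e2] : rcont f b1 b c d /\ rectint f b1 b c d = 0.
  by apply: HG => //; [exact: le_trans ab|move=> z [/andP[h _] _]; exact: Or42].
have [k3 e3] : rcont f a1 b1 c c1 /\ rectint f a1 b1 c c1 = 0.
  by apply: HG => // z [_ /andP[_ h]]; exact: Or43.
have [k4 e4] : rcont f a1 b1 d1 d /\ rectint f a1 b1 d1 d = 0.
  by apply: HG => //; [exact: le_trans cd|move=> z [_ /andP[h _]]; exact: Or44].
rewrite (rect_vsplit aa a1b cd' k1); last exact: HB.
rewrite e1 add0r (rect_vsplit ab bb cd' _ k2); last exact: HB.
rewrite e2 addr0 (rect_hsplit cc c1d ab k3); last exact: HB.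
rewrite e3 add0r (rect_hsplit cd dd ab _ k4); last exact: HB.
by rewrite e4 addr0.
Qed.

(** The number 2 pi i. *)
Definition cauchy_const : C := rectint (fun s : C => s^-1) (-1) 1 (-1) 1.

Lemma bdry_square_modulus M z : 0 < M -> bdry (- M) M (- M) M z -> M <= modulus z.
Proof.
move=> M0 [[_ e]|[_ e]].
  by apply: le_trans (normr_Im z); case: e => ->; rewrite ?normrN gtr0_norm.
by apply: le_trans (normr_Re z); case: e => ->; rewrite ?normrN gtr0_norm.
Qed.

(** Enlarging the square makes the difference of the kernels at w and at 0
    arbitrarily small, while none of the two integrals changes. *)
Lemma cauchy_kernel w a b c d : a < Re w < b -> c < Im w < d ->
  rectint (fun s : C => (s - w)^-1) a b c d = cauchy_const.
Proof.
move=> /andP[aw wb] /andP[cw wd].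
have ab : a <= b by apply: ltW; exact: lt_trans wb.
have cd : c <= d by apply: ltW; exact: lt_trans wd.
apply/eqP; rewrite -subr_eq0; apply/eqP/modulus_small => e e0.
have nw := modulus_ge0 w.
have q0 : 0 <= 32 * modulus w / e by rewrite divr_ge0 ?mulr_ge0 // ltW.
(* a square containing the rectangle, so large that the final estimate is at
   most e *)
have [M [[Ma Mb Mc Md] [M1 Mw ME]]] : exists M, [/\ - M <= a, b <= M, - M <= c & d <= M] /\
    [/\ 1 <= M, modulus w < M & 32 * modulus w / e + modulus w < M].
  exists (`|a| + `|b| + `|c| + `|d| + 1 + modulus w + 1 + 32 * modulus w / e).
  have nn (u : R) := conj (normr_ge0 u) (conj (ler_norm u) (lerNnormlW (lexx `|u|))).
  have [a1 [a2 a3]] := nn a; have [b1 [b2 b3]] := nn b.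
  have [c1 [c2 c3]] := nn c; have [d1 [d2 d3]] := nn d.
  by clear aw wb cw wd ab cd e0; split; split; lra.
have M0 : 0 < M by clear -M1; lra.
have MM : - M <= M by clear -M0; lra.
have Mw0 : 0 < M - modulus w by rewrite subr_gt0.
have dr (v z : C) : z != v -> derivable (fun s => (s - v)^-1) z 1 by exact: drv_invB.
have -> : rectint (fun s => (s - w)^-1) a b c d =
          rectint (fun s => (s - w)^-1) (- M) M (- M) M.
  symmetry; apply: rect_frame => // z _ h; apply: dr; apply/eqP => zw.
  by move: h; rewrite zw => -[]; rewrite leNgt ?aw ?wb ?cw ?wd.
have -> : cauchy_const = rectint (fun s => s^-1) (- M) M (- M) M.
  symmetry; apply: rect_frame; rewrite ?lerN2 //; try by clear; lra.
  move=> z _ h; apply: drvV; last exact: drv_id.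
  by apply/eqP => z0; move: h; rewrite z0 /=; clear; case; lra.
have wb' z : bdry (- M) M (- M) M z -> (M - modulus w <= modulus (z - w)) /\ (M <= modulus z).
  move=> /(bdry_square_modulus M0) h; split=> //.
  by have := modulusD (z - w) w; rewrite subrK; clear -h; lra.
have zw z : bdry (- M) M (- M) M z -> (z - w != 0) /\ (z != 0).
  by move=> /wb'[h1 h2]; rewrite -!modulus_gt0; split; [exact: lt_le_trans h1|exact: lt_le_trans h2].
have kc : rcont (fun s => (s - w)^-1) (- M) M (- M) M.
  by move=> z /zw[]; rewrite subr_eq0 => h _; apply: derivable_cont; exact: dr.
have kc0 : rcont (fun s : C => s^-1) (- M) M (- M) M.
  by move=> z /zw[_ h]; apply: derivable_cont; apply: drvV => //; exact: drv_id.
have kc1 : rcont (fun s : C => -1 * s^-1) (- M) M (- M) M.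
  move=> z /zw[_ h]; apply: derivable_cont; apply: drvM; first exact: drv_cst.
  by apply: drvV => //; exact: drv_id.
have -> : rectint (fun s => (s - w)^-1) (- M) M (- M) M
          - rectint (fun s => s^-1) (- M) M (- M) M =
  rectint (fun s => (s - w)^-1 + -1 * s^-1) (- M) M (- M) M.
  by rewrite rectD // rectZ // mulN1r.
apply: le_trans (modulus_rect (M := modulus w / (M * (M - modulus w))) MM MM _ _) _.
- exact: rcont_D.
- move=> z /[dup] /zw[h1 h2] /wb'[h3 h4].
  have -> : (z - w)^-1 + -1 * z^-1 = w / (z * (z - w)) by field; rewrite h1.
  rewrite modulusM modulusV modulusM.
  rewrite ler_wpM2l // lef_pV2 ?posrE ?mulr_gt0 //; last 1 first.
  - by apply: lt_le_trans h3.
  - by apply: ler_pM => //; exact: ltW.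
  - by apply: lt_le_trans h4.
have -> : 4 * (modulus w / (M * (M - modulus w))) * (M - - M + (M - - M)) =
   16 * modulus w / (M - modulus w) by field; rewrite !gt_eqF.
rewrite ler_pdivrMr //.
have -> : 16 * modulus w = e * (16 * modulus w / e) by field; rewrite gt_eqF.
rewrite ler_wpM2l // ?ltW //.
have -> : 16 * modulus w / e = (32 * modulus w / e) / 2 by field; rewrite gt_eqF.
have X0 := q0; move: ME X0; set X := 32 * modulus w / e; clear => ME X0; lra.
Qed.

Lemma Re_inv z : Re z^-1 = Re z / (Re z ^+ 2 + Im z ^+ 2).
Proof. by case: z. Qed.

Lemma Im_inv z : Im z^-1 = - (Im z / (Re z ^+ 2 + Im z ^+ 2)).
Proof. by case: z. Qed.

(** The horizontal sides contribute at least 2 to the imaginary part, and the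
    vertical ones a nonnegative amount. *)
Lemma cauchy_const_neq0 : cauchy_const != 0.
Proof.
have N11 : (-1 : R) <= 1 by lra.
have kc : rcont (fun s : C => s^-1) (-1) 1 (-1) 1.
  move=> z /(bdry_square_modulus ltr01) h; apply: derivable_cont; apply: drvV.
    by rewrite -modulus_gt0; lra.
  exact: drv_id.
suff : 2 <= Im cauchy_const.
  by apply: contraTneq => ->; rewrite /=; lra.
rewrite /cauchy_const /rectint Im_add.
set A := cint _ _ _; set B := cint _ _ _.
have -> : Im ('i%C * B) = Re B by rewrite Im_mul /= mul0r add0r mul1r.
have H1 : 1 * (1 - -1) <= Im A.
  rewrite -rint_cst //; apply: le_rint; first exact: rintegrable_cst.
    by apply: (proj2 (cintegrableB _ _)); [exact: cintegrable_bot kc|exact: cintegrable_top kc].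
  move=> x /andP[x1 x2]; rewrite /comp Im_add [Im (- _)]raddfN !Im_inv /=.
  have d0 : 0 < x ^+ 2 + 1 ^+ 2 by have := sqr_ge0 x; lra.
  rewrite sqrrN.
  have -> : - (-1 / (x ^+ 2 + 1 ^+ 2)) - - (1 / (x ^+ 2 + 1 ^+ 2)) = 2 / (x ^+ 2 + 1 ^+ 2).
    by rewrite mulNr !opprK -mulrDl.
  by rewrite ler_pdivlMr //; nra.
have H2 : 0 <= Re B.
  rewrite -[0](mul0r (1 - -1)) -rint_cst //; apply: le_rint; first exact: rintegrable_cst.
    by apply: (proj1 (cintegrableB _ _)); [exact: cintegrable_right kc|exact: cintegrable_left kc].
  move=> x /andP[x1 x2]; rewrite /comp Re_add [Re (- _)]raddfN !Re_inv /=.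
  have d0 : 0 < 1 ^+ 2 + x ^+ 2 by have := sqr_ge0 x; lra.
  rewrite sqrrN.
  have -> : 1 / (1 ^+ 2 + x ^+ 2) - (-1 / (1 ^+ 2 + x ^+ 2)) = 2 / (1 ^+ 2 + x ^+ 2).
    by rewrite mulNr opprK -mulrDl.
  by rewrite divr_ge0 // ltW.
by rewrite -[2]addr0 lerD //; lra.
Qed.

End CauchyFormula.

(** * Cauchy's formula *)

Lemma inv_taylor1 (F : fieldType) (u h : F) : u != 0 -> u - h != 0 ->
  (u - h)^-1 - u^-1 - u ^- 2 * h = h ^+ 2 / (u ^+ 2 * (u - h)).
Proof. by move=> u0 uh; field; rewrite u0 uh. Qed.

Lemma inv_taylor2 (F : fieldType) (u h : F) : u != 0 -> u - h != 0 ->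
  (u - h) ^- 2 - u ^- 2 - 2 * u ^- 3 * h =
  h ^+ 2 * (3 * u - 2 * h) / (u ^+ 3 * (u - h) ^+ 2).
Proof. by move=> u0 uh; field; rewrite u0 uh. Qed.

Lemma ler_pM3 (F : realFieldType) (p M h X Y : F) : 0 <= p -> p <= M -> 0 <= h ->
  0 <= X -> X <= Y -> p * (h * X) <= M * Y * h.
Proof.
move=> p0 pM h0 X0 XY; rewrite [h * X]mulrC mulrA ler_wpM2r //.
by apply: ler_pM.
Qed.

Section CauchyConsequences.
Variable R : realType.
Local Notation C := (complex_complex__canonical__Num_NumField R).
Local Notation Re := (@complex.Re R).
Local Notation Im := (@complex.Im R).
Local Notation modulus := (@modulus R).
Local Notation cauchy_const := (@cauchy_const R).
Implicit Types (a b c d x y e r : R) (z w s : C) (f g : C -> C).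

Definition sqbd z r := bdry (Re z - r) (Re z + r) (Im z - r) (Im z + r).
Definition sqint f z r := rectint f (Re z - r) (Re z + r) (Im z - r) (Im z + r).
Definition sqcont f z r := rcont f (Re z - r) (Re z + r) (Im z - r) (Im z + r).

Lemma modulus_le_square z s r : in_rect (Re z - r) (Re z + r) (Im z - r) (Im z + r) s ->
  modulus (s - z) <= 2 * r.
Proof.
move=> [h1 h2]; apply: le_trans (modulus_ReIm _) _.
rewrite Re_add Im_add !raddfN /= mulr2n mulrDl mul1r.
by apply: lerD; rewrite ler_distl; [rewrite h1|rewrite h2].
Qed.

Lemma sqbd_le z s r : 0 < r -> sqbd z r s -> modulus (s - z) <= 2 * r.
Proof.
move=> r0 h; apply: modulus_le_square; apply: bdry_in_rect h; lra.
Qed.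

Lemma sqbd_ge z s r : 0 < r -> sqbd z r s -> r <= modulus (s - z).
Proof.
move=> r0 [[_ e]|[_ e]].
  apply: le_trans (normr_Im _); rewrite Im_add raddfN /=.
  by case: e => ->; rewrite addrAC subrr add0r ?normrN gtr0_norm.
apply: le_trans (normr_Re _); rewrite Re_add raddfN /=.
by case: e => ->; rewrite addrAC subrr add0r ?normrN gtr0_norm.
Qed.

Lemma sqbd_away z w s r : 0 < r -> sqbd z r s -> r - modulus (w - z) <= modulus (s - w).
Proof.
move=> r0 /(sqbd_ge r0) h; rewrite lerBlDr; apply: le_trans h _.
exact: modulus_dist.
Qed.

Lemma square_interior z w r : modulus (w - z) < r ->
  (Re z - r < Re w < Re z + r) /\ (Im z - r < Im w < Im z + r).
Proof.
move=> h; rewrite -!ltr_distl; split; apply: le_lt_trans h.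
  by rewrite -[- Re z]raddfN -Re_add; exact: normr_Re.
by rewrite -[- Im z]raddfN -Im_add; exact: normr_Im.
Qed.

Lemma sq_sides z r : 0 < r -> Re z - r <= Re z + r /\ Im z - r <= Im z + r.
Proof. by move=> r0; split; lra. Qed.

Lemma sqintD f g z r : 0 < r -> sqcont f z r -> sqcont g z r ->
  sqint (fun s => f s + g s) z r = sqint f z r + sqint g z r.
Proof. by move=> /(sq_sides z)[h1 h2]; exact: rectD. Qed.

Lemma sqintZ f (k : C) z r : 0 < r -> sqcont f z r ->
  sqint (fun s => k * f s) z r = k * sqint f z r.
Proof. by move=> /(sq_sides z)[h1 h2]; exact: rectZ. Qed.

Lemma eq_sqint f g z r : 0 < r -> (forall s, sqbd z r s -> f s = g s) ->
  sqint f z r = sqint g z r.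
Proof. by move=> /(sq_sides z)[h1 h2]; exact: eq_rect. Qed.

Lemma modulus_sqint f z r M : 0 < r -> sqcont f z r ->
  (forall s, sqbd z r s -> modulus (f s) <= M) -> modulus (sqint f z r) <= 16 * M * r.
Proof.
move=> r0 fc h; have [h1 h2] := sq_sides z r0.
apply: le_trans (modulus_rect h1 h2 fc h) _.
by rewrite le_eqVlt; apply/orP; left; apply/eqP; ring.
Qed.

Lemma cont_atM f g z : cont_at f z -> cont_at g z -> cont_at (fun w => f w * g w) z.
Proof.
move=> hf hg e e0.
have nf := modulus_ge0 (f z); have ng := modulus_ge0 (g z).
pose A := modulus (f z) + modulus (g z) + 1.
have A0 : 0 < A by rewrite /A; lra.
pose d := Num.min 1 (e / (2 * A)).
have d0 : 0 < d by rewrite lt_min ltr01 divr_gt0 // mulr_gt0.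
have [r1 r10 h1] := hf _ d0; have [r2 r20 h2] := hg _ d0.
exists (Num.min r1 r2); first by rewrite lt_min r10.
move=> w; rewrite lt_min => /andP[/h1 {}h1 /h2 {}h2].
have -> : f w * g w - f z * g z =
  (f w - f z) * (g w - g z) + ((f w - f z) * g z + f z * (g w - g z)) by ring.
have d1 : d <= 1 by rewrite ge_min lexx.
have dA : d * (2 * A) <= e by rewrite -ler_pdivlMr ?mulr_gt0 // ge_min lexx orbT.
have p1 := modulus_ge0 (f w - f z); have p2 := modulus_ge0 (g w - g z).
apply: le_trans (modulusD _ _) _; rewrite modulusM.
apply: le_trans (lerD (ler_pM p1 p2 h1 h2) (modulusD _ _)) _; rewrite !modulusM.
apply: le_trans (lerD (lexx _) (lerD (ler_wpM2r ng h1) (ler_wpM2l nf h2))) _.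
apply: le_trans dA.
have : d * d <= d * 1 by rewrite ler_pM2l.
rewrite /A; move: d0 nf ng; clear; nra.
Qed.

Lemma sqcontM f g z r : sqcont f z r -> sqcont g z r -> sqcont (fun s => f s * g s) z r.
Proof. by move=> hf hg s hs; apply: cont_atM; [exact: hf|exact: hg]. Qed.

Lemma sqcont_drv f z r : (forall s, sqbd z r s -> derivable f s 1) -> sqcont f z r.
Proof. by move=> h s /h; exact: derivable_cont. Qed.

Lemma sqcont_kernel z w r n : 0 < r -> modulus (w - z) < r ->
  sqcont (fun s => (s - w) ^- n) z r.
Proof.
move=> r0 wr; apply: sqcont_drv => s /(sqbd_away w r0) h.
have sw : s - w != 0 by rewrite -modulus_gt0; apply: lt_le_trans h; rewrite subr_gt0.
apply: drvV; first by rewrite expf_neq0.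
by apply: drvX; apply: drvB; [exact: drv_id|exact: drv_cst].
Qed.

Lemma sqint_quotient f w d : 0 < d -> sqcont (fun s => f s - f w) w d ->
  sqint (fun s => f s * (s - w)^-1) w d - cauchy_const * f w =
  sqint (fun s => (f s - f w) * (s - w)^-1) w d.
Proof.
move=> d0 fc.
have ww : modulus (w - w) < d by rewrite subrr modulus0.
have [i1 i2] := square_interior ww.
have kc : sqcont (fun s => (s - w)^-1) w d by exact: (@sqcont_kernel w w d 1 d0).
have kw : cauchy_const * f w = sqint (fun s => f w * (s - w)^-1) w d.
  by rewrite sqintZ // mulrC; congr (_ * _); symmetry; exact: cauchy_kernel.
have cc : sqcont (fun s => f w * (s - w)^-1) w d.
  by apply: sqcontM => // s _; apply: derivable_cont; exact: drv_cst.
have -> : sqint (fun s => f s * (s - w)^-1) w d =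
   sqint (fun s => (f s - f w) * (s - w)^-1) w d + sqint (fun s => f w * (s - w)^-1) w d.
  rewrite -sqintD //; last exact: sqcontM.
  by apply: eq_sqint => // s _; rewrite -mulrDl subrK.
by rewrite kw addrK.
Qed.

Lemma modulus_sqint_quotient f w d t M : 0 < d -> sqcont (fun s => f s - f w) w d ->
  2 * d < t ->
  (forall s, modulus (s - w) < t -> modulus (f s - f w) <= M * modulus (s - w)) ->
  modulus (sqint (fun s => (f s - f w) * (s - w)^-1) w d) <= 16 * M * d.
Proof.
move=> d0 fc dt ht.
have ww : modulus (w - w) < d by rewrite subrr modulus0.
have kc : sqcont (fun s => (s - w)^-1) w d by exact: (@sqcont_kernel w w d 1 d0).
apply: modulus_sqint => //; first exact: sqcontM.
move=> s hs; have sd := sqbd_ge d0 hs.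
have sw : s - w != 0 by rewrite -modulus_gt0; exact: lt_le_trans sd.
rewrite modulusM modulusV ler_pdivrMr ?modulus_gt0 //.
by apply: ht; apply: le_lt_trans dt; exact: sqbd_le.
Qed.

(** Shrinking the square to w replaces f by f w up to an integral of bounded
    difference quotients over a short contour. *)
Lemma cauchy_formula f z r w : 0 < r ->
  (forall s, modulus (s - z) <= 2 * r -> derivable f s 1) ->
  modulus (w - z) < r -> sqint (fun s => f s * (s - w)^-1) z r = cauchy_const * f w.
Proof.
move=> r0 hf wr.
have [/andP[x1 x2] /andP[y1 y2]] := square_interior wr.
have wr2 : modulus (w - z) <= 2 * r by have := ltW wr; move: r0; clear; lra.
have /derivable_has_deriv[k /has_deriv_bound[t t0 ht]] := hf w wr2.
apply/eqP; rewrite -subr_eq0; apply/eqP/modulus_small => e e0.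
have nk : 0 < modulus k + 1 by have := modulus_ge0 k; lra.
(* a square around w small enough for the difference quotients of f at w to
   be bounded on it *)
have [d [d0 [[b1 b2] [b3 b4]] dt de]] : exists d, [/\ 0 < d,
   (Re z - r <= Re w - d /\ Re w + d <= Re z + r) /\
   (Im z - r <= Im w - d /\ Im w + d <= Im z + r), 2 * d < t &
   16 * (modulus k + 1) * d <= e].
  pose d1 := e / (16 * (modulus k + 1)).
  have d10 : 0 < d1 by rewrite divr_gt0 // mulr_gt0.
  pose d := Num.min (Num.min (Num.min (Re w - (Re z - r)) (Re z + r - Re w))
              (Num.min (Im w - (Im z - r)) (Im z + r - Im w)))
             (Num.min (t / 3) d1).
  have : d <= d by [].
  rewrite {2}/d !le_min => /andP[/andP[/andP[q1 q2] /andP[q3 q4]] /andP[q5 q6]].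
  exists d; split.
  - by rewrite /d !lt_min d10 !subr_gt0 x1 x2 y1 y2 /= andbT divr_gt0.
  - by clear -q1 q2 q3 q4; repeat split; lra.
  - by clear -q5 t0; lra.
  - by rewrite mulrC -ler_pdivlMr // mulr_gt0.
have [s1 s2] := sq_sides w d0.
have frame : sqint (fun s => f s * (s - w)^-1) z r = sqint (fun s => f s * (s - w)^-1) w d.
  apply: rect_frame => // s /modulus_le_square hs hout; apply: drvM; first exact: hf.
  apply: drv_invB; apply/eqP => sw; move: hout; rewrite sw.
  by move: d0; clear => d0 []; lra.
have dfin s : sqbd w d s -> derivable f s 1.
  move=> hs; apply: hf; apply: modulus_le_square.
  exact: in_rect_sub (bdry_in_rect s1 s2 hs).
have fc : sqcont (fun s => f s - f w) w d.
  by apply: sqcont_drv => s /dfin h; exact: (drvB h (drv_cst (f w) s)).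
rewrite frame sqint_quotient //; apply: le_trans de.
exact: (modulus_sqint_quotient d0 fc dt ht).
Qed.

(** Differentiation under the integral sign, for a kernel whose first-order
    Taylor remainder is uniformly quadratic. *)
Lemma sqint_param (K : C -> C -> C) (K' phi : C -> C) z r w A rho : 0 < r -> 0 < rho ->
  (forall w', modulus (w' - w) < rho -> sqcont (fun s => phi s * K s w') z r) ->
  sqcont (fun s => phi s * K' s) z r ->
  (forall s h, sqbd z r s -> modulus h < rho ->
    modulus (phi s * (K s (w + h) - K s w - K' s * h)) <= A * modulus h ^+ 2) ->
  has_deriv (fun w => sqint (fun s => phi s * K s w) z r) w
    (sqint (fun s => phi s * K' s) z r).
Proof.
move=> r0 rho0 Kc K'c hA e e0.
have nA := normr_ge0 A; have lA := ler_norm A.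
have q0 : 0 < 16 * `|A| * r + 1.
  by have : 0 <= `|A| * r by [rewrite mulr_ge0 // ltW]; rewrite -mulrA; lra.
exists (Num.min rho (e / (16 * `|A| * r + 1))); first by rewrite lt_min rho0 divr_gt0.
move=> v; rewrite lt_min => /andP[vr ve].
have ww : modulus (w - w) < rho by rewrite subrr modulus0.
set h := v - w in vr ve *.
have vE : v = w + h by rewrite /h addrC subrK.
have neg (k : C) g : sqcont g z r -> sqcont (fun s => k * g s) z r.
  by move=> gc; apply: sqcontM => // s _; apply: derivable_cont; exact: drv_cst.
have c1 : sqcont (fun s => -1 * (phi s * K s w)) z r by apply: neg; exact: Kc.
have c2 : sqcont (fun s => - h * (phi s * K' s)) z r by exact: neg.
have c3 := Kc v vr.
have c4 := rcont_D c3 c1.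
have -> : sqint (fun s => phi s * K s v) z r - sqint (fun s => phi s * K s w) z r
    - sqint (fun s => phi s * K' s) z r * h =
  sqint (fun s => phi s * K s v + -1 * (phi s * K s w) + - h * (phi s * K' s)) z r.
  rewrite sqintD // sqintD // !sqintZ //; last exact: Kc.
  by rewrite mulN1r [_ * h]mulrC mulNr.
apply: le_trans (modulus_sqint (M := `|A| * modulus h ^+ 2) r0 _ _) _.
- exact: rcont_D.
- move=> s hs; have := hA s h hs vr; rewrite -vE.
  have -> : phi s * (K s v - K s w - K' s * h) =
     phi s * K s v + -1 * (phi s * K s w) + - h * (phi s * K' s) by ring.
  by move=> /le_trans; apply; rewrite ler_wpM2r // exprn_ge0 // modulus_ge0.
rewrite expr2 mulrA mulrA -mulrAC ler_wpM2r ?modulus_ge0 //.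
move: ve; rewrite ltr_pdivlMr // => ve; apply: le_trans (ltW ve).
have := modulus_ge0 h; clear; nra.
Qed.

Section CauchyIntegral.
Variables (phi : C -> C) (z w : C) (r M : R).
Hypotheses (r0 : 0 < r) (wr : modulus (w - z) < r) (phic : sqcont phi z r).
Hypothesis phiM : forall s, sqbd z r s -> modulus (phi s) <= M.

Let rho := (r - modulus (w - z)) / 2.
Let rho0 : 0 < rho.
Proof. by rewrite /rho divr_gt0 // subr_gt0. Qed.

Let near_w v : modulus (v - w) < rho -> modulus (v - z) < r.
Proof.
move=> h; apply: le_lt_trans (modulus_dist v w z) _.
by have := wr; move: h; rewrite /rho; lra.
Qed.

Let kernel_bounds s h : sqbd z r s -> modulus h < rho ->
  [/\ 0 <= modulus (phi s) <= M, rho <= modulus (s - w) & rho <= modulus (s - w - h)].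
Proof.
move=> hs hh; split; first by rewrite modulus_ge0 phiM.
  by apply: le_trans (sqbd_away w r0 hs); move: wr; rewrite /rho; lra.
rewrite -addrA -opprD; apply: le_trans (sqbd_away (w + h) r0 hs).
have : modulus (w + h - z) <= modulus h + modulus (w - z).
  by rewrite (addrC w) -addrA; exact: modulusD.
by move: hh; rewrite /rho; lra.
Qed.

Lemma cauchy_int_deriv1 :
  has_deriv (fun w => sqint (fun s => phi s * (s - w)^-1) z r) w
    (sqint (fun s => phi s * (s - w) ^- 2) z r).
Proof.
apply: (@sqint_param (fun s w => (s - w)^-1) (fun s => (s - w) ^- 2) phi z r w (M / rho ^+ 3) rho) => //.
- by move=> v /near_w hv; apply: sqcontM => //; exact: (@sqcont_kernel z v r 1).
- by apply: sqcontM => //; exact: sqcont_kernel.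
- move=> s h hs hh; have [/andP[p0 pM] h1 h2] := kernel_bounds hs hh.
  have n1 := lt_le_trans rho0 h1; have n2 := lt_le_trans rho0 h2.
  have u0 : s - w != 0 by rewrite -modulus_gt0.
  have u1 : s - w - h != 0 by rewrite -modulus_gt0.
  rewrite [- (w + h)]opprD addrA inv_taylor1 //.
  have M0 : 0 <= M := le_trans p0 pM.
  rewrite !modulusM modulusV modulusM !modulusX.
  apply: (ler_pM3 p0 pM (sqr_ge0 _)).
    by rewrite invr_ge0; apply: mulr_ge0; rewrite ?exprn_ge0 ?modulus_ge0.
  have q1 : 0 < rho ^+ 3 by exact: exprn_gt0.
  have q2 : 0 < modulus (s - w) ^+ 2 * modulus (s - w - h).
    by apply: mulr_gt0 => //; exact: exprn_gt0.
  rewrite lef_pV2 ?posrE //.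
  rewrite (exprD rho 2 1).
  by apply: ler_pM; rewrite ?exprn_ge0 ?lerXn2r ?nnegrE // ltW.
Qed.

Lemma cauchy_int_deriv2 :
  has_deriv (fun w => sqint (fun s => phi s * (s - w) ^- 2) z r) w
    (sqint (fun s => phi s * (2 * (s - w) ^- 3)) z r).
Proof.
apply: (@sqint_param (fun s w => (s - w) ^- 2) (fun s => 2 * (s - w) ^- 3) phi z r w
   (5 * M / rho ^+ 4) rho) => //.
- by move=> v /near_w hv; apply: sqcontM => //; exact: sqcont_kernel.
- apply: sqcontM => //; apply: sqcontM; last exact: sqcont_kernel.
  by move=> s _; apply: derivable_cont; exact: drv_cst.
- move=> s h hs hh; have [/andP[p0 pM] h1 h2] := kernel_bounds hs hh.
  have n1 := lt_le_trans rho0 h1; have n2 := lt_le_trans rho0 h2.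
  have u0 : s - w != 0 by rewrite -modulus_gt0.
  have u1 : s - w - h != 0 by rewrite -modulus_gt0.
  have M0 : 0 <= M := le_trans p0 pM.
  rewrite [- (w + h)]opprD addrA inv_taylor2 //.
  have num : modulus (3 * (s - w) - 2 * h) <= 5 * modulus (s - w).
    have k3 : modulus (3 : C) = 3 by rewrite -(rmorph_nat (real_complex R) 3) modulusR ger0_norm.
    have k2 : modulus (2 : C) = 2 by rewrite -(rmorph_nat (real_complex R) 2) modulusR ger0_norm.
    apply: le_trans (modulusD _ _) _; rewrite modulusN !modulusM k3 k2.
    by have := lt_le_trans hh h1; lra.
  rewrite !modulusM modulusV modulusM !modulusX.
  have -> : 5 * M / rho ^+ 4 = M * (5 / rho ^+ 4) by rewrite mulrA [M * 5]mulrC.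
  rewrite -[modulus h ^+ 2 * _ / _]mulrA; apply: (ler_pM3 p0 pM (sqr_ge0 _)).
    by apply: mulr_ge0; rewrite ?modulus_ge0 // invr_ge0; apply: mulr_ge0; rewrite ?exprn_ge0 ?modulus_ge0.
  apply: le_trans (ler_wpM2r _ num) _.
    by rewrite invr_ge0; apply: mulr_ge0; rewrite ?exprn_ge0 ?modulus_ge0.
  rewrite -mulrA ler_wpM2l //.
  have -> : modulus (s - w) / (modulus (s - w) ^+ 3 * modulus (s - w - h) ^+ 2) =
     (modulus (s - w) ^+ 2 * modulus (s - w - h) ^+ 2)^-1.
    by field; rewrite !gt_eqF.
  have q1 : 0 < rho ^+ 4 by exact: exprn_gt0.
  have q2 : 0 < modulus (s - w) ^+ 2 * modulus (s - w - h) ^+ 2.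
    by apply: mulr_gt0; exact: exprn_gt0.
  rewrite lef_pV2 ?posrE //.
  rewrite (exprD rho 2 2).
  by apply: ler_pM; rewrite ?exprn_ge0 ?lerXn2r ?nnegrE // ltW.
Qed.

End CauchyIntegral.

End CauchyConsequences.

(** * Holomorphic functions and Liouville's theorem *)

Section Consequences.
Variable R : realType.
Local Notation C := (complex_complex__canonical__Num_NumField R).
Local Notation Re := (@complex.Re R).
Local Notation Im := (@complex.Im R).
Local Notation modulus := (@modulus R).
Local Notation pt := (@pt R).
Local Notation cauchy_const := (@cauchy_const R).
Implicit Types (a b c d x y e r : R) (z w s : C) (f g h : C -> C).

Lemma bounded_on_rect f a b c d : a <= b -> c <= d ->
  (forall z, in_rect a b c d z -> cont_at f z) ->
  exists M, forall z, in_rect a b c d z -> modulus (f z) <= M.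
Proof.
move=> ab cd hf.
apply: (quadrisection (P := fun a b c d => exists M, forall z, in_rect a b c d z -> modulus (f z) <= M)) => //.
- move=> a1 b1 c1 d1 _ _ _ _ _ _ m n [M1 h1] [M2 h2] [M3 h3] [M4 h4].
  exists (Num.max (Num.max M1 M2) (Num.max M3 M4)) => z [/andP[p1 p2] /andP[q1 q2]].
  rewrite !le_max; case: (leP (Re z) m) => [pm|/ltW pm]; case: (leP (Im z) n) => [qn|/ltW qn].
  - by rewrite h1 //; split; apply/andP.
  - by rewrite h3 ?orbT //; split; apply/andP.
  - by rewrite h2 ?orbT //; split; apply/andP.
  - by rewrite h4 ?orbT //; split; apply/andP.
- move=> x y hx hy; have [r r0 hr] := hf (pt x y) (conj hx hy) 1 ltr01.
  exists (r / 2); first by rewrite divr_gt0.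
  move=> a1 b1 c1 d1 _ _ _ _ /andP[x1 x2] /andP[y1 y2] w1 w2.
  exists (modulus (f (pt x y)) + 1) => z [/andP[p1 p2] /andP[q1 q2]].
  have /hr fz : modulus (z - pt x y) < r.
    apply: le_lt_trans (modulus_ReIm _) _; rewrite Re_add Im_add !raddfN /= [ltRHS](splitr r).
    apply: ltrD; rewrite ltr_norml; apply/andP.
      by move: x1 x2 w1 p1 p2; clear => *; split; lra.
    by move: y1 y2 w2 q1 q2; clear => *; split; lra.
  rewrite -[f z](subrK (f (pt x y))); apply: le_trans (modulusD _ _) _.
  by rewrite addrC lerD2l.
Qed.

Lemma has_deriv_ext f g z (d : C) : (\forall w \near z, f w = g w) ->
  has_deriv f z d -> has_deriv g z d.
Proof.
move=> /near_modulus[r r0 h] hf e /hf[t t0 ht].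
have zz : modulus (z - z) < r by rewrite subrr modulus0.
exists (Num.min r t); first by rewrite lt_min r0.
by move=> w; rewrite lt_min => /andP[wr /ht]; rewrite h // (h _ zz).
Qed.

Lemma derivable_ext f g z : (\forall w \near z, f w = g w) ->
  derivable f z 1 -> derivable g z 1.
Proof.
move=> fg /derivable_has_deriv[d hd].
exact: has_deriv_derivable (has_deriv_ext fg hd).
Qed.

Lemma has_derivZ (k : C) f z (d : C) : has_deriv f z d -> has_deriv (fun w => k * f w) z (k * d).
Proof.
move=> hf e e0; have nk := modulus_ge0 k.
have q0 : 0 < modulus k + 1 by lra.
have [r r0 hr] := hf _ (divr_gt0 e0 q0); exists r => // w /hr {}hr.
have -> : k * f w - k * f z - k * d * (w - z) = k * (f w - f z - d * (w - z)) by ring.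
rewrite modulusM; apply: le_trans (ler_wpM2l nk hr) _.
rewrite mulrA ler_wpM2r ?modulus_ge0 // mulrCA ger_pMr //.
by rewrite ler_pdivrMr // mul1r; lra.
Qed.

Lemma has_deriv_derive f z (d : C) : has_deriv f z d -> 'D_1 f z = d.
Proof. by move=> /has_derivP h; apply: cvg_lim h. Qed.

Lemma cauchy_representation f z : holomorphic_at f z ->
  exists r M, [/\ 0 < r, sqcont f z r,
    (forall s, sqbd z r s -> modulus (f s) <= M) &
    forall w, modulus (w - z) < r ->
      f w = cauchy_const^-1 * sqint (fun s => f s * (s - w)^-1) z r].
Proof.
move=> /near_modulus[e e0 he]; pose r := e / 3.
have r0 : 0 < r by rewrite divr_gt0.
have re : 2 * r < e by rewrite /r; lra.
have hd s : modulus (s - z) <= 2 * r -> derivable f s 1.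
  by move=> hs; apply: he; exact: le_lt_trans re.
have [s1 s2] := sq_sides z r0.
have [s hs|M hM] := bounded_on_rect s1 s2 (f := f).
  by apply: derivable_cont; apply: hd; exact: modulus_le_square.
exists r, M; split=> //.
- by apply: sqcont_drv => s /(sqbd_le r0)/hd.
- by move=> s /(bdry_in_rect s1 s2); exact: hM.
- by move=> w wr; rewrite (cauchy_formula r0 hd wr) mulKf // cauchy_const_neq0.
Qed.

Lemma near_ball z r w : modulus (w - z) < r -> \forall v \near w, modulus (v - z) < r.
Proof.
move=> h; apply/near_modulus; exists (r - modulus (w - z)); first by rewrite subr_gt0.
by move=> v; rewrite ltrBrDr; exact/le_lt_trans/modulus_dist.
Qed.

(** The derivative is the Cauchy integral with squared kernel, which can be
    differentiated once more. *)
Lemma holomorphic_derive f z : holomorphic_at f z -> holomorphic_at (fun w => 'D_1 f w) z.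
Proof.
move=> /cauchy_representation[r [M [r0 fc fM hf]]].
have hD w : modulus (w - z) < r ->
    'D_1 f w = cauchy_const^-1 * sqint (fun s => f s * (s - w) ^- 2) z r.
  move=> wr; apply: has_deriv_derive.
  have h := has_derivZ cauchy_const^-1 (cauchy_int_deriv1 r0 wr fc fM).
  apply: has_deriv_ext h.
  by apply: filterS (near_ball wr) => v hv; rewrite hf.
apply/near_modulus; exists r; [exact: r0|move=> w wr].
have h := has_derivZ cauchy_const^-1 (cauchy_int_deriv2 r0 wr fc fM).
apply: has_deriv_derivable (has_deriv_ext _ h).
by apply: filterS (near_ball wr) => v hv; rewrite hD.
Qed.

(** The quotient is again a Cauchy integral, hence holomorphic: this is the
    removable singularity theorem in the form needed for Laurent expansions. *)
Lemma holomorphic_quotient h z : holomorphic_at h z ->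
  exists2 g, holomorphic_at g z & \forall w \near z, h w = h z + g w * (w - z).
Proof.
move=> /cauchy_representation[r [M [r0 hc hM hE]]].
pose phi s := h s * (s - z)^-1.
have zr : modulus (z - z) < r by rewrite subrr modulus0.
have kc w : modulus (w - z) < r -> sqcont (fun s => (s - w)^-1) z r.
  by move=> wr; exact: (@sqcont_kernel _ z w r 1).
have phic : sqcont phi z r by apply: sqcontM => //; exact: kc.
have phiM s : sqbd z r s -> modulus (phi s) <= M / r.
  move=> hs; rewrite modulusM modulusV; have sr := sqbd_ge r0 hs.
  apply: ler_pM; rewrite ?invr_ge0 ?modulus_ge0 ?hM //.
  by rewrite lef_pV2 // posrE //; exact: lt_le_trans sr.
exists (fun w => cauchy_const^-1 * sqint (fun s => phi s * (s - w)^-1) z r).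
  apply/near_modulus; exists r; [exact: r0|move=> w wr].
  exact: has_deriv_derivable (has_derivZ cauchy_const^-1 (cauchy_int_deriv1 r0 wr phic phiM)).
apply/near_modulus; exists r; [exact: r0|move=> w wr].
rewrite (hE w wr) {1}(hE z zr) -mulrA -mulrDr; congr (_ * _).
rewrite mulrC -sqintZ //; last by apply: sqcontM => //; exact: kc.
rewrite -sqintD //; first last.
- apply: sqcontM; first by move=> s _; apply: derivable_cont; exact: drv_cst.
  by apply: sqcontM => //; exact: kc.
apply: eq_sqint => // s hs; rewrite /phi.
have sz : s - z != 0 by rewrite -modulus_gt0; exact: lt_le_trans (sqbd_ge r0 hs).
have sw : s - w != 0.
  by rewrite -modulus_gt0; apply: lt_le_trans (sqbd_away w r0 hs); rewrite subr_gt0.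
by field; rewrite sz sw.
Qed.

(** The difference of the Cauchy kernels at w and 0 decays like the inverse
    square of the radius. *)
Lemma liouville f M : (forall z, derivable f z 1) ->
  (forall z, modulus (f z) <= M) -> forall w, f w = f 0.
Proof.
move=> hf hM w; apply/eqP; rewrite -subr_eq0; apply/eqP.
apply: (mulfI (cauchy_const_neq0 R)); rewrite mulr0; apply: modulus_small => e e0.
have nw := modulus_ge0 w.
have M0 : 0 <= M by exact: le_trans (modulus_ge0 _) (hM 0).
have X0 : 0 <= 16 * M * modulus w / e.
  by apply: divr_ge0; [rewrite !mulr_ge0|exact: ltW].
pose r := modulus w + 1 + 16 * M * modulus w / e.
have wr : modulus (w - 0) < r by rewrite subr0 /r; lra.
have r0 : 0 < r by rewrite /r; lra.
have zr : modulus (0 - 0 : C) < r by rewrite subrr modulus0.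
have fd s : modulus (s - 0) <= 2 * r -> derivable f s 1 by [].
have fc : sqcont f 0 r by apply: sqcont_drv.
have kc v : modulus (v - 0) < r -> sqcont (fun s => (s - v)^-1) 0 r.
  by move=> vr; exact: (@sqcont_kernel _ 0 v r 1).
have cc (k : C) : sqcont (fun=> k) 0 r.
  by move=> s _; apply: derivable_cont; exact: drv_cst.
rewrite mulrBr -(cauchy_formula r0 fd wr) -(cauchy_formula r0 fd zr).
have -> : sqint (fun s => f s * (s - w)^-1) 0 r - sqint (fun s => f s * (s - 0)^-1) 0 r =
   sqint (fun s => f s * (w * ((s - w)^-1 * (s - 0)^-1))) 0 r.
  rewrite -[- sqint _ _ _]mulN1r -sqintZ //; last by apply: sqcontM => //; exact: kc.
  rewrite -sqintD //; first last.
  - by apply: sqcontM; [exact: cc|apply: sqcontM => //; exact: kc].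
  - by apply: sqcontM => //; exact: kc.
  apply: eq_sqint => // s hs.
  have sz : s - 0 != 0 by rewrite -modulus_gt0; exact: lt_le_trans (sqbd_ge r0 hs).
  have sw : s - w != 0.
    by rewrite -modulus_gt0; apply: lt_le_trans (sqbd_away w r0 hs); rewrite subr_gt0.
  by rewrite subr0 in sz *; field; rewrite sz sw.
have rw0 : 0 < r - modulus w by rewrite subr_gt0 -[w]subr0.
apply: le_trans (modulus_sqint (M := M * (modulus w / ((r - modulus w) * r))) r0 _ _) _.
- apply: sqcontM => //; apply: sqcontM; first exact: cc.
  by apply: sqcontM; exact: kc.
- move=> s hs; rewrite !modulusM !modulusV.
  have sz := sqbd_ge r0 hs; have := sqbd_away w r0 hs; rewrite subr0 => sw.
  apply: ler_pM; rewrite ?modulus_ge0 ?hM //.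
    by rewrite !mulr_ge0 ?invr_ge0 ?modulus_ge0.
  rewrite ler_wpM2l // invfM; apply: ler_pM; rewrite ?invr_ge0 ?modulus_ge0 //.
    by rewrite lef_pV2 ?posrE //; exact: lt_le_trans sw.
  by rewrite lef_pV2 ?posrE //; exact: lt_le_trans sz.
have -> : 16 * (M * (modulus w / ((r - modulus w) * r))) * r =
   16 * M * modulus w / (r - modulus w) by field; rewrite !gt_eqF.
rewrite ler_pdivrMr // [e * _]mulrC -ler_pdivrMr //.
by rewrite /r; lra.
Qed.

Lemma int_period f om : (forall z, f (z + om) = f z) ->
  forall (n : int) z, f (z + n%:~R * om) = f z.
Proof.
move=> h; have hn (n : nat) z : f (z + n%:R * om) = f z.
  elim: n z => [|n IH] z; first by rewrite mul0r addr0.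
  by rewrite -natr1 mulrDl mul1r addrA h.
case=> n z; first exact: hn.
rewrite -(hn n.+1 (z + _)) NegzE mulrNz mulNr; congr f.
by rewrite -addrA addNr addr0.
Qed.

(** Every point is congruent modulo the lattice to one of the fundamental
    parallelogram, on which an entire function is bounded. *)
Lemma elliptic_entire_constant (tau : C) f : 0 < Im tau -> (forall z, derivable f z 1) ->
  (forall z, f (z + 1) = f z) -> (forall z, f (z + tau) = f z) -> forall z, f z = f 0.
Proof.
move=> tau0 fd f1 ft.
pose L (p : C) : C := (Re p)%:C%C + (Im p)%:C%C * tau.
have LB p q : modulus (L p - L q) <= (1 + modulus tau) * modulus (p - q).
  have -> : L p - L q = (Re (p - q))%:C%C + (Im (p - q))%:C%C * tau.
    by rewrite /L Re_add Im_add !raddfN /= !rmorphD !rmorphN /=; ring.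
  apply: le_trans (modulusD _ _) _; rewrite modulusM !modulusR mulrDl mul1r.
  apply: lerD; first exact: normr_Re.
  by rewrite mulrC ler_wpM2l ?modulus_ge0 // normr_Im.
have [p _|M hM] := bounded_on_rect (f := f \o L) (@ler01 R) (@ler01 R).
  move=> e e0; have [r r0 hr] := derivable_cont (fd (L p)) e0.
  have q0 : 0 < 1 + modulus tau by have := modulus_ge0 tau; lra.
  exists (r / (1 + modulus tau)); first by rewrite divr_gt0.
  move=> q; rewrite ltr_pdivlMr // => hq; apply: hr.
  by apply: le_lt_trans (LB q p) _; rewrite mulrC.
apply: (liouville (M := M)) => // z.
pose y := Im z / Im tau; pose x := Re z - y * Re tau.
have zE : z = x%:C%C + y%:C%C * tau.
  apply/eqP; rewrite eq_complex Re_add Im_add Re_mul Im_mul /= !mul0r subr0 add0r addr0.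
  by rewrite /x subrK eqxx /y divfK ?eqxx // gt_eqF.
have int1 : forall u n, f (u + n%:~R) = f u.
  by move=> u n; have := int_period f1 n u; rewrite mulr1.
pose m := Num.floor x; pose n := Num.floor y.
have LE : z = L (pt (x - m%:~R) (y - n%:~R)) + m%:~R + n%:~R * tau.
  by rewrite zE /L /= !rmorphB /= !rmorph_int; ring.
rewrite LE (int_period ft) int1 -/((f \o L) (pt _ _)).
have /andP[mx mx1] : m%:~R <= x < m%:~R + 1 by have := floor_itv x; rewrite intrD.
have /andP[ny ny1] : n%:~R <= y < n%:~R + 1 by have := floor_itv y; rewrite intrD.
by apply: hM; split=> /=; apply/andP; split; lra.
Qed.

End Consequences.

(** * Lattice sums *)

Lemma inv_diff_succ (F : realFieldType) (x : F) : 0 < x ->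
  x^-1 - (x + 1)^-1 = (x * (x + 1))^-1.
Proof.
move=> x0; have x1 : 0 < x + 1 by rewrite addr_gt0.
by field; rewrite ?(gt_eqF x0) ?(gt_eqF x1).
Qed.

Section LatticeSums.
Variable R : realType.
Local Notation C := (complex_complex__canonical__Num_NumField R).
Local Notation Re := (@complex.Re R).
Local Notation Im := (@complex.Im R).
Local Notation modulus := (@modulus R).
Implicit Types (p q : int * int) (l : seq (int * int)) (t : int * int -> C).

(** Lattice sums are organized by layers of constant taxicab distance, which
    have linearly many points. *)
Definition taxi p : nat := (`|p.1| + `|p.2|)%N.

Definition zrange N : seq int := [seq i%:Z - N%:Z | i <- iota 0 (2 * N).+1].

Lemma zrange_uniq N : uniq (zrange N).
Proof. by rewrite map_inj_uniq ?iota_uniq // => i j /addIr[]. Qed.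

Lemma mem_zrange N (i : int) : (i \in zrange N) = (`|i| <= N)%N.
Proof.
apply/mapP/idP => [[k]|hi]; first by rewrite mem_iota => /andP[_ hk] ->; lia.
by exists (absz (i + N%:Z)); [rewrite mem_iota; lia|lia].
Qed.

Lemma size_zrange N : size (zrange N) = (2 * N).+1.
Proof. by rewrite size_map size_iota. Qed.

Definition box N : seq (int * int) := [seq (i, j) | i <- zrange N, j <- zrange N].

Lemma box_uniq N : uniq (box N).
Proof. by apply: allpairs_uniq; rewrite ?zrange_uniq // => -[? ?] [? ?]. Qed.

Lemma mem_box N p : (p \in box N) = (`|p.1| <= N)%N && (`|p.2| <= N)%N.
Proof.
rewrite -!mem_zrange; case: p => i j /=; apply/allpairsP/andP.
  by move=> [[i' j'] /= [hi hj [-> ->]]].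
by move=> [hi hj]; exists (i, j).
Qed.

Lemma notin_box_taxi N p : p \notin box N -> (N < taxi p)%N.
Proof. by rewrite mem_box /taxi; lia. Qed.

Lemma box_sub N M p : (N <= M)%N -> p \in box N -> p \in box M.
Proof. by rewrite !mem_box; lia. Qed.

(** The abscissa, of absolute value at most k, determines the ordinate up to
    sign: at most 2 (2k + 1) pairs. *)
Lemma count_layer k l : (0 < k)%N -> uniq l -> (count (fun p => taxi p == k) l <= 6 * k)%N.
Proof.
move=> k0 ul; rewrite -size_filter.
pose layer := [seq (i, y) | i <- zrange k, y <- [:: (k - `|i|)%N%:Z; - (k - `|i|)%N%:Z]].
apply: (@leq_trans (size layer)).
  apply: uniq_leq_size; first exact: filter_uniq.
  move=> [i j]; rewrite mem_filter => /andP[/eqP hk _].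
  apply/allpairsPdep; exists i, j; split=> //.
    by rewrite mem_zrange; move: hk; rewrite /taxi /=; lia.
  by rewrite !inE; move: hk; rewrite /taxi /=; lia.
rewrite size_allpairs_dep (eq_map (g := fun=> 2%N)) //.
rewrite (_ : sumn _ = (2 * size (zrange k))%N); first by rewrite size_zrange; lia.
by elim: (zrange k) => //= x s ->; lia.
Qed.

(** Layer k contributes at most 6k / k^3, and 1 / k^2 <= 1 / (k - 1) - 1 / k
    telescopes. *)
Lemma layer_sums N M l : (0 < N)%N -> uniq l ->
  (forall p, p \in l -> (N < taxi p <= N + M)%N) ->
  \sum_(p <- l) ((taxi p)%:R : R) ^- 3 <= 6 * (N%:R^-1 - (N + M)%:R^-1).
Proof.
move=> N0; elim: M l => [|M IH] l ul hl.
  rewrite addn0 subrr mulr0; case: l ul hl => [|p l] _ hl; first by rewrite big_nil.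
  by have := hl p (mem_head _ _); lia.
rewrite (bigID (fun p => taxi p == (N + M.+1)%N)) /=.
rewrite -[X in _ + X <= _]big_filter.
have h2 := IH [seq p <- l | taxi p != (N + M.+1)%N] (filter_uniq _ ul).
have {h2} : \sum_(p <- [seq p <- l | taxi p != (N + M.+1)%N]) ((taxi p)%:R : R) ^- 3 <=
    6 * (N%:R^-1 - (N + M)%:R^-1).
  apply: h2 => p; rewrite mem_filter => /andP[/eqP h /hl]; lia.
set k := (N + M.+1)%N.
have k0 : (0 < k)%N by rewrite /k; lia.
have h1 : \sum_(p <- l | taxi p == k) ((taxi p)%:R : R) ^- 3 <= (6 * k)%:R * k%:R ^- 3.
  rewrite (eq_bigr (fun=> (k%:R : R) ^- 3)); last by move=> p /eqP ->.
  rewrite big_const_seq iter_addr_0 -[leLHS]mulr_natl ler_wpM2r ?invr_ge0 ?exprn_ge0 //.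
  by rewrite ler_nat; exact: count_layer.
move=> h2; apply: le_trans (lerD h1 h2) _.
have kE : (k%:R : R) = (N + M)%:R + 1 by rewrite /k addnS -natr1.
have m0 : 0 < ((N + M)%:R : R) by rewrite ltr0n; lia.
have kR0 : 0 < (k%:R : R) by rewrite ltr0n.
rewrite natrM -mulrA -mulrDr ler_wpM2l //.
have -> : (k%:R : R) * k%:R ^- 3 = k%:R ^- 2 by field; rewrite gt_eqF.
suff : (k%:R : R) ^- 2 <= (N + M)%:R^-1 - k%:R^-1 by lra.
have -> : (N + M)%:R^-1 - k%:R^-1 = ((N + M)%:R * k%:R : R)^-1.
  by rewrite kE; exact: inv_diff_succ.
rewrite lef_pV2 ?posrE ?mulr_gt0 // expr2.
by rewrite ler_wpM2r ?ltW // kE; lra.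
Qed.

Definition dominated t (A : R) N := forall p, (N < taxi p)%N ->
  modulus (t p) <= A * (taxi p)%:R ^- 3.

Lemma modulus_sum (I : eqType) (r : seq I) (F : I -> C) :
  modulus (\sum_(i <- r) F i) <= \sum_(i <- r) modulus (F i).
Proof.
elim: r => [|i r IH]; first by rewrite !big_nil modulus0.
rewrite !big_cons; apply: le_trans (modulusD _ _) _; exact: lerD.
Qed.

Lemma dominated_tail t A N l : 0 <= A -> (0 < N)%N -> dominated t A N -> uniq l ->
  (forall p, p \in l -> (N < taxi p)%N) ->
  modulus (\sum_(p <- l) t p) <= 6 * A / N%:R.
Proof.
move=> A0 N0 ht ul hl; apply: le_trans (modulus_sum _ _) _.
pose M := \max_(p <- l) taxi p.
have hM p : p \in l -> (N < taxi p <= N + M)%N.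
  move=> pl; rewrite hl //=; apply: leq_trans (leq_addl _ _).
  exact: leq_bigmax_seq.
apply: (@le_trans _ _ (\sum_(p <- l) A * (taxi p)%:R ^- 3)).
  rewrite big_seq [leRHS]big_seq; apply: ler_sum => p /hl; exact: ht.
rewrite -mulr_sumr; apply: le_trans (ler_wpM2l A0 (layer_sums N0 ul hM)) _.
rewrite [6 * A]mulrC -mulrA ler_wpM2l // ler_wpM2l // gerBl.
by rewrite invr_ge0.
Qed.

Definition bsum N t : C := \sum_(p <- box N) t p.

Lemma sum_minus_box t A N l : 0 <= A -> (0 < N)%N -> dominated t A N -> uniq l ->
  {subset box N <= l} -> modulus (\sum_(p <- l) t p - bsum N t) <= 6 * A / N%:R.
Proof.
move=> A0 N0 ht ul bl.
rewrite (bigID (fun p => p \in box N)) /= -big_filter.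
have -> : \sum_(p <- [seq p <- l | p \in box N]) t p = bsum N t.
  apply: perm_big; apply: uniq_perm; rewrite ?filter_uniq ?box_uniq //.
  by move=> p; rewrite mem_filter andb_idr //; exact: bl.
rewrite addrAC subrr add0r -big_filter; apply: dominated_tail => //; first exact: filter_uniq.
by move=> p; rewrite mem_filter => /andP[/notin_box_taxi].
Qed.

Definition tends (u : nat -> C) (L : C) := forall e : R, 0 < e ->
  exists N1, forall N, (N1 <= N)%N -> modulus (u N - L) <= e.

Lemma inv_small (B e : R) : 0 < e -> exists N1 : nat, forall N, (N1 <= N)%N ->
  (0 < N)%N -> B / N%:R <= e.
Proof.
move=> e0; exists (Num.bound (`|B| / e)) => N hN N0.
rewrite ler_pdivrMr ?ltr0n // mulrC -ler_pdivrMr //.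
apply: le_trans (_ : `|B| / e <= _).
  by rewrite ler_wpM2r ?invr_ge0 ?(ltW e0) // ler_norm.
have h : 0 <= `|B| / e by rewrite divr_ge0 // ltW.
by apply: le_trans (ltW (archi_boundP h)) _; rewrite ler_nat.
Qed.

Lemma tends_unique u L L' : tends u L -> tends u L' -> L = L'.
Proof.
move=> h h'; apply/eqP; rewrite -subr_eq0; apply/eqP/modulus_small => e e0.
have e2 : 0 < e / 2 by rewrite divr_gt0.
have [N1 {}h] := h _ e2; have [N2 {}h'] := h' _ e2.
have := h _ (leq_maxl N1 N2); have := h' _ (leq_maxr N1 N2).
set v := u _ => h1 h2.
apply: le_trans (modulus_dist L v L') _; rewrite modulusB; lra.
Qed.

Lemma tendsD u v L L' : tends u L -> tends v L' -> tends (fun N => u N + v N) (L + L').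
Proof.
move=> h h' e e0; have e2 : 0 < e / 2 by rewrite divr_gt0.
have [N1 {}h] := h _ e2; have [N2 {}h'] := h' _ e2.
exists (maxn N1 N2) => N; rewrite geq_max => /andP[/h {}h /h' {}h'].
by rewrite opprD addrACA; apply: le_trans (modulusD _ _) _; lra.
Qed.

Lemma tendsN u L : tends u L -> tends (fun N => - u N) (- L).
Proof.
move=> h e /h[N1 {}h]; exists N1 => N /h.
by rewrite -opprD modulusN.
Qed.

Lemma tendsZ (k : C) u L : tends u L -> tends (fun N => k * u N) (k * L).
Proof.
move=> h e e0; have k0 : 0 < modulus k + 1 by have := modulus_ge0 k; lra.
have [N1 {}h] := h _ (divr_gt0 e0 k0); exists N1 => N /h {}h.
rewrite -mulrBr modulusM; apply: le_trans (ler_wpM2l (modulus_ge0 _) h) _.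
rewrite mulrCA ger_pMr // ler_pdivrMr // mul1r; lra.
Qed.

Lemma tends_cst (k : C) : tends (fun=> k) k.
Proof. by move=> e e0; exists 0%N => N _; rewrite subrr modulus0 ltW. Qed.

Lemma tends_ext u v L N0 : (forall N, (N0 <= N)%N -> u N = v N) -> tends u L -> tends v L.
Proof.
move=> uv h e /h[N1 {}h]; exists (maxn N0 N1) => N.
by rewrite geq_max => /andP[/uv <- /h].
Qed.

Lemma tends_bound u L B N0 : tends u L -> (forall N, (N0 <= N)%N -> modulus (u N) <= B) ->
  modulus L <= B.
Proof.
move=> h hB; apply/ler_addgt0Pr => e /h[N1 {}h].
have := h _ (leq_maxr N0 N1); have := hB _ (leq_maxl N0 N1).
set v := u _ => h1 h2; rewrite -[L](subrK v); apply: le_trans (modulusD _ _) _.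
by rewrite modulusB; lra.
Qed.

Lemma real_cauchy (v : nat -> R) B N0 :
  (forall N M, (N0 <= N)%N -> (N <= M)%N -> `|v M - v N| <= B / N%:R) ->
  exists x, forall N, (N0 <= N)%N -> `|v N - x| <= B / N%:R.
Proof.
move=> h.
pose lo := [set v N - B / N%:R | N in [set N | (N0 <= N)%N]].
have lohi N M : (N0 <= N)%N -> (N0 <= M)%N -> v N - B / N%:R <= v M + B / M%:R.
  move=> hN hM; case: (leqP N M) => [NM|/ltnW MN].
    have := h _ _ hN NM; have := h _ _ hM (leqnn M).
    by rewrite subrr normr0 ler_norml => ? /andP[? ?]; lra.
  have := h _ _ hM MN; have := h _ _ hN (leqnn N).
  by rewrite subrr normr0 ler_norml => ? /andP[? ?]; lra.
have hs : has_sup lo.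
  split; first by exists (v N0 - B / N0%:R), N0 => //=.
  by exists (v N0 + B / N0%:R) => _ [N hN <-]; exact: lohi.
exists (sup lo) => N hN; rewrite ler_norml.
have h1 : v N - B / N%:R <= sup lo by apply: sup_upper_bound => //; exists N.
have h2 : sup lo <= v N + B / N%:R.
  by apply: ge_sup => [|_ [M hM <-]]; [case: hs|exact: lohi].
by apply/andP; split; lra.
Qed.

Lemma complex_cauchy (u : nat -> C) B N0 :
  (forall N M, (N0 <= N)%N -> (N <= M)%N -> modulus (u M - u N) <= B / N%:R) ->
  exists L, forall N, (N0 <= N)%N -> modulus (u N - L) <= 2 * B / N%:R.
Proof.
move=> h.
have [N M hN NM|x hx] := @real_cauchy (fun N => Re (u N)) B N0.
  by apply: le_trans (h _ _ hN NM); rewrite -[- Re _]raddfN -Re_add; exact: normr_Re.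
have [N M hN NM|y hy] := @real_cauchy (fun N => Im (u N)) B N0.
  by apply: le_trans (h _ _ hN NM); rewrite -[- Im _]raddfN -Im_add; exact: normr_Im.
exists (pt x y) => N hN; apply: le_trans (modulus_ReIm _) _.
rewrite Re_add Im_add !raddfN /= -mulrA mulr2n mulrDl mul1r.
by apply: lerD; [exact: hx|exact: hy].
Qed.

Lemma tends0 (u : nat -> C) (B : R) N0 :
  (forall N, (N0 <= N)%N -> (0 < N)%N -> modulus (u N) <= B / N%:R) -> tends u 0.
Proof.
move=> h e /(inv_small B)[N1 h1]; exists (maxn (maxn N0 N1) 1) => N.
rewrite !geq_max => /andP[/andP[hN0 hN1] N_gt0].
by rewrite subr0; apply: le_trans (h _ hN0 N_gt0) _; exact: h1.
Qed.

Lemma sum_zrange_tele N (F : int -> C) :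
  \sum_(i <- zrange N) (F (i - 1) - F i) = F (- N%:Z - 1) - F N%:Z.
Proof.
rewrite big_map.
have -> : F N%:Z = F ((2 * N).+1%:Z - N%:Z - 1) by congr F; lia.
have -> : F (- N%:Z - 1) = F (0%:Z - N%:Z - 1) by congr F; lia.
elim: (2 * N).+1 => [|k IH]; first by rewrite big_nil subrr.
rewrite -addn1 iotaD big_cat IH /= big_seq1.
have -> : F ((k + 1)%N%:Z - N%:Z - 1) = F (k%:Z - N%:Z) by congr F; lia.
by rewrite addrA subrK.
Qed.

Section Dominated.
Variables (t : int * int -> C) (A : R) (N0 : nat).
Hypotheses (A0 : 0 <= A) (N0_gt0 : (0 < N0)%N) (ht : dominated t A N0).

Lemma dominated_limit : exists L, forall N, (N0 <= N)%N ->
  modulus (bsum N t - L) <= 2 * (6 * A) / N%:R.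
Proof.
apply: complex_cauchy => N M hN NM; apply: sum_minus_box => //.
- by lia.
- by move=> p hp; apply: ht; lia.
- exact: box_uniq.
- by move=> p; exact: box_sub.
Qed.

Lemma dominated_tends L :
  (forall N, (N0 <= N)%N -> modulus (bsum N t - L) <= 2 * (6 * A) / N%:R) ->
  tends (bsum ^~ t) L.
Proof.
move=> h e /(inv_small (2 * (6 * A)))[N1 hN1]; exists (maxn N0 N1) => N.
rewrite geq_max => /andP[h0 h1]; apply: le_trans (h _ h0) _; apply: hN1 => //; lia.
Qed.

(** The sum over the net of finite subsets agrees with the limit over boxes:
    outside a large box, what any finite set adds is small. *)
Lemma dominated_sum : tends (bsum ^~ t) (sum (t : int * int -> C)).
Proof.
have [L hL] := dominated_limit.
have hT := dominated_tends hL.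
suff -> : sum (t : int * int -> C) = L by [].
have PF := @totally_filter (int * int)%type.
have FF : Filter (@totally (int * int)%type) by exact: filter_filter.
apply: cvg_lim; first exact: norm_hausdorff.
apply/cvgrPdist_le => e e0.
have re : (Re e)%:C%C = e by apply: RRe_real; apply: gtr0_real.
have e0' : 0 < Re e / 2 by rewrite divr_gt0 // -ltcR re.
have [N1 h1] := inv_small (6 * A) e0'; have [N2 h2] := hT _ e0'.
pose N := maxn N0 (maxn N1 N2).
have NN0 : (N0 <= N)%N by rewrite leq_maxl.
have NN1 : (N1 <= N)%N by rewrite /N; lia.
have NN2 : (N2 <= N)%N by rewrite /N; lia.
exists [fset p | p in box N]%fset => // S /= hS.
have -> : partial_sum t S = \sum_(p <- S) t p by rewrite /partial_sum big_seq_fsetE.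
rewrite normr_modulus -re lecR.
rewrite modulusB; apply: le_trans (modulus_dist _ (bsum N t) _) _.
rewrite (splitr (Re e)); apply: lerD; last exact: h2.
apply: le_trans (h1 _ NN1 _); last by lia.
apply: sum_minus_box => //.
- by lia.
- by move=> p hp; apply: ht; lia.
- exact: fset_uniq.
- by move=> p hp; apply: (fsubsetP hS); apply/imfsetP; exists p.
Qed.

End Dominated.

End LatticeSums.

(** * The Weierstrass zeta function *)

Section Zeta.
Variable R : realType.
Local Notation C := (complex_complex__canonical__Num_NumField R).
Local Notation Re := (@complex.Re R).
Local Notation Im := (@complex.Im R).
Local Notation modulus := (@modulus R).
Variable tau : C.
Hypothesis tau0 : 0 < Im tau.
Implicit Types (p q : int * int) (z w h : C) (F t : int * int -> C).

Definition wp p : C := p.1%:~R + p.2%:~R * tau.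

Lemma latticeP z : lattice tau z <-> exists p, z = wp p.
Proof. by split=> [[m [n ->]]|[[m n] ->]]; [exists (m, n)|exists m, n]. Qed.

Lemma wp0 : wp 0 = 0.
Proof. by rewrite /wp !mulr0z mul0r addr0. Qed.

Lemma wpB p q : wp p - wp q = wp (p.1 - q.1, p.2 - q.2).
Proof. by rewrite /wp /= !rmorphB /=; ring. Qed.

Lemma wpN p : wp (- p.1, - p.2) = - wp p.
Proof. by rewrite /wp /= !rmorphN /=; ring. Qed.

(** The coordinates of a lattice point are controlled by its modulus: the second
    one by the imaginary part, and then the first one by the real part. *)
Definition taxi_const : R := 1 + (1 + modulus tau) / Im tau.

Lemma taxi_const_gt0 : 0 < taxi_const.
Proof.
have : 0 <= (1 + modulus tau) / Im tau.
  by rewrite divr_ge0 ?(ltW tau0) // addr_ge0 ?modulus_ge0.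
by rewrite /taxi_const; lra.
Qed.

Lemma intC (n : int) : (n%:~R : C) = (n%:~R : R)%:C%C.
Proof. by rewrite rmorph_int. Qed.

Lemma taxi_le p : (taxi p)%:R <= taxi_const * modulus (wp p).
Proof.
have E2 : Im (wp p) = p.2%:~R * Im tau.
  by rewrite /wp Im_add Im_mul !intC /= mul0r addr0 add0r.
have E1 : Re (wp p) = p.1%:~R + p.2%:~R * Re tau.
  by rewrite /wp Re_add Re_mul !intC /= mul0r subr0.
have h2 : `|p.2%:~R : R| <= modulus (wp p) / Im tau.
  rewrite ler_pdivlMr // -{1}(gtr0_norm tau0) -normrM -E2; exact: normr_Im.
have h1 : `|p.1%:~R : R| <= modulus (wp p) + modulus (wp p) / Im tau * modulus tau.
  have -> : (p.1%:~R : R) = Re (wp p) - p.2%:~R * Re tau by rewrite E1 addrK.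
  apply: le_trans (ler_normB _ _) _; apply: lerD; first exact: normr_Re.
  by rewrite normrM; apply: ler_pM => //; exact: normr_Re.
have -> : (taxi p)%:R = `|p.1%:~R : R| + `|p.2%:~R : R|.
  by rewrite /taxi natrD !natr_absz !intr_norm.
apply: le_trans (lerD h1 h2) _; rewrite le_eqVlt; apply/orP; left; apply/eqP.
by rewrite /taxi_const; field; rewrite gt_eqF.
Qed.

Lemma taxi_eq0 p : taxi p = 0%N -> p = 0.
Proof. by case: p => m n; rewrite /taxi /= => h; congr (_, _); lia. Qed.

Lemma wp_inj : injective wp.
Proof.
move=> p q pq; have := taxi_le (p.1 - q.1, p.2 - q.2).
rewrite -wpB pq subrr modulus0 mulr0 lern0 => /eqP /taxi_eq0 [].
by case: p q {pq} => [m n] [m' n'] /= /eqP + /eqP; rewrite !subr_eq0 => /eqP -> /eqP ->.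
Qed.

Lemma wp_sep p q : p != q -> 1 <= taxi_const * modulus (wp p - wp q).
Proof.
move=> pq; rewrite wpB; apply: le_trans (taxi_le _).
rewrite ler1n lt0n; apply: contra pq => /eqP /taxi_eq0 [].
by case: p q => [m n] [m' n'] /= /eqP + /eqP; rewrite !subr_eq0 => /eqP -> /eqP ->.
Qed.

Lemma lattice_isolated z : \forall w \near z^', ~ lattice tau w.
Proof.
have k0 := taxi_const_gt0; apply/dnear_modulus.
have i0 : 0 < (2 * taxi_const)^-1 by rewrite invr_gt0 mulr_gt0.
case: (pselect (exists p, wp p <> z /\ modulus (wp p - z) < (2 * taxi_const)^-1)) => [[p [pz hp]]|none].
  have p0 : 0 < modulus (wp p - z) by rewrite modulus_gt0 subr_eq0; apply/eqP.
  exists (modulus (wp p - z)) => // w hw wz /latticeP[q wq].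
  have pq : p != q by apply: contraTneq hw => ->; rewrite wq ltxx.
  have := wp_sep pq; have : modulus (wp p - wp q) < taxi_const^-1.
    apply: le_lt_trans (modulus_dist _ z _) _; rewrite -wq [modulus (z - w)]modulusB.
    have E : (2 * taxi_const)^-1 = taxi_const^-1 / 2 by rewrite invfM mulrC.
    by move: hp hw; rewrite E; lra.
  by rewrite -(ltr_pM2l k0) divff ?gt_eqF // => /lt_le_trans h /h; rewrite ltxx.
exists (2 * taxi_const)^-1 => // w hw wz /latticeP[q wq]; apply: none.
by exists q; rewrite -wq; split=> //; apply/eqP.
Qed.

Lemma far_lattice (rho : R) : exists2 N0, (0 < N0)%N &
  forall p, (N0 < taxi p)%N -> 2 * rho <= modulus (wp p).
Proof.
have k0 := taxi_const_gt0.
exists (Num.bound (`|2 * rho * taxi_const|)).+1 => // p hp.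
rewrite -(ler_pM2l k0) mulrC; apply: le_trans (taxi_le p).
apply: le_trans (ler_norm _) _; apply: le_trans (ltW (archi_boundP (normr_ge0 _))) _.
by rewrite ler_nat; exact: ltnW (ltnW hp).
Qed.

Lemma dominated_inv3 t (B : R) N0 : 0 <= B ->
  (forall p, (N0 < taxi p)%N -> modulus (t p) <= B * modulus (wp p) ^- 3) ->
  dominated t (B * taxi_const ^+ 3) N0.
Proof.
move=> B0 h p hp; apply: le_trans (h p hp) _; rewrite -mulrA ler_wpM2l //.
have k0 := taxi_const_gt0.
have s0 : 0 < ((taxi p)%:R : R) by rewrite ltr0n; lia.
have w0 : 0 < modulus (wp p).
  by rewrite -(pmulr_rgt0 _ k0); exact: lt_le_trans (taxi_le p).
rewrite -!exprVn -exprMn lerXn2r ?nnegrE //.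
- by rewrite invr_ge0 ltW.
- by rewrite mulr_ge0 ?invr_ge0 ?(ltW k0) // ltW.
by rewrite ler_pdivlMr // mulrC ler_pdivrMr // taxi_le.
Qed.

(** The general term of the zeta series.  Since 0^-1 = 0, the point 0
    contributes the polar term z^-1. *)
Definition zterm z w : C := (z - w)^-1 + w^-1 + z / w ^+ 2.

Definition zetaN N z : C := bsum N (fun p => zterm z (wp p)).

Section Far.
Variables (rho : R) (z w : C).
Hypotheses (rho0 : 0 < rho) (zr : modulus z < rho) (wr : 2 * rho <= modulus w).

Lemma far_neq0 : [/\ 0 < modulus w, w != 0, z - w != 0 & modulus w / 2 <= modulus (z - w)].
Proof.
have w0 : 0 < modulus w by move: rho0 wr; lra.
have h : modulus w / 2 <= modulus (z - w).
  have := modulusD (w - z) z; rewrite subrK modulusB.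
  by move: zr wr; lra.
split=> //; rewrite -modulus_gt0 //.
by apply: lt_le_trans h; rewrite divr_gt0.
Qed.

(** The added terms cancel the expansion of (z - w)^-1 up to order two in 1/w,
    leaving a remainder of order |w|^-3. *)
Lemma zterm_bound : modulus (zterm z w) <= 2 * rho ^+ 2 * modulus w ^- 3.
Proof.
have [w0 wn zw h] := far_neq0.
have -> : zterm z w = z ^+ 2 / (w ^+ 2 * (z - w)) by rewrite /zterm; field; rewrite wn zw.
rewrite modulusM modulusV modulusM !modulusX.
have -> : 2 * rho ^+ 2 * modulus w ^- 3 = rho ^+ 2 / (modulus w ^+ 2 * (modulus w / 2)).
  by field; rewrite gt_eqF.
have h0 : 0 < modulus w / 2 by rewrite divr_gt0.
have zw0 := lt_le_trans h0 h.
have w20 : 0 < modulus w ^+ 2 by rewrite exprn_gt0.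
apply: ler_pM; rewrite ?exprn_ge0 ?modulus_ge0 //.
- by rewrite invr_ge0 mulr_ge0 ?modulus_ge0 ?exprn_ge0 // modulus_ge0.
- by rewrite lerXn2r ?nnegrE ?modulus_ge0 ?ltW.
by rewrite lef_pV2 ?posrE ?mulr_gt0 // ler_wpM2l // ltW.
Qed.

Lemma dzterm_bound :
  modulus (- (z - w) ^- 2 + w ^- 2) <= 12 * rho * modulus w ^- 3.
Proof.
have [w0 wn zw h] := far_neq0.
have -> : - (z - w) ^- 2 + w ^- 2 = z * (z - 2 * w) / ((z - w) ^+ 2 * w ^+ 2).
  by field; rewrite wn zw.
rewrite !modulusM modulusV modulusM !modulusX.
have -> : 12 * rho * modulus w ^- 3 = rho * (3 * modulus w) / ((modulus w / 2) ^+ 2 * modulus w ^+ 2).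
  by field; rewrite gt_eqF.
have h0 : 0 < modulus w / 2 by rewrite divr_gt0.
have zw0 := lt_le_trans h0 h.
have k2 : modulus (2 : C) = 2 by rewrite -(rmorph_nat (real_complex R) 2) modulusR ger0_norm.
have num : modulus (z - 2 * w) <= 3 * modulus w.
  by apply: le_trans (modulusD _ _) _; rewrite modulusN modulusM k2; move: zr wr w0; lra.
have d1 : 0 < (modulus w / 2) ^+ 2 * modulus w ^+ 2 by apply: mulr_gt0; rewrite exprn_gt0.
have d2 : 0 < modulus (z - w) ^+ 2 * modulus w ^+ 2 by apply: mulr_gt0; rewrite exprn_gt0.
apply: ler_pM.
- by rewrite mulr_ge0 ?modulus_ge0.
- by rewrite invr_ge0 ltW.
- by apply: ler_pM; rewrite ?modulus_ge0 // ltW.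
rewrite lef_pV2 ?posrE // ler_wpM2r ?exprn_ge0 ?(ltW w0) //.
by rewrite lerXn2r ?nnegrE ?(ltW h0) ?modulus_ge0.
Qed.

Lemma zterm_taylor h : modulus (z + h) < rho ->
  modulus (zterm (z + h) w - zterm z w - h * (- (z - w) ^- 2 + w ^- 2)) <=
  8 * modulus h ^+ 2 * modulus w ^- 3.
Proof.
move=> zhr.
have [w0 wn zw hz] := far_neq0.
have hzh : modulus w / 2 <= modulus (w - z - h).
  have := modulusD (w - z - h) (z + h).
  have -> : w - z - h + (z + h) = w by ring.
  by move: zhr wr; lra.
have h0 : 0 < modulus w / 2 by rewrite divr_gt0.
have uh : w - z - h != 0 by rewrite -modulus_gt0; exact: lt_le_trans hzh.
have u0 : w - z != 0 by rewrite -opprB oppr_eq0.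
have -> : zterm (z + h) w - zterm z w - h * (- (z - w) ^- 2 + w ^- 2) =
  - (h ^+ 2 / ((w - z) ^+ 2 * (w - z - h))).
  have z1 : z + h - w = - (w - z - h) by ring.
  have z2 : z - w = - (w - z) by ring.
  by rewrite -inv_taylor1 // /zterm z1 z2 sqrrN !invrN; ring.
rewrite modulusN modulusM modulusV modulusM !modulusX.
have -> : 8 * modulus h ^+ 2 * modulus w ^- 3 = modulus h ^+ 2 / ((modulus w / 2) ^+ 2 * (modulus w / 2)).
  by field; rewrite gt_eqF.
rewrite ler_wpM2l ?exprn_ge0 ?modulus_ge0 //.
have d1 : 0 < (modulus w / 2) ^+ 2 * (modulus w / 2) by apply: mulr_gt0; rewrite ?exprn_gt0.
have hz' : modulus w / 2 <= modulus (w - z) by rewrite modulusB.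
have d2 : 0 < modulus (w - z) ^+ 2 * modulus (w - z - h).
  by apply: mulr_gt0; [rewrite exprn_gt0 // modulus_gt0|rewrite modulus_gt0].
rewrite lef_pV2 ?posrE //; apply: ler_pM => //; rewrite ?exprn_ge0 ?(ltW h0) //.
by rewrite lerXn2r ?nnegrE ?(ltW h0) ?modulus_ge0.
Qed.

End Far.

Lemma zterm_dominated rho z N0 : 0 < rho -> modulus z < rho ->
  (forall p, (N0 < taxi p)%N -> 2 * rho <= modulus (wp p)) ->
  dominated (fun p => zterm z (wp p)) (2 * rho ^+ 2 * taxi_const ^+ 3) N0.
Proof.
move=> r0 zr hN; apply: dominated_inv3; first by rewrite mulr_ge0 ?exprn_ge0 // ltW.
by move=> p /hN; exact: zterm_bound.
Qed.

Lemma bsum_eq0_only N (a : C) : bsum N (fun p => if p == 0 then a else 0) = a.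
Proof.
rewrite /bsum (bigD1_seq 0) ?box_uniq ?mem_box //= big1 ?addr0 //.
by move=> p /negbTE ->.
Qed.

Lemma zeta_tends z : tends (fun N => zetaN N z) (zeta tau z).
Proof.
pose rho := modulus z + 1.
have r0 : 0 < rho by rewrite /rho ltr_wpDl ?modulus_ge0.
have zr : modulus z < rho by rewrite /rho ltrDl.
have [N0 N00 hN] := far_lattice rho.
pose t p := if p == 0 then 0 else zterm z (wp p).
have ht : dominated t (2 * rho ^+ 2 * taxi_const ^+ 3) N0.
  move=> p hp; rewrite /t; case: eqP => [p0|_]; last exact: zterm_dominated hp.
  by move: hp; rewrite p0.
have A0 : 0 <= 2 * rho ^+ 2 * taxi_const ^+ 3.
  by rewrite !mulr_ge0 ?exprn_ge0 ?(ltW taxi_const_gt0) // ltW.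
have tS := dominated_sum A0 N00 ht.
have -> : zeta tau z = z^-1 + sum (t : int * int -> C) by [].
apply: (tends_ext (N0 := 0%N) _ (tendsD (tends_cst z^-1) tS)) => N _.
rewrite -{1}(bsum_eq0_only N z^-1) /zetaN /bsum -big_split /=; apply: eq_bigr => p _.
rewrite /t; case: eqP => [->|_]; last by rewrite add0r.
by rewrite /zterm wp0 subr0 invr0 expr0n /= invr0 mulr0 !addr0.
Qed.

Lemma bsum_off N M F : (N <= M)%N ->
  bsum M (fun p => if p \in box N then 0 else F p) = bsum M F - bsum N F.
Proof.
move=> NM; rewrite {2}/bsum (bigID (fun p => p \in box N)) /=.
have -> : \sum_(p <- box M | p \in box N) F p = bsum N F.
  rewrite -big_filter; apply: perm_big; apply: uniq_perm; rewrite ?filter_uniq ?box_uniq //.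
  by move=> p; rewrite mem_filter andb_idr //; exact: box_sub.
rewrite addrAC subrr add0r [RHS]big_mkcond; apply: eq_bigr => p _.
by case: (p \in box N).
Qed.

Lemma modulus_bsum_off N M F (A : R) : 0 <= A -> (0 < N)%N -> dominated F A N ->
  modulus (bsum M (fun p => if p \in box N then 0 else F p)) <= 6 * A / N%:R.
Proof.
move=> A0 N0 hF; have -> : bsum M (fun p => if p \in box N then 0 else F p) =
    \sum_(p <- [seq p <- box M | p \notin box N]) F p.
  by rewrite big_filter big_mkcond; apply: eq_bigr => p _; case: (p \in box N).
apply: dominated_tail => //; first by rewrite filter_uniq ?box_uniq.
by move=> p; rewrite mem_filter => /andP[/notin_box_taxi].
Qed.

(** Far from the poles the Taylor remainders of the terms are O(|h|^2 |w|^-3)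
    uniformly, so that the tail can be differentiated termwise. *)
Lemma zeta_tail_derivable (rho : R) : 0 < rho -> exists2 N0, (0 < N0)%N &
  forall N z, (N0 <= N)%N -> modulus z < rho ->
    derivable (fun w => zeta tau w - zetaN N w) z 1.
Proof.
move=> r0; have [N0 N00 hN] := far_lattice rho; exists N0 => // N z N0N zr.
have N_gt0 : (0 < N)%N by lia.
have k3 : 0 <= taxi_const ^+ 3 by rewrite exprn_ge0 // ltW // taxi_const_gt0.
have hN' p : (N < taxi p)%N -> 2 * rho <= modulus (wp p) by move=> h; apply: hN; lia.
pose T w := zeta tau w - zetaN N w.
have Tlim w : tends (fun M => bsum M (fun p => if p \in box N then 0 else zterm w (wp p))) (T w).
  apply: (@tends_ext _ (fun M => zetaN M w - zetaN N w) _ _ N).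
    by move=> M NM; rewrite bsum_off.
  by apply: tendsD; [exact: zeta_tends|exact: tends_cst].
pose v p := - (z - wp p) ^- 2 + wp p ^- 2.
pose vN p := if p \in box N then 0 else v p.
have hv : dominated v (12 * rho * taxi_const ^+ 3) N.
  apply: dominated_inv3; first by rewrite mulr_ge0 // ltW.
  by move=> p /hN'; exact: dzterm_bound.
have Av0 : 0 <= 12 * rho * taxi_const ^+ 3 by rewrite mulr_ge0 // mulr_ge0 // ltW.
have hvN : dominated vN (12 * rho * taxi_const ^+ 3) N.
  move=> p hp; rewrite /vN; case: ifP => _; last exact: hv.
  by rewrite modulus0 mulr_ge0 // invr_ge0 exprn_ge0.
have [D hD] := dominated_limit Av0 N_gt0 hvN.
have {hD} Dlim := dominated_tends Av0 N_gt0 hD.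
apply: (has_deriv_derivable (d := D)) => e e0.
(* 48 = 6 * 8: the bound 6 A / N on a tail, with the A of zterm_taylor *)
pose Q := 48 * taxi_const ^+ 3 + 1.
have Q0 : 0 < Q by rewrite /Q ltr_wpDl // mulr_ge0.
exists (Num.min (rho - modulus z) (e / Q)); first by rewrite lt_min subr_gt0 zr divr_gt0.
move=> w; rewrite lt_min => /andP[w1 w2]; set h := w - z in w1 w2 *.
have wE : w = z + h by rewrite /h addrC subrK.
have zhr : modulus (z + h) < rho.
  by apply: le_lt_trans (modulusD _ _) _; move: w1; lra.
pose F p := zterm w (wp p) - zterm z (wp p) - h * v p.
have A0 : 0 <= 8 * modulus h ^+ 2 * taxi_const ^+ 3 by rewrite mulr_ge0 // mulr_ge0 // sqr_ge0.
have hF : dominated F (8 * modulus h ^+ 2 * taxi_const ^+ 3) N.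
  apply: dominated_inv3; first by rewrite mulr_ge0 // sqr_ge0.
  by move=> p /hN' hp; rewrite /F /v wE; exact: (zterm_taylor r0 zr hp zhr).
have Flim : tends (fun M => bsum M (fun p => if p \in box N then 0 else F p)) (T w - T z - D * h).
  rewrite [D * h]mulrC.
  apply: (tends_ext (N0 := 0%N) _ (tendsD (tendsD (Tlim w) (tendsN (Tlim z))) (tendsN (tendsZ h Dlim)))) => M _.
  rewrite /bsum -!sumrN mulr_sumr -sumrN -!big_split /=; apply: eq_bigr => p _.
  by rewrite /vN /F; case: ifP => _ //; rewrite mulr0 subrr subr0.
have := tends_bound Flim (fun M (_ : (0 <= M)%N) => @modulus_bsum_off N M F _ A0 N_gt0 hF).
move=> /le_trans; apply.
have Nr : 1 <= (N%:R : R) by rewrite ler1n.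
have Nr0 : 0 < (N%:R : R) by rewrite ltr0n.
apply: (@le_trans _ _ (48 * taxi_const ^+ 3 * modulus h * modulus h)).
  rewrite ler_pdivrMr //.
  have -> : 6 * (8 * modulus h ^+ 2 * taxi_const ^+ 3) = 48 * taxi_const ^+ 3 * modulus h * modulus h by ring.
  by apply: ler_peMr => //; rewrite mulr_ge0 ?modulus_ge0 // mulr_ge0 ?modulus_ge0 // mulr_ge0.
rewrite ler_wpM2r ?modulus_ge0 //; apply: (@le_trans _ _ (Q * modulus h)).
  by rewrite ler_wpM2r ?modulus_ge0 // /Q; lra.
by rewrite mulrC -ler_pdivlMr // ltW.
Qed.

Lemma drv_sum (I : eqType) (r : seq I) (G : I -> C -> C) z :
  (forall i, i \in r -> derivable (G i) z 1) ->
  derivable (fun w => \sum_(i <- r) G i w) z 1.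
Proof.
elim: r => [|i r IH] h.
  rewrite (_ : (fun w => _) = (fun=> 0)); first exact: drv_cst.
  by apply/funext => w; rewrite big_nil.
rewrite (_ : (fun w => _) = (fun w => G i w + \sum_(j <- r) G j w)).
  apply: drvD; first by apply: h; rewrite mem_head.
  by apply: IH => j jr; apply: h; rewrite in_cons jr orbT.
by apply/funext => w; rewrite big_cons.
Qed.

Lemma zterm_derivable z w : z != w -> derivable (fun s => zterm s w) z 1.
Proof.
move=> zw; apply: drvD.
  exact: (drvD (drv_invB zw) (drv_cst _ _)).
exact: (drvM (drv_id z) (drv_cst _ _)).
Qed.

Lemma zeta_derivable z : ~ lattice tau z -> derivable (zeta tau) z 1.
Proof.
move=> nz; have r0 : 0 < modulus z + 1 by rewrite ltr_wpDl ?modulus_ge0.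
have [N0 _ h] := zeta_tail_derivable r0.
have zr : modulus z < modulus z + 1 by rewrite ltrDl.
have {h} hT := h N0 z (leqnn _) zr.
rewrite (_ : zeta tau = fun w => (zeta tau w - zetaN N0 w) + zetaN N0 w).
  apply: (drvD hT); apply: drv_sum => p _; apply: zterm_derivable.
  by apply/eqP => zp; apply: nz; apply/latticeP; exists p.
by apply/funext => w; rewrite subrK.
Qed.

(** Take a box containing p: the finite sum has the pole, and the tail is
    differentiable. *)
Lemma zeta_pole p : holomorphic_at (fun z => zeta tau z - (z - wp p)^-1) (wp p).
Proof.
have r0 : 0 < modulus (wp p) + 1 by rewrite ltr_wpDl ?modulus_ge0.
have [N0 _ h] := zeta_tail_derivable r0.
pose N := maxn N0 (taxi p).
have pN : p \in box N by rewrite mem_box /N /taxi; lia.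
have [e e0 he] := (dnear_modulus _ _).1 (lattice_isolated (wp p)).
apply/near_modulus; exists (Num.min e 1); first by rewrite lt_min e0 ltr01.
move=> z; rewrite lt_min => /andP[ze z1].
have zr : modulus z < modulus (wp p) + 1.
  by rewrite -[z](subrK (wp p)) addrC; apply: le_lt_trans (modulusD _ _) _; rewrite ltrD2l.
have hT := h N z (leq_maxl _ _) zr.
pose G s := \sum_(q <- rem p (box N)) zterm s (wp q) + ((wp p)^-1 + s / wp p ^+ 2).
rewrite (_ : (fun z => _) = fun s => (zeta tau s - zetaN N s) + G s).
  apply: (drvD hT); apply: drvD; last first.
    exact: (drvD (drv_cst _ _) (drvM (drv_id z) (drv_cst _ _))).
  apply: drv_sum => q; rewrite (mem_rem_uniq _ (box_uniq N)) inE => /andP[qp _].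
  apply: zterm_derivable; apply/eqP => zq.
  apply: (he z ze); last by apply/latticeP; exists q.
  by rewrite zq (inj_eq wp_inj).
apply/funext => s; rewrite /G /zetaN /bsum (big_rem p pN) /=.
by set S := \sum_(_ <- _) _; rewrite /zterm; ring.
Qed.

End Zeta.

(** * Quasi-periods *)

Section QuasiPeriods.
Variable R : realType.
Local Notation C := (complex_complex__canonical__Num_NumField R).
Local Notation Re := (@complex.Re R).
Local Notation Im := (@complex.Im R).
Local Notation modulus := (@modulus R).
Variable tau : C.
Hypothesis tau0 : 0 < Im tau.
Local Notation wp := (wp tau).
Local Notation taxi_const := (taxi_const tau).
Local Notation zetaN := (zetaN tau).
Local Notation zeta := (zeta tau).
Implicit Types (p q e : int * int) (z w : C).

Lemma box_shift1 N (a : int * int -> C) :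
  \sum_(p <- box N) (a (p.1 - 1, p.2) - a p) =
  \sum_(j <- zrange N) (a (- N%:Z - 1, j) - a (N%:Z, j)).
Proof.
rewrite big_allpairs exchange_big /=; apply: eq_bigr => j _.
exact: (sum_zrange_tele N (fun i => a (i, j))).
Qed.

Lemma box_shift2 N (a : int * int -> C) :
  \sum_(p <- box N) (a (p.1, p.2 - 1) - a p) =
  \sum_(i <- zrange N) (a (i, - N%:Z - 1) - a (i, N%:Z)).
Proof.
rewrite big_allpairs /=; apply: eq_bigr => i _.
exact: (sum_zrange_tele N (fun j => a (i, j))).
Qed.

Section Boundary.
Variables z z0 : C.

Let a p : C := (z - wp p)^-1 - (z0 - wp p)^-1.

Lemma pole_difference_bound : exists B N0, [/\ 0 <= B, (0 < N0)%N &
  forall N p, (N0 < N)%N -> (N <= taxi p)%N -> modulus (a p) <= B / N%:R ^+ 2].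
Proof.
pose rho := modulus z + modulus z0 + 1.
have m1 := modulus_ge0 z; have m2 := modulus_ge0 z0.
have r0 : 0 < rho by rewrite /rho; lra.
have zr : modulus z < rho by rewrite /rho; lra.
have zr0 : modulus z0 < rho by rewrite /rho; lra.
have [N0 N00 hN] := far_lattice tau0 rho.
have k0 := taxi_const_gt0 tau0.
exists (modulus (z0 - z) * (2 * taxi_const) ^+ 2), N0; split=> //.
  by rewrite mulr_ge0 ?modulus_ge0 // exprn_ge0 // mulr_ge0 // ltW.
move=> N p hNN hp; have wr := hN p (leq_trans hNN hp).
have [w0 wn zw h1] := far_neq0 r0 zr wr.
have [_ _ zw0 h2] := far_neq0 r0 zr0 wr.
have -> : a p = (z0 - z) * ((z - wp p)^-1 * (z0 - wp p)^-1).
  by rewrite /a; field; rewrite zw zw0.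
rewrite !modulusM !modulusV -mulrA ler_wpM2l ?modulus_ge0 //.
have Np : 0 < (N%:R : R) by rewrite ltr0n (leq_ltn_trans _ hNN).
have hw : N%:R / (2 * taxi_const) <= modulus (wp p) / 2.
  rewrite ler_pdivrMr ?mulr_gt0 //.
  have -> : modulus (wp p) / 2 * (2 * taxi_const) = taxi_const * modulus (wp p) by field.
  by apply: le_trans (taxi_le tau0 p); rewrite ler_nat.
have q0 : 0 < N%:R / (2 * taxi_const) by rewrite divr_gt0 // mulr_gt0.
have E : (2 * taxi_const) ^+ 2 / N%:R ^+ 2 = (N%:R / (2 * taxi_const))^-1 * (N%:R / (2 * taxi_const))^-1.
  by rewrite invf_div -expr2 expr_div_n.
rewrite E; apply: ler_pM; rewrite ?invr_ge0 ?modulus_ge0 //.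
- rewrite lef_pV2 ?posrE ?modulus_gt0 //; exact: le_trans h1.
- rewrite lef_pV2 ?posrE ?modulus_gt0 //; exact: le_trans h2.
Qed.

Lemma boundary_tends0 (u v : nat -> int -> int * int) :
  (forall N j, (N <= taxi (u N j))%N) -> (forall N j, (N <= taxi (v N j))%N) ->
  tends (fun N => \sum_(j <- zrange N) (a (u N j) - a (v N j))) 0.
Proof.
move=> hu hv; have [B [N0 [B0 N00 hB]]] := pole_difference_bound.
apply: (@tends0 _ _ (6 * B) N0.+1) => N hN N_gt0.
have Np : 0 < (N%:R : R) by rewrite ltr0n.
apply: le_trans (modulus_sum _ _) _.
apply: (@le_trans _ _ (\sum_(j <- zrange N) (2 * B / N%:R ^+ 2))).
  apply: ler_sum => j _; apply: le_trans (modulusD _ _) _; rewrite modulusN.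
  have h1 := hB N (u N j) hN (hu N j); have h2 := hB N (v N j) hN (hv N j).
  by apply: le_trans (lerD h1 h2) _; rewrite -mulrA mulr2n mulrDl mul1r.
rewrite big_const_seq count_predT size_zrange iter_addr_0 -[leLHS]mulr_natl.
have -> : 6 * B / N%:R = (3 * N%:R) * (2 * B / N%:R ^+ 2) by field; rewrite gt_eqF.
rewrite ler_wpM2r ?divr_ge0 ?exprn_ge0 ?mulr_ge0 //.
by rewrite -natrM ler_nat; lia.
Qed.

End Boundary.

Lemma zetaN_shift N e z z0 :
  zetaN N (z + wp e) - zetaN N z - (zetaN N (z0 + wp e) - zetaN N z0) =
  \sum_(p <- box N) (((z - wp (p.1 - e.1, p.2 - e.2))^-1 - (z0 - wp (p.1 - e.1, p.2 - e.2))^-1)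
     - ((z - wp p)^-1 - (z0 - wp p)^-1)).
Proof.
rewrite /zetaN /bsum -!sumrN -!big_split /= -sumrN -big_split /=; apply: eq_bigr => p _.
rewrite /zterm -!wpB.
have -> : z - (wp p - wp e) = z + wp e - wp p by ring.
have -> : z0 - (wp p - wp e) = z0 + wp e - wp p by ring.
by ring.
Qed.

(** The box sums of the difference telescope to sums over two opposite sides of
    the box, which have O(N) terms of size O(1/N^2). *)
Lemma zeta_shift e z z0 : e = (1, 0) \/ e = (0, 1) ->
  zeta (z + wp e) - zeta z = zeta (z0 + wp e) - zeta z0.
Proof.
move=> he; apply/eqP; rewrite -subr_eq0; apply/eqP.
pose E N := zetaN N (z + wp e) - zetaN N z - (zetaN N (z0 + wp e) - zetaN N z0).
have zt v := zeta_tends tau0 v.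
have E1 : tends E (zeta (z + wp e) - zeta z - (zeta (z0 + wp e) - zeta z0)).
  apply: tendsD; first by apply: tendsD; [exact: zt|exact/tendsN/zt].
  by apply: tendsN; apply: tendsD; [exact: zt|exact/tendsN/zt].
apply: tends_unique E1 _.
pose a p : C := (z - wp p)^-1 - (z0 - wp p)^-1.
case: he => ee.
- apply: (tends_ext (N0 := 0%N) _ (@boundary_tends0 z z0 (fun N j => (- N%:Z - 1, j)) (fun N j => (N%:Z, j)) _ _)).
  + move=> N _; rewrite /E zetaN_shift ee -(box_shift1 N a).
    by apply: eq_bigr => p _; rewrite /a !subr0.
  + by move=> N j; rewrite /taxi /=; lia.
  + by move=> N j; rewrite /taxi /=; lia.
- apply: (tends_ext (N0 := 0%N) _ (@boundary_tends0 z z0 (fun N i => (i, - N%:Z - 1)) (fun N i => (i, N%:Z)) _ _)).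
  + move=> N _; rewrite /E zetaN_shift ee -(box_shift2 N a).
    by apply: eq_bigr => p _; rewrite /a !subr0.
  + by move=> N j; rewrite /taxi /=; lia.
  + by move=> N j; rewrite /taxi /=; lia.
Qed.

Lemma zetaN_odd N z : zetaN N (- z) = - zetaN N z.
Proof.
rewrite /zetaN /bsum -sumrN.
have -> : \sum_(p <- box N) zterm (- z) (wp p) =
    \sum_(p <- [seq (- q.1, - q.2) | q <- box N]) zterm (- z) (wp p).
  apply: perm_big; apply: uniq_perm; first exact: box_uniq.
    rewrite map_inj_uniq ?box_uniq // => -[i j] [i' j'] /= [hi hj].
    by congr (_, _); lia.
  move=> [i j]; apply/idP/mapP => [|[[i' j']]]; rewrite mem_box /= => h.
    by exists (- i, - j); [rewrite mem_box /=; lia|rewrite /= !opprK].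
  by move=> [-> ->]; rewrite mem_box /=; lia.
rewrite big_map; apply: eq_bigr => p _; rewrite wpN /zterm.
have -> : - z - - wp p = - (z - wp p) by ring.
by rewrite !invrN sqrrN; ring.
Qed.

Lemma zeta_odd z : zeta (- z) = - zeta z.
Proof.
apply: tends_unique (zeta_tends tau0 (- z)) _.
apply: (tends_ext (N0 := 0%N) _ (tendsN (zeta_tends tau0 z))) => N _.
by rewrite zetaN_odd.
Qed.

Definition zfun z : C := zeta z - e2 tau * z.

(** The step of zfun along tau, read off at 1/2; its value is - 2 pi i. *)
Definition zstep : C := zfun (2^-1 + tau) - zfun 2^-1.

Lemma wp10 : wp (1, 0) = 1.
Proof. by rewrite /wp /= mul0r addr0. Qed.

Lemma wp01 : wp (0, 1) = tau.
Proof. by rewrite /wp /= mul1r add0r. Qed.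

Lemma zfun1 z : zfun (z + 1) = zfun z.
Proof.
have := zeta_shift z 2^-1 (or_introl (erefl ((1, 0) : int * int))).
rewrite wp10 => h0.
have h : zeta (z + 1) - zeta z = e2 tau := h0.
rewrite /zfun; move: (zeta (z + 1)) (zeta z) (e2 tau) {h0} h => A B E h.
by rewrite mulrDr mulr1 -h; ring.
Qed.

Lemma zfun_tau z : zfun (z + tau) = zfun z + zstep.
Proof.
have := zeta_shift z 2^-1 (or_intror (erefl ((0, 1) : int * int))).
rewrite wp01 /zstep /zfun.
move: (zeta (z + tau)) (zeta z) (zeta (2^-1 + tau)) (zeta 2^-1) (e2 tau) => A B D E F h.
have -> : A = D - E + B by rewrite -h subrK.
by rewrite !mulrDr; ring.
Qed.

Lemma zfun_odd z : zfun (- z) = - zfun z.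
Proof. by rewrite /zfun zeta_odd mulrN opprB opprK addrC. Qed.

Lemma zfun_derivable z : ~ lattice tau z -> derivable zfun z 1.
Proof.
move=> nz; exact: (drvB (zeta_derivable tau0 nz) (drvM (drv_cst (e2 tau) z) (drv_id z))).
Qed.

Lemma zfun_pole p : holomorphic_at (fun z => zfun z - (z - wp p)^-1) (wp p).
Proof.
move: (zeta_pole tau0 p) => h; rewrite /holomorphic_at.
apply: filterS h => z h.
rewrite (_ : (fun z => _) = (fun z => (zeta z - (z - wp p)^-1) - e2 tau * z)).
  exact: (drvB h (drvM (drv_cst (e2 tau) z) (drv_id z))).
by apply/funext => s; rewrite /zfun addrAC.
Qed.

Lemma lattice_coord (x y : R) : lattice tau (x%:C%C + y%:C%C * tau) ->
  exists m n : int, x = m%:~R /\ y = n%:~R.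
Proof.
move=> [m [n]]; rewrite !intC => h; exists m, n.
have hy : y = n%:~R.
  have := congr1 Im h; rewrite !Im_add !Im_mul /= !mul0r !addr0 !add0r.
  by apply: mulIf; rewrite gt_eqF.
split=> //; have := congr1 Re h; rewrite !Re_add !Re_mul /= hy => /addIr.
by [].
Qed.

Lemma int_open01 (x : R) (m : int) : 0 < x < 1 -> x <> m%:~R.
Proof.
by move=> /andP[h0 h1] e; move: h0 h1; rewrite e ltr0z -[1]/(1%:~R) ltr_int; lia.
Qed.

Lemma notin_lattice (x y : R) : 0 < x < 1 \/ 0 < y < 1 ->
  ~ lattice tau (x%:C%C + y%:C%C * tau).
Proof.
move=> h /lattice_coord[m [n [ex ey]]].
by case: h => /int_open01 h; [exact: h ex|exact: h ey].
Qed.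

Lemma wp_lattice p : lattice tau (wp p). Proof. by apply/latticeP; exists p. Qed.

Lemma latticeB z w : lattice tau z -> lattice tau w -> lattice tau (z - w).
Proof. by move=> /latticeP[p ->] /latticeP[q ->]; rewrite wpB; exact: wp_lattice. Qed.

Lemma lattice_near z : ~ lattice tau z -> \forall w \near z, ~ lattice tau w.
Proof.
move=> nz; have /dnear_modulus[e e0 h] := lattice_isolated tau0 z.
apply/near_modulus; exists e => // w we; have [->|] := eqVneq w z; [exact: nz|exact: h].
Qed.

Lemma zfun_holomorphic z : ~ lattice tau z -> holomorphic_at zfun z.
Proof. by move=> /lattice_near; apply: filterS => w; exact: zfun_derivable. Qed.

End QuasiPeriods.

(** * Entire modifications and elliptic functions *)

Section RegularElliptic.
Variable R : realType.
Local Notation C := (complex_complex__canonical__Num_NumField R).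
Local Notation Im := (@complex.Im R).
Local Notation modulus := (@modulus R).
Implicit Types (f g P Q : C -> C) (z w a : C).

Lemma near_dnear z (P : C -> Prop) : (\forall w \near z, P w) -> \forall w \near z^', P w.
Proof.
move=> /near_modulus[e e0 h]; apply/dnear_modulus; exists e => // w we _; exact: h.
Qed.

Lemma cont_near_eq f g z : cont_at f z -> cont_at g z ->
  (\forall w \near z^', f w = g w) -> f z = g z.
Proof.
move=> fc gc /dnear_modulus[r r0 fg]; apply/eqP; rewrite -subr_eq0.
apply/eqP/modulus_small => e e0; have e2 : 0 < e / 2 by rewrite divr_gt0.
have [s s0 hs] := fc _ e2; have [t t0 ht] := gc _ e2.
pose d := Num.min r (Num.min s t) / 2.
have m0 : 0 < Num.min r (Num.min s t) by rewrite !lt_min r0 s0.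
have d0 : 0 < d by rewrite divr_gt0.
have : d < Num.min r (Num.min s t) by rewrite /d; lra.
rewrite !lt_min => /andP[dr /andP[ds dt]].
pose w := z + d%:C%C.
have wz : modulus (w - z) = d by rewrite /w addrAC subrr add0r modulusR gtr0_norm.
have wnz : w != z by rewrite -subr_eq0 -modulus_eq0 wz gt_eqF.
have hf : modulus (f w - f z) <= e / 2 by apply: hs; rewrite wz.
have hg : modulus (g w - g z) <= e / 2 by apply: ht; rewrite wz.
have fgw : f w = g w by apply: fg => //; rewrite wz.
apply: le_trans (modulus_dist _ (f w) _) _; rewrite modulusB fgw; rewrite fgw in hf; lra.
Qed.

Lemma holomorphic_derivable f z : holomorphic_at f z -> derivable f z 1.
Proof. exact: nbhs_singleton. Qed.

Lemma holD f g z : holomorphic_at f z -> holomorphic_at g z ->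
  holomorphic_at (fun w => f w + g w) z.
Proof. by apply: filterS2 => w; exact: drvD. Qed.

Lemma holM f g z : holomorphic_at f z -> holomorphic_at g z ->
  holomorphic_at (fun w => f w * g w) z.
Proof. by apply: filterS2 => w; exact: drvM. Qed.

Lemma hol_cst (k : C) z : holomorphic_at (fun=> k) z.
Proof. by apply: filterE => w; exact: drv_cst. Qed.

Lemma holB f g z : holomorphic_at f z -> holomorphic_at g z ->
  holomorphic_at (fun w => f w - g w) z.
Proof. by apply: filterS2 => w; exact: drvB. Qed.

Lemma derivable_shift f z a : derivable f (z + a) 1 -> derivable (fun w => f (w + a)) z 1.
Proof.
move=> /derivable_has_deriv[d h]; apply: (has_deriv_derivable (d := d)) => e /h[r r0 hr].
exists r => // w wr; have := hr (w + a).
by rewrite opprD addrACA subrr addr0; exact.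
Qed.

Lemma near_shift z a (P : C -> Prop) : (\forall w \near (z + a), P w) ->
  \forall w \near z, P (w + a).
Proof.
move=> /near_modulus[r r0 h]; apply/near_modulus; exists r => // w wr; apply: h.
by rewrite opprD addrACA subrr addr0.
Qed.

Lemma dnear_shift z a (P : C -> Prop) : (\forall w \near (z + a)^', P w) ->
  \forall w \near z^', P (w + a).
Proof.
move=> /dnear_modulus[r r0 h]; apply/dnear_modulus; exists r => // w wr wz; apply: h.
  by rewrite opprD addrACA subrr addr0.
by rewrite (inj_eq (addIr a)).
Qed.

Lemma hol_shift f z a : holomorphic_at f (z + a) -> holomorphic_at (fun w => f (w + a)) z.
Proof. by move=> /near_shift; apply: filterS => w; exact: derivable_shift. Qed.

Lemma dnear_near z (P : C -> Prop) : (\forall w \near z^', P w) ->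
  \forall w \near z^', \forall v \near w, P v.
Proof.
move=> /dnear_modulus[r r0 h]; apply/dnear_modulus; exists r => // w wr wz.
have wz0 : 0 < modulus (w - z) by rewrite modulus_gt0 subr_eq0.
apply/near_modulus; exists (Num.min (r - modulus (w - z)) (modulus (w - z))).
  by rewrite lt_min subr_gt0 wr wz0.
move=> v; rewrite lt_min => /andP[v1 v2]; apply: h.
  by apply: le_lt_trans (modulus_dist v w z) _; move: v1; lra.
by apply: contraTneq v2 => ->; rewrite modulusB ltxx.
Qed.

Lemma dnear_dnear z (P : C -> Prop) : (\forall w \near z^', P w) ->
  \forall w \near z^', \forall v \near w^', P v.
Proof. by move=> /dnear_near; apply: filterS => w; exact: near_dnear. Qed.

(** The local extensions agree wherever two of them are defined, by continuity;
    so their values at their own centers form a single entire function. *)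
Lemma entire_extension P : (forall z, regular_at P z) ->
  exists Q, (forall z, derivable Q z 1) /\ (forall z, \forall w \near z^', P w = Q w).
Proof.
move=> hP.
have hP' z : exists g, holomorphic_at g z /\ \forall w \near z^', P w = g w.
  by have [g h1 h2] := hP z; exists g.
have [g hg] := choice hP'.
pose Q z := g z z.
have QE z : \forall w \near z^', Q w = g z w.
  have [hz Pz] := hg z.
  have hz' : \forall w \near z^', derivable (g z) w 1 by exact: near_dnear.
  have H := dnear_dnear Pz.
  near=> w.
  have [hw Pw] := hg w.
  apply: (cont_near_eq (f := g w)).
  - exact: derivable_cont (holomorphic_derivable hw).
  - by apply: derivable_cont; near: w.
  - have Pzw : \forall v \near w^', P v = g z v by near: w.
    by apply: filterS2 Pw Pzw => v <- <-.
exists Q; split=> z.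
  have [hz _] := hg z.
  apply: derivable_ext (holomorphic_derivable hz).
  have /dnear_modulus[r r0 h] := QE z.
  apply/near_modulus; exists r => // w wr; have [->//|wz] := eqVneq w z.
  by rewrite h.
have [_ Pz] := hg z.
by apply: filterS2 Pz (QE z) => w -> ->.
Unshelve. all: by end_near. Qed.

Lemma extension_shift P Q (a k : C) : (forall z, derivable Q z 1) ->
  (forall z, \forall w \near z^', P w = Q w) ->
  (forall z, \forall w \near z^', P (w + a) = P w + k) -> forall z, Q (z + a) = Q z + k.
Proof.
move=> dQ PQ hP z; apply: (cont_near_eq (f := fun w => Q (w + a)) (g := fun w => Q w + k)).
- by apply: derivable_cont; apply: derivable_shift; exact: dQ.
- by apply: derivable_cont; exact: (drvD (dQ z) (drv_cst k z)).
- have H := dnear_shift (PQ (z + a)).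
  by apply: filterS3 H (PQ z) (hP z) => w <- <-.
Qed.

Variable tau : C.
Hypothesis tau0 : 0 < Im tau.

Lemma regular_elliptic_constant P : (forall z, regular_at P z) ->
  (forall z, \forall w \near z^', P (w + 1) = P w) ->
  (forall z, \forall w \near z^', P (w + tau) = P w) ->
  exists k, forall z, \forall w \near z^', P w = k.
Proof.
move=> hP h1 ht; have [Q [dQ PQ]] := entire_extension hP.
have e1 : forall z, Q (z + 1) = Q z + 0.
  apply: (extension_shift dQ PQ) => u.
  by apply: filterS (h1 u) => x ->; rewrite addr0.
have et : forall z, Q (z + tau) = Q z + 0.
  apply: (extension_shift dQ PQ) => u.
  by apply: filterS (ht u) => x ->; rewrite addr0.
exists (Q 0) => z; apply: filterS (PQ z) => w ->.
by apply: (elliptic_entire_constant tau0 dQ) => v; rewrite ?e1 ?et addr0.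
Qed.

(** Liouville for functions with additive periods.  The increments of such a
    function are elliptic, hence constant, so that it is additive up to a
    constant; differentiability at 0 makes it linear, and the period 1 makes its
    slope vanish. *)
Lemma quasi_periodic_entire Q (c : C) : (forall z, derivable Q z 1) ->
  (forall z, Q (z + 1) = Q z) -> (forall z, Q (z + tau) = Q z + c) ->
  c = 0 /\ forall z, Q z = Q 0.
Proof.
move=> dQ h1 ht.
have incr s z : Q (z + s) - Q z = Q s - Q 0.
  rewrite -[s in RHS]add0r.
  apply: (elliptic_entire_constant (f := fun v => Q (v + s) - Q v) tau0) => v.
  - exact: (drvB (derivable_shift (dQ (v + s))) (dQ v)).
  - by rewrite h1 addrAC h1.
  - by rewrite addrAC !ht; ring.
pose A s := Q s - Q 0.
have AD s t : A (s + t) = A s + A t.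
  by rewrite /A -(incr t s); ring.
have An s n : A (s *+ n) = A s *+ n.
  elim: n => [|n IH]; first by rewrite !mulr0n /A subrr.
  by rewrite !mulrS AD IH.
have A1 : A 1 = 0 by rewrite /A -(h1 0) add0r subrr.
have At : A tau = c by have := ht 0; rewrite add0r /A => ->; rewrite addrAC subrr add0r.
have [d hd] := derivable_has_deriv (dQ 0).
have rate s : A s = d * s.
  apply/eqP; rewrite -subr_eq0; apply/eqP/modulus_small => e e0.
  have s0 : 0 < modulus s + 1 by rewrite ltr_wpDl ?modulus_ge0.
  have [r r0 hr] := hd _ (divr_gt0 e0 s0).
  have [n hn] := halving_small (modulus s) r0.
  pose u := s / (2 ^ n)%:R.
  have n0 : ((2 ^ n)%:R : C) != 0 by rewrite pnatr_eq0 -lt0n expn_gt0.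
  have su : s = u *+ (2 ^ n) by rewrite -mulr_natr /u divfK.
  have mn : modulus ((2 ^ n)%:R : C) = 2 ^+ n.
    by rewrite -(rmorph_nat (real_complex R)) modulusR natrX ger0_norm // exprn_ge0.
  have mu : modulus u = modulus s / 2 ^+ n by rewrite /u modulusM modulusV mn.
  have := hr u; rewrite subr0 mu => /(_ hn).
  rewrite -/(A u) => hu.
  rewrite [in A s]su An [in d * s]su mulrnAr -mulrnBl -mulr_natl modulusM mn.
  have p0 : 0 < (2 : R) ^+ n by rewrite exprn_gt0.
  apply: le_trans (ler_wpM2l (ltW p0) hu) _.
  have -> : 2 ^+ n * (e / (modulus s + 1) * (modulus s / 2 ^+ n)) = e * (modulus s / (modulus s + 1)).
    by field; rewrite !gt_eqF.
  by rewrite ger_pMr // ler_pdivrMr // mul1r lerDl.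
have d0 : d = 0 by rewrite -[d]mulr1 -rate A1.
split; first by rewrite -At rate d0 mul0r.
by move=> z; apply/eqP; rewrite -subr_eq0 -/(A z) rate d0 mul0r.
Qed.

End RegularElliptic.

(** * Odd elliptic functions with simple poles *)

Section NoSimplePole.
Variable R : realType.
Local Notation C := (complex_complex__canonical__Num_NumField R).
Local Notation Im := (@complex.Im R).
Local Notation modulus := (@modulus R).
Variable tau : C.
Hypothesis tau0 : 0 < Im tau.
Local Notation wp := (wp tau).
Local Notation lattice := (lattice tau).
Variable f : C -> C.
Hypothesis fd : forall z, ~ lattice z -> derivable f z 1.
Hypothesis fp : forall p, holomorphic_at (fun z => f z - (z - wp p)^-1) (wp p).
Hypothesis f1 : forall z, f (z + 1) = f z.
Hypothesis ft : forall z, f (z + tau) = f z.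
Hypothesis fodd : forall z, f (- z) = - f z.

Lemma f_period p z : f (z + wp p) = f z.
Proof.
rewrite /wp addrA (int_period ft); have := int_period f1 p.1 z.
by rewrite mulr1.
Qed.

Lemma f_hol z : ~ lattice z -> holomorphic_at f z.
Proof. by move=> /(lattice_near tau0); apply: filterS => w; exact: fd. Qed.

(** The pole of either factor is compensated by a zero of the other one: at the
    lattice because f is odd, at a + lattice because f w - f a vanishes. *)
Lemma product_regular a z : ~ lattice a ->
  regular_at (fun w => (f w - f a) * (f (w - a) + f a)) z.
Proof.
move=> na.
case: (pselect (lattice z)) => [/latticeP[p zp]|nz]; last first.
  case: (pselect (lattice (z - a))) => [/latticeP[p zp]|nza]; last first.
    apply: holomorphic_regular; apply: holM.
      exact: (holB (f_hol nz) (@hol_cst R (f a) z)).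
    exact: (holD (hol_shift (f_hol nza)) (@hol_cst R (f a) z)).
  have zE : z = a + wp p by rewrite -zp addrC subrK.
  have hv : holomorphic_at (fun w => f w - f a) z.
    exact: (holB (f_hol nz) (@hol_cst R (f a) z)).
  have [g hg vg] := holomorphic_quotient hv.
  have hu := fp p; rewrite -zp in hu; have {}hu := hol_shift hu.
  exists (fun w => (f w - f a) * (f (w - a) - (w - a - (z - a))^-1 + f a) + g w).
    exact: (holD (holM hv (holD hu (@hol_cst R (f a) z))) hg).
  have := near_dnear vg; have := dnbhs_neq z; apply: filterS2 => w wz.
  have -> : f z - f a = 0 by rewrite zE f_period subrr.
  have -> : w - a - (z - a) = w - z by ring.
  rewrite add0r => e.
  have wz0 : w - z != 0 by rewrite subr_eq0.
  have -> : g w = (f w - f a) / (w - z) by rewrite e mulfK.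
  by ring.
have nza : ~ lattice (z - a).
  move=> h; apply: na; rewrite -[a](subKr z); apply: (latticeB _ h).
  by rewrite zp; exact: wp_lattice.
have hv : holomorphic_at (fun w => f (w - a) + f a) z.
  exact: (holD (hol_shift (f_hol nza)) (@hol_cst R (f a) z)).
have [g hg vg] := holomorphic_quotient hv.
have hu := fp p; rewrite -zp in hu.
exists (fun w => (f w - (w - z)^-1 - f a) * (f (w - a) + f a) + g w).
  exact: (holD (holM (holB hu (@hol_cst R (f a) z)) hv) hg).
have := near_dnear vg; have := dnbhs_neq z; apply: filterS2 => w wz.
have -> : f (z - a) + f a = 0 by rewrite zp [wp p - a]addrC f_period fodd addNr.
rewrite add0r => e.
have wz0 : w - z != 0 by rewrite subr_eq0.
have -> : g w = (f (w - a) + f a) / (w - z) by rewrite e mulfK.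
by ring.
Qed.

(** Substituting w = a + b, an addition theorem for f. *)
Lemma product_constant a : ~ lattice a -> exists k, forall b, ~ lattice b ->
  ~ lattice (a + b) -> (f (a + b) - f a) * (f b + f a) = k.
Proof.
move=> na.
have [z|z|k hk] := regular_elliptic_constant tau0 (fun z => product_regular z na).
- by apply: filterE => w; rewrite addrAC !f1.
- by apply: filterE => w; rewrite addrAC !ft.
exists k => b nb nab.
have ab : a + b - a = b by rewrite addrAC subrr add0r.
rewrite -{2}ab.
apply: (cont_near_eq (f := fun w => (f w - f a) * (f (w - a) + f a)) (g := fun=> k)).
- apply: derivable_cont; apply: drvM; first exact: (drvB (fd nab) (drv_cst _ _)).
  apply: drvD; last exact: drv_cst.
  by apply: derivable_shift; rewrite ab; exact: fd.
- by apply: derivable_cont; exact: drv_cst.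
- exact: hk.
Qed.

Let toC (x : R) : C := x%:C%C.

Lemma real_notin_lattice (x : R) : 0 < x < 1 -> ~ lattice (toC x).
Proof.
move=> hx; have := @notin_lattice _ _ tau0 x 0 (or_introl hx).
by rewrite mul0r addr0.
Qed.

Lemma self_opp0 (x : C) : x = - x -> x = 0.
Proof.
move=> e; have : x *+ 2 == 0 by rewrite mulr2n {1}e addNr.
by rewrite mulrn_eq0 => /eqP.
Qed.

Lemma toC_half_double : toC 2^-1 + toC 2^-1 = 1.
Proof. by rewrite /toC -rmorphD /= (_ : 2^-1 + 2^-1 = 1 :> R) //; lra. Qed.

Lemma f_half : f (toC 2^-1) = 0.
Proof.
have h : toC 2^-1 = - toC 2^-1 + 1 by rewrite -toC_half_double addKr.
by apply: self_opp0; rewrite {1}h f1 fodd.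
Qed.

Lemma f_tau2 : f (toC 2^-1 * tau) = 0.
Proof.
have h : toC 2^-1 * tau = - (toC 2^-1 * tau) + tau.
  by rewrite -{3}[tau]mul1r -toC_half_double mulrDl addKr.
by apply: self_opp0; rewrite {1}h ft fodd.
Qed.

(** The constant of the addition theorem for a = 1/2 vanishes, since f is zero
    at the toC-period tau/2. *)
Lemma f_half_product b : ~ lattice b -> ~ lattice (toC 2^-1 + b) ->
  f (toC 2^-1 + b) * f b = 0.
Proof.
have hh : ~ lattice (toC 2^-1) by apply: real_notin_lattice; lra.
have [k hk] := product_constant hh => nb nhb.
have := hk b nb nhb; rewrite f_half subr0 addr0 => ->.
pose b0 := toC (- 2^-1) + toC 2^-1 * tau.
have hab : toC 2^-1 + b0 = toC 2^-1 * tau.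
  by rewrite /b0 /toC rmorphN addrA addrN add0r.
rewrite -(hk b0).
- by rewrite hab f_tau2 f_half subr0 mul0r.
- by apply: (notin_lattice tau0); right; lra.
- by rewrite hab -[X in lattice X]add0r; apply: (notin_lattice (x := 0) tau0); right; lra.
Qed.

(** The addition theorem at b = 1/2 computes the constant as - f(x)^2; at b = x
    it then gives the value at 2x. *)
Lemma f_double (x : R) : 0 < x < 2^-1 -> f (toC x) != 0 -> f (toC (x + x)) = f (toC x) / 2.
Proof.
move=> /andP[x0 x1] fx.
have nx : ~ lattice (toC x) by apply: real_notin_lattice; lra.
have nxx : ~ lattice (toC x + toC x) by rewrite /toC -rmorphD; apply: real_notin_lattice; lra.
have nxh : ~ lattice (toC x + toC 2^-1) by rewrite /toC -rmorphD; apply: real_notin_lattice; lra.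
have nh : ~ lattice (toC 2^-1) by apply: real_notin_lattice; lra.
have [k hk] := product_constant nx.
have kE : k = - f (toC x) ^+ 2.
  rewrite -(hk (toC 2^-1) nh nxh) f_half add0r.
  have := @f_half_product (toC x) nx; rewrite addrC => /(_ nxh) h.
  by rewrite mulrBl h expr2 sub0r.
have := hk (toC x) nx nxx; rewrite kE => h.
have h2 : f (toC x + toC x) - f (toC x) = - f (toC x) / 2.
  apply: (mulIf (_ : f (toC x) + f (toC x) != 0)).
    by rewrite -mulr2n mulrn_eq0.
  by rewrite h; field.
have -> : toC (x + x) = toC x + toC x by rewrite /toC rmorphD.
by rewrite -[LHS](subrK (f (toC x))) h2; field.
Qed.

(** By the duplication formula f(x) <> 0 implies f(2x) <> 0 for small real x;
    starting near the pole at 0 and doubling up to 1/2 contradicts f(1/2) = 0. *)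
Lemma no_odd_elliptic_simple_pole : False.
Proof.
have /holomorphic_derivable/derivable_cont/(_ 1 ltr01)[r r0 hr] := fp 0.
rewrite wp0 in hr.
set M := modulus (f 0 - (0 - 0)^-1) + 1.
have M0 : 0 < M by rewrite ltr_wpDl ?modulus_ge0.
have s0 : 0 < Num.min r M^-1 by rewrite lt_min r0 invr_gt0.
have [n0 hn0] := halving_small 1 s0.
pose x m : R := 1 / 2 ^+ m.
have xp m : 0 < x m by rewrite /x divr_gt0 ?exprn_gt0.
have step m : x m.+1 + x m.+1 = x m.
  by rewrite /x exprS invfM; lra.
pose n := n0.+1.
have hn : x n < Num.min r M^-1.
  by apply: lt_trans hn0; rewrite -/(x n0) -(step n0) ltrDr.
have fn0 : f (toC (x n)) != 0.
  move: hn; rewrite lt_min => /andP[xr xM].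
  have mx : modulus (toC (x n)) = x n by rewrite modulusR gtr0_norm.
  have := hr (toC (x n)); rewrite !subr0 mx => /(_ xr) h.
  apply/eqP => f0; move: h; rewrite f0 sub0r => h.
  have : modulus (toC (x n))^-1 <= M.
    rewrite -modulusN -[X in modulus X](subrK (f 0 - 0^-1)).
    apply: le_trans (modulusD _ _) _; rewrite /M subr0 addrC; apply: lerD => //.
  rewrite modulusV mx leNgt => /negP; apply.
  by rewrite -[M]invrK ltf_pV2 ?posrE ?invr_gt0.
have up m : f (toC (x m.+2)) != 0 -> f (toC (x m.+1)) != 0.
  move=> h; rewrite -(step m.+1) f_double //.
    by rewrite mulf_neq0 // invr_eq0 pnatr_eq0.
  rewrite xp /=; have : x m.+2 + x m.+2 + (x m.+2 + x m.+2) = x m by rewrite !step.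
  have : x m <= 1 by rewrite /x ler_pdivrMr ?exprn_gt0 // mul1r exprn_ege1 // ler1n.
  by have := xp m; lra.
have down m : f (toC (x m.+1)) != 0 -> False.
  elim: m => [|m IH]; last by move=> /up.
  by rewrite /x expr1 div1r f_half eqxx.
exact: down fn0.
Qed.

End NoSimplePole.

(** * Difference operators *)

(** Difference operators T - id, for an endomorphism T of a commutative ring:
    the invariants of T act as scalars, and an element Z with T Z = Z + k behaves
    like k times an integer variable. *)
Section DifferenceOperator.
Variables (A : comNzRingType) (T : {rmorphism A -> A}).
Implicit Types (F G k : A) (n m : nat).

Definition dif F := T F - F.

Lemma difD F G : dif (F + G) = dif F + dif G.
Proof. by rewrite /dif rmorphD opprD addrACA. Qed.

Lemma dif_invariant_mul F G : T F = F -> dif (F * G) = F * dif G.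
Proof. by move=> h; rewrite /dif rmorphM h mulrBr. Qed.

Lemma iter_dif_invariant_mul n F G : T F = F ->
  iter n dif (F * G) = F * iter n dif G.
Proof. by move=> h; elim: n => // n IH; rewrite !iterS IH dif_invariant_mul. Qed.

Variables (Z k : A).
Hypotheses (TZ : T Z = Z + k) (Tk : T k = k).

Lemma TkX n m : T (k ^+ n *+ m) = k ^+ n *+ m.
Proof. by rewrite rmorphMn rmorphXn /= Tk. Qed.

Lemma dif_Zmul m G : dif ((Z + k *+ m) * G) = (Z + k *+ m.+1) * dif G + k * G.
Proof.
by rewrite /dif rmorphM rmorphD rmorphMn /= TZ Tk [k *+ m.+1]mulrS; ring.
Qed.

(** Leibniz rule: Z is of degree one for the difference operator. *)
Lemma iter_dif_Zmul n F : iter n.+1 dif (Z * F) =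
  (Z + k *+ n.+1) * iter n.+1 dif F + k *+ n.+1 * iter n dif F.
Proof.
elim: n => [|n IH]; first by rewrite /= -[Z in LHS]addr0 -(mulr0n k) dif_Zmul.
rewrite iterS IH difD dif_Zmul dif_invariant_mul; last by have := TkX 1 n.+1; rewrite expr1.
by rewrite -!iterS [k *+ n.+2 in RHS]mulrS; rewrite [k *+ n.+2]mulrS; ring.
Qed.

Lemma iter_dif_Zpow n : iter n dif (Z ^+ n) = k ^+ n *+ n`! /\
  iter n.+1 dif (Z ^+ n) = 0.
Proof.
have D0 m N : dif (k ^+ m *+ N) = 0 by rewrite /dif TkX subrr.
elim: n => [|n [IH1 IH2]].
  by rewrite expr0 /= /dif rmorph1 subrr.
have h : iter n.+1 dif (Z ^+ n.+1) = k ^+ n.+1 *+ n.+1`!.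
  rewrite exprS iter_dif_Zmul IH2 mulr0 add0r IH1.
  by rewrite mulrnAl mulrnAr -mulrnA -exprS factS mulnC.
by split=> //; rewrite iterS h D0.
Qed.

(** One difference less leaves an affine function of Z. *)
Lemma iter_dif_Zpow_succ n : exists q, iter n dif (Z ^+ n.+1) =
  (k ^+ n *+ n.+1`!) * Z + k ^+ n.+1 *+ q.
Proof.
elim: n => [|n [q IH]].
  by exists 0%N; rewrite expr1 addr0 expr0 mulr1n mul1r.
exists (n.+1 * n.+1`! + n.+1 * q)%N.
rewrite exprS iter_dif_Zmul (iter_dif_Zpow n.+1).1 IH [n.+2`!]factS mulSn.
move: (n.+1`!) => N; rewrite [k ^+ n.+2]exprS [k ^+ n.+1]exprS.
move: (k ^+ n) (n.+1) => kn m; by ring.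
Qed.

End DifferenceOperator.

Section DifferenceAlgebra.
Variables (C : numFieldType) (tau : C).
Implicit Types (F G : pfun C) (k n : nat) (a b c : C).
Local Notation Delta := (Delta tau).

Definition cstp c : pfun C := pfun_class (cst c).

Lemma scale_cstp c F : c *: F = cstp c * F. Proof. by []. Qed.

Lemma cstpD a b : cstp (a + b) = cstp a + cstp b.
Proof. exact: pfun_classD. Qed.

Lemma cstpM a b : cstp (a * b) = cstp a * cstp b.
Proof. exact: pfun_classM. Qed.

Lemma cstp0 : cstp 0 = 0.
Proof. by apply: (addrI (cstp 0)); rewrite -cstpD !addr0. Qed.

Lemma cstp1 : cstp 1 = 1.
Proof. exact: pfun_class1. Qed.

Lemma cstpMn a n : cstp (a *+ n) = cstp a *+ n.
Proof. by elim: n => [|n IH]; [exact: cstp0|rewrite !mulrS cstpD IH]. Qed.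

Lemma cstpX a n : cstp (a ^+ n) = cstp a ^+ n.
Proof. by elim: n => [|n IH]; [exact: cstp1|rewrite !exprS cstpM IH]. Qed.

Lemma Delta_cst c : Delta (cstp c) = 0.
Proof. by rewrite /Defs.Delta translate_cst subrr. Qed.

Lemma regular_at_shift (g : C -> C) w b : regular_at g (w + b) ->
  regular_at (fun v => g (v + b)) w.
Proof.
have nsh (P : C -> Prop) : (\forall v \near (w + b), P v) -> \forall v \near w, P (v + b).
  move=> /nbhs_ballP[e /= e0 he]; apply/nbhs_ballP; exists e => //= v vw; apply: he.
  by move: vw; rewrite -!ball_normE /= opprD addrACA subrr addr0.
have dsh (h : C -> C) v : derivable h (v + b) 1 -> derivable (fun u => h (u + b)) v 1.
  rewrite /derivable; set k1 := (fun _ => _); set k2 := (fun _ => _).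
  suff -> : k2 = k1 by [].
  by apply/funext => t; rewrite /k1 /k2 /= addrA.
move=> [h hh hg]; exists (fun v => h (v + b)).
  by apply: filterS (nsh _ hh) => v; exact: dsh.
by apply: filterS (nsh _ hg) => v hv vw; apply: hv; rewrite (inj_eq (addIr b)).
Qed.

Lemma regular_translate a F z : regular (translate a F) z <-> regular F (z + a).
Proof.
rewrite regular_pfun_class; split; last exact: regular_at_shift.
move=> h; have := @regular_at_shift _ (z + a) (- a); rewrite addrK => /(_ _ h).
by rewrite (_ : (fun v => _) = repr F) //; apply/funext => v; rewrite subrK.
Qed.

Lemma meromorphic_translate a F : meromorphic F -> meromorphic (translate a F).
Proof.
move=> mF; apply/meromorphic_class => z; have [n hn] := mF (z + a); exists n.
apply: regular_ext (regular_at_shift hn); apply: filterE => w.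
by rewrite opprD addrACA subrr addr0.
Qed.

Lemma meromorphic_sub F G : meromorphic F -> meromorphic G -> meromorphic (F - G).
Proof.
have [f ->] := pfunP F; have [g ->] := pfunP G.
rewrite -pfun_classB !meromorphic_class => mf mg z.
rewrite -(mulN1r g); apply: meromorphicD; first exact: mf.
by apply: meromorphicM (mg z); apply: regular_meromorphic; exact: (regular_cst (-1)).
Qed.

Lemma translateC a b F : translate a (translate b F) = translate b (translate a F).
Proof.
have [f ->] := pfunP F; rewrite !translate_class; congr pfun_class.
by apply/funext => w; rewrite addrAC.
Qed.

Lemma Kn_Delta k F : Kn tau k.+1 F -> Kn tau k (Delta F).
Proof.
move=> [mF pF kF]; split.
- by apply: meromorphic_sub => //; exact: meromorphic_translate.
- by rewrite /Defs.Delta rmorphB /= translateC pF.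
- by rewrite -iterSr.
Qed.

Lemma special_Delta F : special tau F -> special tau (Delta F).
Proof.
move=> sF; apply: specialB => // z hz; apply: contrapT => nz; apply: hz.
apply/regular_translate/(special_regular sF) => -[m [n e]]; apply: nz.
by exists m, (n - 1); rewrite rmorphB /= mulrBl mul1r addrA -e addrK.
Qed.

Lemma SKnP n F : reflect (F \in SK tau /\ iter n Delta F = 0) (F \in SKn tau n).
Proof.
apply: (iffP idP) => [h|[/asboolP[[k [mF pF _]] sF] nF]].
  by split; [exact: SKnSK h|case/asboolP: h => -[]].
by apply/asboolP.
Qed.

Lemma SK_Delta F : F \in SK tau -> Delta F \in SK tau.
Proof.
move=> /asboolP[[k hk] sF]; apply/asboolP; split; last exact: special_Delta.
exists k; apply: Kn_Delta; case: hk => mF pF kF; split=> //.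
exact: iterDelta_leq kF.
Qed.

Lemma SK_iterDelta n F : F \in SK tau -> iter n Delta F \in SK tau.
Proof. by move=> hF; elim: n => // n IH; exact: SK_Delta. Qed.

Lemma SK_cstp c : cstp c \in SK tau.
Proof. by apply: (@SKnSK _ _ 1); exact: class_cst_SKn. Qed.

Lemma iterDelta_invariant_mul n F G : translate tau F = F ->
  iter n Delta (F * G) = F * iter n Delta G.
Proof. exact: (@iter_dif_invariant_mul (pfun C) (translate tau)). Qed.

Lemma iterDelta_pow (Z : pfun C) c n : translate tau Z = Z + cstp c ->
  iter n Delta (Z ^+ n) = cstp c ^+ n *+ n`! /\ iter n.+1 Delta (Z ^+ n) = 0.
Proof.
move=> hZ.
exact: (@iter_dif_Zpow (pfun C) (translate tau) Z (cstp c) hZ (translate_cst tau c)).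
Qed.

Lemma iterDelta_pow_succ (Z : pfun C) c n : translate tau Z = Z + cstp c ->
  exists q, iter n Delta (Z ^+ n.+1) =
    (cstp c ^+ n *+ n.+1`!) * Z + cstp c ^+ n.+1 *+ q.
Proof.
move=> hZ.
exact: (@iter_dif_Zpow_succ (pfun C) (translate tau) Z (cstp c) hZ (translate_cst tau c)).
Qed.

Implicit Types (x y : SK_type tau).

Lemma SKvalD x y : SKval (x + y) = SKval x + SKval y.
Proof. exact: (raddfD (val : SK_type tau -> pfun C)). Qed.

Lemma SKvalM x y : SKval (x * y) = SKval x * SKval y.
Proof. by []. Qed.

Lemma SKval1 : SKval (1 : SK_type tau) = 1.
Proof. exact: (rmorph1 (val : SK_type tau -> pfun C)). Qed.

Lemma SKval0 : SKval (0 : SK_type tau) = 0.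
Proof. exact: (raddf0 (val : SK_type tau -> pfun C)). Qed.

Lemma SKvalX x n : SKval (x ^+ n) = SKval x ^+ n.
Proof. by elim: n => [|n IH]; [exact: SKval1|rewrite !exprS SKvalM IH]. Qed.

Lemma SKval_sum (I : Type) (r : seq I) (P : pred I) (E : I -> SK_type tau) :
  SKval (\sum_(i <- r | P i) E i) = \sum_(i <- r | P i) SKval (E i).
Proof. exact: (big_morph _ SKvalD SKval0). Qed.

Lemma SKvalZ c x : SKval (c *: x) = c *: SKval x.
Proof. by []. Qed.

End DifferenceAlgebra.

(** * The ring of special quasi-elliptic functions *)

Section PolynomialRing.
Variable R : realType.
Local Notation C := (complex_complex__canonical__Num_NumField R).
Local Notation Im := (@complex.Im R).
Variable tau : C.
Hypothesis tau0 : 0 < Im tau.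
Local Notation c0 := (zstep tau).
Local Notation Delta := (Delta tau).
Local Notation Z := (scrZ tau).
Implicit Types (F G : pfun C) (n : nat).

(** If the step were zero, zfun would be an odd elliptic function with simple
    poles. *)
Lemma zstep_neq0 : c0 != 0.
Proof.
apply/eqP => e; apply: (@no_odd_elliptic_simple_pole R tau tau0 (zfun tau)).
- by move=> z; exact: zfun_derivable.
- by move=> p; exact: zfun_pole.
- by move=> z; exact: zfun1.
- by move=> z; rewrite zfun_tau // e addr0.
- by move=> z; exact: zfun_odd.
Qed.

Lemma scrZE : Z = pfun_class (zfun tau). Proof. by []. Qed.

Lemma translate1_scrZ : translate 1 Z = Z.
Proof. by rewrite scrZE translate_class; congr pfun_class; apply/funext => z; exact: zfun1. Qed.

Lemma translate_scrZ : translate tau Z = Z + cstp c0.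
Proof.
rewrite scrZE translate_class /cstp -pfun_classD; congr pfun_class.
by apply/funext => z; exact: zfun_tau.
Qed.

Lemma Delta_scrZ : Delta Z = cstp c0.
Proof. by rewrite /Defs.Delta translate_scrZ addrAC subrr add0r. Qed.

Lemma zfun_meromorphic z : meromorphic_at (zfun tau) z.
Proof.
case: (pselect (lattice tau z)) => [/latticeP[p ->]|nz]; last first.
  by apply: regular_meromorphic; apply: holomorphic_regular; exact: zfun_holomorphic.
have h := zfun_pole tau0 p; exists 1%N.
exists (fun w => (w - wp tau p) * (zfun tau w - (w - wp tau p)^-1) + 1).
  apply: holD; last exact: hol_cst.
  apply: holM h; apply: filterE => w.
  exact: (drvB (drv_id w) (drv_cst (wp tau p) w)).
apply: filterS (dnbhs_neq (wp tau p)) => w wz.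
have wz0 : w - wp tau p != 0 by rewrite subr_eq0.
by rewrite expr1 [in RHS]mulrBr (mulfV wz0) subrK.
Qed.

Lemma scrZ_SK : Z \in SK tau.
Proof.
apply/asboolP; split.
  exists 2; split.
  - by rewrite scrZE; apply/meromorphic_class; exact: zfun_meromorphic.
  - exact: translate1_scrZ.
  - by rewrite /= Delta_scrZ Delta_cst.
move=> z hz; apply: contrapT => nz; apply: hz.
by rewrite scrZE; apply/regular_pfun_class/holomorphic_regular; exact: zfun_holomorphic.
Qed.

Lemma invariant_SK1 (a : SK1_type tau) : translate tau (SK1val a) = SK1val a.
Proof.
have /SKnP[_ /= h] := SK1valP a.
by move/eqP: h; rewrite /Defs.Delta subr_eq0 => /eqP.
Qed.

Lemma iterDelta_SK1_mul n (a : SK1_type tau) F :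
  iter n Delta (SK1val a * F) = SK1val a * iter n Delta F.
Proof. exact: iterDelta_invariant_mul (invariant_SK1 a). Qed.

(** The constant value of the n-th difference of Z^n. *)
Definition zfact n : C := c0 ^+ n *+ n`!.

Lemma zfact_neq0 n : zfact n != 0.
Proof.
by rewrite /zfact -mulr_natr mulf_neq0 ?expf_neq0 ?zstep_neq0 // pnatr_eq0 -lt0n fact_gt0.
Qed.

Lemma cstp_zfact n : cstp (zfact n) = cstp c0 ^+ n *+ n`!.
Proof. by rewrite /zfact cstpMn cstpX. Qed.

Lemma cstpV c : c != 0 -> cstp c^-1 * cstp c = 1 :> pfun C.
Proof. by move=> h; rewrite -cstpM mulVf // cstp1. Qed.

Definition ZSK : SK_type tau := SKType scrZ_SK.

Definition evalZ (p : {poly SK1_type tau}) : SK_type tau :=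
  (map_poly (@SK1_SK C tau) p).[ZSK].

Lemma evalZE p : evalZ p = \sum_(i < size p) SK1_SK p`_i * ZSK ^+ i.
Proof. by rewrite /evalZ /map_poly horner_poly. Qed.

Lemma evalZD p q : evalZ (p + q) = evalZ p + evalZ q.
Proof. by rewrite /evalZ rmorphD hornerD. Qed.

Lemma evalZB p q : evalZ (p - q) = evalZ p - evalZ q.
Proof. by rewrite /evalZ rmorphB hornerD hornerN. Qed.

Lemma evalZ_monomial a n : evalZ (a%:P * 'X^n) = SK1_SK a * ZSK ^+ n.
Proof. by rewrite /evalZ rmorphM /= map_polyC map_polyXn hornerM hornerC hornerXn. Qed.

Lemma SKval_monomial (a : SK1_type tau) n :
  SKval (SK1_SK a * ZSK ^+ n) = SK1val a * Z ^+ n.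
Proof.
by rewrite SKvalM SKvalX.
Qed.

(** Subtracting from F the term (Delta^n F / zfact n) Z^n, whose coefficient is
    elliptic, lowers the order of F. *)
Lemma evalZ_onto n F : F \in SKn tau n -> exists p, SKval (evalZ p) = F.
Proof.
elim: n F => [|n IH] F /SKnP[sF nF].
  exists 0; rewrite evalZE size_poly0 big_ord0 /=.
  by rewrite (nF : F = 0).
have sa : cstp (zfact n)^-1 * iter n Delta F \in SKn tau 1.
  apply: rpredM; first exact: class_cst_SKn.
  by apply/SKnP; split; [exact: SK_iterDelta|rewrite /= -iterS].
pose a : SK1_type tau := SK1Type sa.
have aZ : SK1val a * Z ^+ n \in SK tau.
  apply: rpredM; first exact: SKnSK (SK1valP a).
  by apply: rpredX; exact: scrZ_SK.
have [|p hp] := IH (F - SK1val a * Z ^+ n).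
  apply/SKnP; split; first exact: rpredB.
  rewrite (raddfB (iter n Delta)) /= (iterDelta_SK1_mul n a) (iterDelta_pow n translate_scrZ).1 -cstp_zfact /=.
  by rewrite mulrAC cstpV ?zfact_neq0 // mul1r subrr.
exists (p + a%:P * 'X^n); rewrite evalZD evalZ_monomial SKvalD.
by rewrite hp SKval_monomial subrK.
Qed.

(** The n-th difference of a polynomial of degree n in Z is a nonzero multiple of
    its leading coefficient. *)
Lemma evalZ_eq0 p : evalZ p = 0 -> p = 0.
Proof.
move=> h; apply/eqP; apply: contrapT => /negP p0.
have [n sp] : exists n, size p = n.+1.
  by exists (size p).-1; rewrite prednK // lt0n size_poly_eq0.
have : iter n Delta (SKval (evalZ p)) = 0.
  by rewrite h SKval0 raddf0.
have -> : SKval (evalZ p) = \sum_(i < n.+1) SK1val p`_i * Z ^+ i.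
  by rewrite evalZE SKval_sum sp; apply: eq_bigr => i _; exact: SKval_monomial.
rewrite (raddf_sum (iter n Delta)) /= big_ord_recr /= big1 => [|i _]; last first.
  rewrite iterDelta_SK1_mul.
  by rewrite (iterDelta_leq (ltn_ord i) (iterDelta_pow i translate_scrZ).2) mulr0.
rewrite add0r iterDelta_SK1_mul (iterDelta_pow n translate_scrZ).1 -cstp_zfact => e.
have : SK1val p`_n = 0.
  rewrite -[LHS]mulr1 -(cstpV (zfact_neq0 n)) mulrCA e.
  exact: mulr0.
move=> pn; move: p0; rewrite -lead_coef_eq0 lead_coefE sp /=.
by move=> /eqP; apply; exact: val_inj.
Qed.

Lemma evalZ_bij : bijective evalZ.
Proof.
have ex (F : SK_type tau) : exists p, evalZ p = F.
  have /asboolP[[k kF] sF] := SKvalP F.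
  have [p hp] := evalZ_onto (n := k) (F := SKval F) (introT (asboolP _) (conj kF sF)).
  by exists p; exact: val_inj.
have [g hg] := choice ex; exists g => // p; apply/eqP; rewrite -subr_eq0.
by apply/eqP/evalZ_eq0; rewrite evalZB hg subrr.
Qed.

Lemma ZSK_basis : @is_basis (SK1_type tau) (SK_module tau) (fun k => ZSK ^+ k).
Proof.
have [g _ hg] := evalZ_bij; split=> [v|n a].
  exists (size (g v)), (fun i : 'I_(size (g v)) => (g v)`_i).
  by rewrite -[LHS]hg evalZE.
move=> h i; pose p := \poly_(j < n) (if insub j is Some k then a k else 0).
have pj (j : 'I_n) : p`_j = a j by rewrite coef_poly ltn_ord valK.
have : evalZ p = 0.
  rewrite -[RHS]h /evalZ.
  rewrite (horner_coef_wide _ (n := n)); last first.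
    by apply: leq_trans (size_poly _ _) _; exact: size_poly.
  apply: eq_bigr => j _; rewrite -pj.
  by rewrite coef_map.
by move=> /evalZ_eq0 p0; rewrite -pj p0 coef0.
Qed.

End PolynomialRing.

(** * Polynomial sequences *)

Section PolynomialSequences.
Variable C : numFieldType.
Implicit Types (s t : int -> C) (p : {poly C}) (m : int) (n k : nat).

Definition dz s : int -> C := fun m => s (m + 1) - s m.

Lemma iter_dz0 n : iter n dz (fun=> 0) = fun=> 0.
Proof.
by elim: n => // n IH; rewrite iterS IH; apply/funext => m; rewrite /dz subrr.
Qed.

Lemma iter_dzD n s t : iter n dz (fun m => s m + t m) =
  fun m => iter n dz s m + iter n dz t m.
Proof.
elim: n => // n IH; rewrite !iterS IH; apply/funext => m.
by rewrite /dz opprD addrACA.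
Qed.

Lemma iter_dzB n s t : iter n dz (fun m => s m - t m) =
  fun m => iter n dz s m - iter n dz t m.
Proof.
elim: n => // n IH; rewrite !iterS IH; apply/funext => m.
by rewrite /dz; ring.
Qed.

Lemma iter_dzZ n (c : C) s : iter n dz (fun m => c * s m) =
  fun m => c * iter n dz s m.
Proof.
elim: n => // n IH; rewrite !iterS IH; apply/funext => m.
by rewrite /dz mulrBr.
Qed.

Lemma dz_eq0_cst s : dz s = (fun=> 0) -> forall m, s m = s 0.
Proof.
move=> h; have h1 m : s (m + 1) = s m.
  by apply/eqP; rewrite -subr_eq0 -/(dz s m) h.
have hn (n : nat) m : s (m + n%:Z) = s m.
  elim: n m => [|n IH] m; first by rewrite addr0.
  by rewrite -addn1 PoszD addrA h1.
case=> n; first by rewrite -[in LHS](add0r (Posz n)) hn.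
by rewrite -(hn n.+1) NegzE addNr.
Qed.

Lemma iter_dz_leq k n s : (k <= n)%N -> iter k dz s = (fun=> 0) ->
  iter n dz s = (fun=> 0).
Proof. by move=> /subnK <- h; rewrite iterD h iter_dz0. Qed.

Lemma iter_dz_mul n s : iter n.+1 dz (fun m => s m * m%:~R) =
  fun m => iter n.+1 dz s m * (m%:~R + n.+1%:R) + n.+1%:R * iter n dz s m.
Proof.
elim: n => [|n IH]; first by apply/funext => m; rewrite /= /dz intrD; ring.
rewrite iterS IH; apply/funext => m; rewrite [in LHS]/dz.
rewrite -[iter n.+2 dz s m]/(iter n.+1 dz s (m + 1) - iter n.+1 dz s m).
have -> : iter n.+1 dz s m = iter n dz s (m + 1) - iter n dz s m by [].
by rewrite intrD -[n.+2%:R]natr1; ring.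
Qed.

Lemma polynomial_killed p : exists k, iter k dz (fun m => p.[m%:~R]) = fun=> 0.
Proof.
elim/poly_ind: p => [|p c [k IH]].
  by exists 0%N; apply/funext => m; rewrite /= horner0.
exists k.+1.
rewrite (_ : (fun m => _) = fun m => p.[m%:~R] * m%:~R + c); last first.
  by apply/funext => m; rewrite hornerMXaddC.
rewrite iter_dzD iter_dz_mul iterS IH; apply/funext => m.
rewrite iterSr (_ : dz (fun=> c) = fun=> 0) ?iter_dz0.
  by rewrite /dz subrr mul0r mulr0 !addr0.
by apply/funext => i; rewrite /dz subrr.
Qed.

(** The binomial polynomials X (X - 1) ... (X - n + 1) / n!, on which differences
    act by lowering the index. *)
Fixpoint binp n : {poly C} :=
  if n is n'.+1 then n%:R^-1 *: (binp n' * ('X - n'%:R%:P)) else 1.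

Lemma hornerBinpS n (x : C) : (binp n.+1).[x] = n.+1%:R^-1 * ((binp n).[x] * (x - n%:R)).
Proof. by rewrite /= hornerZ hornerM hornerXsubC. Qed.

Lemma binp_shift n (x : C) : (binp n).[x + 1] * (x + 1 - n%:R) = (x + 1) * (binp n).[x].
Proof.
elim: n => [|n IH]; first by rewrite !hornerC subr0 mulrC.
rewrite !hornerBinpS IH -natr1; ring.
Qed.

Lemma binp_diff n (x : C) : (binp n.+1).[x + 1] - (binp n.+1).[x] = (binp n).[x].
Proof.
rewrite !hornerBinpS binp_shift -mulrBr.
have n0 : (n.+1%:R : C) != 0 by rewrite pnatr_eq0.
apply: (mulfI n0); rewrite mulrA mulfV // mul1r -natr1; ring.
Qed.

(** Summing the expansion of the difference of s recovers s up to a constant. *)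
Lemma newton_series n s : iter n dz s = (fun=> 0) ->
  exists a : nat -> C, forall m, s m = \sum_(j < n) a j * (binp j).[m%:~R].
Proof.
elim: n s => [|n IH] s h.
  by exists (fun=> 0) => m; rewrite big_ord0 -[s]/(iter 0 dz s) h.
have [a ha] := IH (dz s) (etrans (esym (iterSr n dz s)) h).
pose t m := s m - \sum_(j < n) a j * (binp j.+1).[m%:~R].
have ht : dz t = fun=> 0.
  apply/funext => m; rewrite /dz /t opprB addrACA -opprB addrC.
  rewrite [_ + _](_ : _ = dz s m - (\sum_(j < n) a j * (binp j.+1).[(m + 1)%:~R] -
      \sum_(j < n) a j * (binp j.+1).[m%:~R])); last by rewrite /dz; ring.
  rewrite ha -sumrB -sumrB big1 // => j _.
  by rewrite -mulrBr intrD binp_diff subrr.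
exists (fun j => if j is j'.+1 then a j' else t 0) => m.
rewrite big_ord_recl /= hornerC mulr1 -(dz_eq0_cst ht m) /t.
by rewrite -addrA addNr addr0.
Qed.

Lemma killed_polynomial n s : iter n dz s = (fun=> 0) -> polynomial_map s.
Proof.
move=> /newton_series[a ha]; exists (\sum_(j < n) a j *: binp j) => m.
by rewrite ha horner_sum; apply: eq_bigr => j _; rewrite hornerZ.
Qed.

Lemma killed_vanish n s : iter n dz s = (fun=> 0) ->
  (forall i, (i < n)%N -> s i%:Z = 0) -> s = fun=> 0.
Proof.
elim: n s => [|n IH] s h h0; first exact: h.
have hd : dz s = fun=> 0.
  apply: IH; first by rewrite -iterSr.
  move=> i hi; rewrite /dz -[i%:Z + 1]/((i + 1)%N%:Z) !h0 ?subr0 //; lia.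
by apply/funext => m; rewrite (dz_eq0_cst hd) h0.
Qed.

End PolynomialSequences.

(** * Singular parts *)

Section SingularParts.
Variable R : realType.
Local Notation C := (complex_complex__canonical__Num_NumField R).
Implicit Types (f g h : C -> C) (z w a c : C) (p q : {poly C}) (F G : pfun C).

(** The polar part with coefficients p, in which the coefficient of degree l
    belongs to (w - z)^-(l + 1). *)
Definition polar p z w : C := (w - z)^-1 * p.[(w - z)^-1].

Definition sing f z p := regular_at (fun w => f w - polar p z w) z.

Lemma polarD p q z w : polar (p + q) z w = polar p z w + polar q z w.
Proof. by rewrite /polar hornerD mulrDr. Qed.

Lemma polarN p z w : polar (- p) z w = - polar p z w.
Proof. by rewrite /polar hornerN mulrN. Qed.

Lemma polarZ c p z w : polar (c *: p) z w = c * polar p z w.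
Proof. by rewrite /polar hornerZ mulrCA. Qed.

Lemma polar_coef p z w :
  \sum_(l < size p) p`_l / (w - z) ^+ l.+1 = polar p z w.
Proof.
rewrite /polar horner_coef mulr_sumr; apply: eq_bigr => l _.
by rewrite exprVn exprS invfM mulrCA.
Qed.

Lemma is_singular_partE F z p : is_singular_part F z p <-> sing (repr F) z p.
Proof.
rewrite /is_singular_part /sing.
by under [X in regular_at X _ <-> _]funext do rewrite polar_coef.
Qed.

Lemma regD f g z : regular_at f z -> regular_at g z -> regular_at (fun w => f w + g w) z.
Proof. exact: regularD. Qed.

Lemma regM f g z : regular_at f z -> regular_at g z -> regular_at (fun w => f w * g w) z.
Proof. exact: regularM. Qed.

Lemma regZ c f z : regular_at f z -> regular_at (fun w => c * f w) z.
Proof. by move=> hf; exact: (regM (regular_cst c z) hf). Qed.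

Lemma regN f z : regular_at f z -> regular_at (fun w => - f w) z.
Proof.
move=> /(regZ (-1)); apply: regular_ext; apply: filterE => w; exact: mulN1r.
Qed.

Lemma sing_ext f g z p : (\forall w \near z^', f w = g w) -> sing f z p -> sing g z p.
Proof. by move=> fg; apply: regular_ext; apply: filterS fg => w ->. Qed.

Lemma singD f g z p q : sing f z p -> sing g z q -> sing (fun w => f w + g w) z (p + q).
Proof.
move=> hf hg; apply: regular_ext (regD hf hg); apply: filterE => w.
by rewrite polarD opprD addrACA.
Qed.

Lemma singZ c f z p : sing f z p -> sing (fun w => c * f w) z (c *: p).
Proof.
move=> /(regZ c); apply: regular_ext; apply: filterE => w.
by rewrite polarZ mulrBr.
Qed.

Lemma singN f z p : sing f z p -> sing (fun w => - f w) z (- p).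
Proof.
move=> /regN; apply: regular_ext; apply: filterE => w.
by rewrite polarN opprB opprK addrC.
Qed.

Lemma sing_shift f z a p : sing f (z + a) p -> sing (fun w => f (w + a)) z p.
Proof.
move=> /regular_at_shift; apply: regular_ext; apply: filterE => w.
by rewrite /polar opprD addrACA subrr addr0.
Qed.

Lemma polar0 z w : polar 0 z w = 0.
Proof. by rewrite /polar horner0 mulr0. Qed.

Lemma sing0 f z : sing f z 0 <-> regular_at f z.
Proof.
by split; apply: regular_ext; apply: filterE => w; rewrite polar0 subr0.
Qed.

(** Induction on the order of the pole: the value at z of (w - z)^n f is the
    leading coefficient of the polar part. *)
Lemma sing_exists f z : meromorphic_at f z -> exists p, sing f z p.
Proof.
move=> [n]; elim: n f => [|n IH] f hf.
  exists 0; apply/sing0; apply: regular_ext hf.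
  by apply: filterE => w; rewrite expr0 mul1r.
have [h hh hfh] := hf; have [g hg hgE] := holomorphic_quotient hh.
have [|p hp] := IH (fun w => f w - polar (h z *: 'X^n) z w).
  exists g => //.
  have := near_dnear hgE; have := dnbhs_neq z; move: hfh; apply: filterS3 => w e1 wz e2.
  have wz0 : w - z != 0 by rewrite subr_eq0.
  have -> : g w = (h w - h z) / (w - z) by rewrite e2 addrAC subrr add0r mulfK.
  rewrite -e1 /polar hornerZ hornerXn exprVn mulrBr.
  by rewrite exprS; move: (w - z) wz0 => u u0; field; rewrite u0 expf_neq0.
exists (p + h z *: 'X^n).
move: hp; apply: regular_ext; apply: filterE => w.
by rewrite polarD opprD addrA addrAC.
Qed.

(** Multiplying a regular polar part by the right power of w - z isolates its
    leading coefficient. *)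
Lemma regular_polar_eq0 z p : regular_at (polar p z) z -> p = 0.
Proof.
move=> [g hg hE]; apply/eqP; apply: contrapT => /negP p0.
have [n sp] : exists n, size p = n.+1.
  by exists (size p).-1; rewrite prednK // lt0n size_poly_eq0.
pose q w := \sum_(l < n.+1) p`_l * (w - z) ^+ (n - l).
have qd w : derivable q w 1.
  apply: drv_sum => l _; apply: drvM; first exact: drv_cst.
  by apply: drvX; exact: (drvB (drv_id w) (drv_cst z w)).
have gd := holomorphic_derivable hg.
pose r w := (w - z) ^+ n.+1 * g w.
have rd : derivable r z 1.
  exact: (drvM (drvX n.+1 (drvB (drv_id z) (drv_cst z z))) gd).
have : q z = r z.
  apply: (cont_near_eq (derivable_cont (qd z)) (derivable_cont rd)).
  have := dnbhs_neq z; move: hE; apply: filterS2 => w e wz.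
  have wz0 : w - z != 0 by rewrite subr_eq0.
  rewrite /r -e -polar_coef sp mulr_sumr; apply: eq_bigr => l _.
  rewrite mulrCA; congr (_ * _).
  have ln : (l <= n)%N by rewrite -ltnS.
  rewrite [X in X / _](_ : _ = (w - z) ^+ (n - l) * (w - z) ^+ l.+1).
    by rewrite mulfK // expf_neq0.
  by rewrite -exprD addnS subnK.
rewrite /r /q subrr expr0n /= mul0r big_ord_recr /= subnn expr0 mulr1 big1.
  by rewrite add0r => pn; move: p0; rewrite -lead_coef_eq0 lead_coefE sp /= pn eqxx.
by move=> l _; rewrite expr0n subn_eq0 leqNgt ltn_ord mulr0.
Qed.

Lemma sing_unique f z p q : sing f z p -> sing f z q -> p = q.
Proof.
move=> hp hq; apply/eqP; rewrite -subr_eq0; apply/eqP/(@regular_polar_eq0 z).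
apply: regular_ext (regD hq (regN hp)); apply: filterE => w.
by rewrite polarD polarN; ring.
Qed.

Lemma singular_partP F z : meromorphic F -> sing (repr F) z (singular_part F z).
Proof.
move=> mF; apply/is_singular_partE; have [p hp] := sing_exists (mF z).
by apply: (@xgetPex _ 0 [set p | is_singular_part F z p]); exists p; apply/is_singular_partE.
Qed.

Lemma singular_part_eq F z p : sing (repr F) z p -> singular_part F z = p.
Proof.
move=> hp; have h : is_singular_part F z (singular_part F z).
  by apply: (@xgetPex _ 0 [set p | is_singular_part F z p]); exists p; apply/is_singular_partE.
by apply: sing_unique hp; apply/is_singular_partE.
Qed.

Lemma sing_class f z p : sing (repr (pfun_class f)) z p <-> sing f z p.
Proof.
split; apply: sing_ext; first exact: repr_class.
by apply: filterS (repr_class f z) => w ->.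
Qed.

Lemma singular_partD F G z : meromorphic F -> meromorphic G ->
  singular_part (F + G) z = singular_part F z + singular_part G z.
Proof.
move=> mF mG; apply: singular_part_eq.
have -> : F + G = pfun_class (fun w => repr F w + repr G w).
  by rewrite -[F in LHS]reprK -[G in LHS]reprK; symmetry; exact: pfun_classD.
by apply/sing_class; apply: singD; exact: singular_partP.
Qed.

Lemma singular_partB F G z : meromorphic F -> meromorphic G ->
  singular_part (F - G) z = singular_part F z - singular_part G z.
Proof.
move=> mF mG; apply: singular_part_eq.
have -> : F - G = pfun_class (fun w => repr F w - repr G w).
  by rewrite -[F in LHS]reprK -[G in LHS]reprK; symmetry; exact: pfun_classB.
by apply/sing_class; apply: singD (singN _); exact: singular_partP.
Qed.

Lemma singular_partZ c F z : meromorphic F ->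
  singular_part (c *: F) z = c *: singular_part F z.
Proof.
move=> mF; apply: singular_part_eq.
have -> : c *: F = pfun_class (fun w => c * repr F w).
  by rewrite -[F in LHS]reprK; symmetry; exact: (pfun_classM (cst c) (repr F)).
by apply/sing_class; apply: singZ; exact: singular_partP.
Qed.

Lemma singular_part_translate a F z : meromorphic F ->
  singular_part (translate a F) z = singular_part F (z + a).
Proof.
move=> mF; apply: singular_part_eq; apply/sing_class; apply: sing_shift.
exact: singular_partP.
Qed.

Lemma singular_part_cst c z : singular_part (cstp c) z = 0.
Proof.
by apply: singular_part_eq; apply/sing_class; apply/sing0; exact: regular_cst.
Qed.

Lemma regular_singular_part F z : meromorphic F ->
  regular F z <-> singular_part F z = 0.
Proof.
move=> mF; split=> [h|h]; first by apply: singular_part_eq; apply/sing0.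
by apply/sing0; rewrite -h; exact: singular_partP.
Qed.

Variable tau : C.
Local Notation sigma := (sigma tau).
Local Notation dz := (@dz C).
Local Notation Delta := (Delta tau).

Lemma SK_meromorphic F : F \in SK tau -> meromorphic F.
Proof. by move=> /asboolP[[k []]]. Qed.

Lemma sigmaD F G : meromorphic F -> meromorphic G ->
  sigma (F + G) = fun l m => sigma F l m + sigma G l m.
Proof.
move=> mF mG; apply/funext => l; apply/funext => m.
by rewrite /Defs.sigma singular_partD // coefD.
Qed.

Lemma sigmaZ c F : meromorphic F -> sigma (c *: F) = fun l m => c * sigma F l m.
Proof.
move=> mF; apply/funext => l; apply/funext => m.
by rewrite /Defs.sigma singular_partZ // coefZ.
Qed.

Lemma sigma_cst c : sigma (cstp c) = fun l m => 0.
Proof.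
apply/funext => l; apply/funext => m.
by rewrite /Defs.sigma singular_part_cst coef0.
Qed.

Lemma sigmaB F G : meromorphic F -> meromorphic G ->
  sigma (F - G) = fun l m => sigma F l m - sigma G l m.
Proof.
move=> mF mG; apply/funext => l; apply/funext => m.
by rewrite /Defs.sigma singular_partB // coefB.
Qed.

(** Translation by tau moves the expansion at (m + 1) tau to m tau. *)
Lemma sigma_Delta F l : meromorphic F -> sigma (Delta F) l = dz (sigma F l).
Proof.
move=> mF; have mT := meromorphic_translate tau mF.
rewrite (sigmaB mT mF : sigma (Delta F) = _); apply/funext => m.
have h : sigma (translate tau F) l m = sigma F l (m + 1).
  rewrite /Defs.sigma (singular_part_translate _ _ mF).
  by rewrite intrD mulrDl mul1r.
by rewrite h.
Qed.

Lemma sigma_iterDelta n F l : F \in SK tau ->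
  sigma (iter n Delta F) l = iter n dz (sigma F l).
Proof.
move=> hF; elim: n => // n IH; rewrite !iterS sigma_Delta ?IH //.
by apply: SK_meromorphic; exact: SK_iterDelta.
Qed.

Lemma sigma_killed n F l : F \in SKn tau n -> iter n dz (sigma F l) = fun=> 0.
Proof. by move=> /SKnP[hF nF]; rewrite -sigma_iterDelta // nF -cstp0 sigma_cst. Qed.

(** Each coefficient is killed by the n-th difference, hence polynomial, and is
    determined by its values at 0, ..., n - 1; so the orders of the poles at the n
    points m tau with m < n bound all of them. *)
Lemma sigma_PN F : F \in SK tau -> sigma F \in @PN C.
Proof.
move=> hF; have [n hn] : exists n, F \in SKn tau n.
  by have /asboolP[[n hn] sF] := hF; exists n; apply/asboolP.
apply/asboolP; split; last by move=> l; exact: killed_polynomial (sigma_killed l hn).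
exists (\max_(i < n) size (singular_part F ((i : nat)%:Z%:~R * tau)))%N => l hl.
apply: (killed_vanish (sigma_killed l hn)) => i hi.
rewrite /Defs.sigma nth_default //; apply: leq_trans hl.
exact: (leq_bigmax (Ordinal hi)).
Qed.

End SingularParts.

(** * Derivatives of quasi-elliptic functions *)

Section Derivative.
Variable R : realType.
Local Notation C := (complex_complex__canonical__Num_NumField R).
Implicit Types (f g h : C -> C) (z w a c : C) (p q : {poly C}) (F G : pfun C).

Lemma derive_ext f g z : (\forall w \near z, f w = g w) -> 'D_1 f z = 'D_1 g z.
Proof. by move=> h; apply: near_eq_derive => //; exact: oner_neq0. Qed.

(** The chain rule for u = (w - z)^-1, as u' = - u^2. *)
Lemma polynomial_inv_derive p z w : w != z ->
  derivable (fun v : C => p.[(v - z)^-1]) w 1 /\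
  'D_1 (fun v : C => p.[(v - z)^-1]) w = - (p^`().[(w - z)^-1] * (w - z)^-1 ^+ 2).
Proof.
move=> wz; have wz0 : w - z != 0 by rewrite subr_eq0.
have ud := drv_invB wz.
have ud' : 'D_1 (fun v : C => (v - z)^-1) w = - (w - z)^-1 ^+ 2.
  have d1 := drvB (drv_id w) (drv_cst z w).
  have e1 : 'D_1 (fun v : C => v - z) w = 1.
    have := @deriveB _ _ _ (fun v : C => v) (fun=> z) w 1 (drv_id w) (drv_cst z w).
    have -> : 'D_1 (fun=> z) w = 0 := derive_cst z w 1.
    by rewrite derive_id subr0.
  have := @deriveV _ _ (fun v : C => v - z) w 1 wz0 d1.
  by rewrite e1 => ->; rewrite exprVn /GRing.scale /= mulr1.
elim/poly_ind: p => [|p c [pd pe]].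
  rewrite (_ : (fun v : C => _) = fun=> 0); last by apply/funext => v; rewrite horner0.
  split; first exact: (drv_cst (0 : C) w).
  rewrite deriv0 horner0 mul0r oppr0; exact: (derive_cst (0 : C) w 1).
rewrite (_ : (fun v : C => _) = fun v => p.[(v - z)^-1] * (v - z)^-1 + c); last first.
  by apply/funext => v; rewrite hornerMXaddC.
have md := drvM pd ud; split; first exact: (drvD md (drv_cst c w)).
have -> := @deriveD _ _ _ _ (fun=> c) w 1 md (drv_cst c w).
have -> : 'D_1 (fun=> c) w = 0 := derive_cst c w 1.
rewrite addr0.
have -> := @deriveM _ _ (fun v : C => p.[(v - z)^-1]) (fun v : C => (v - z)^-1) w 1 pd ud.
rewrite pe ud' derivD derivC addr0 derivM derivX mulr1 hornerD hornerMX /GRing.scale /=.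
by move: (p.[(w - z)^-1]) (p^`().[(w - z)^-1]) ((w - z)^-1) => A B u; ring.
Qed.

(** Differentiation of polar parts: p stands for the function u p(u) of
    u = (w - z)^-1, and u' = - u^2. *)
Definition dpolar p : {poly C} := - ('X * ('X * p)^`()).

Lemma dpolar0 : dpolar 0 = 0.
Proof. by rewrite /dpolar mulr0 deriv0 mulr0 oppr0. Qed.

Lemma dpolar_monomial c n : dpolar (c *: 'X^n) = (- (c *+ n.+1)) *: 'X^(n.+1).
Proof.
rewrite /dpolar -scalerAr -exprS derivZ derivXn /= -scalerAr mulrnAr -exprS.
by rewrite scaleNr -scalerMnl -scalerMnr.
Qed.

Lemma polarE p z w : polar p z w = ('X * p).[(w - z)^-1].
Proof. by rewrite hornerM hornerX. Qed.

Lemma sing_near f z p : sing f z p -> exists2 h, holomorphic_at h z &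
  \forall w \near z^', \forall v \near w, f v = polar p z v + h v.
Proof.
move=> [h hh hE]; exists h => //; apply: dnear_near; apply: filterS hE => w <-.
by rewrite addrC subrK.
Qed.

Lemma polar_derive p z w : w != z -> derivable (polar p z) w 1 /\
  'D_1 (polar p z) w = polar (dpolar p) z w.
Proof.
move=> wz; have [h1 h2] := polynomial_inv_derive ('X * p) wz.
rewrite (_ : polar p z = fun v => ('X * p).[(v - z)^-1]); last first.
  by apply/funext => v; exact: polarE.
split=> //; rewrite h2 /polar /dpolar hornerN hornerM hornerX.
by move: (('X * p)^`().[(w - z)^-1]) ((w - z)^-1) => A u; ring.
Qed.

Lemma sing_derivable f z p : sing f z p -> \forall w \near z^', derivable f w 1.
Proof.
move=> /sing_near[h hh hE]; have hz := dnbhs_neq z.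
have hd := near_dnear hh; move: hE hz hd; apply: filterS3 => w hE wz hd.
have [pd _] := polar_derive p wz.
apply: (derivable_ext _ (drvD pd hd)).
by apply: filterS hE => v ->.
Qed.

Lemma sing_derive f z p : sing f z p -> sing (fun w => 'D_1 f w) z (dpolar p).
Proof.
move=> /sing_near[h hh hE]; exists (fun w => 'D_1 h w); first exact: holomorphic_derive.
have hz := dnbhs_neq z.
have hd := near_dnear hh; move: hE hz hd; apply: filterS3 => w hE wz hd.
have [pd pe] := polar_derive p wz.
rewrite (derive_ext hE) -pe.
have -> := @deriveD _ _ _ (polar p z) h w 1 pd hd.
by rewrite addrAC subrr add0r.
Qed.

Lemma polar_meromorphic p z : meromorphic_at (polar p z) z.
Proof.
have inv : meromorphic_at (fun w => (w - z)^-1) z.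
  exists 1%N; exists (fun=> 1); first exact: hol_cst.
  apply: filterS (dnbhs_neq z) => w wz.
  by rewrite expr1 mulfV // subr_eq0.
apply: (meromorphicM inv); elim/poly_ind: p => [|p c IH].
  apply: regular_meromorphic; apply: regular_ext (regular_cst 0 z).
  by apply: filterE => w; rewrite horner0.
apply: meromorphic_ext (meromorphicD (meromorphicM IH inv) (regular_meromorphic (regular_cst c z))).
by apply: filterE => w; rewrite hornerMXaddC.
Qed.

Lemma sing_meromorphic f z p : sing f z p -> meromorphic_at f z.
Proof.
move=> /regular_meromorphic h; apply: meromorphic_ext (meromorphicD h (polar_meromorphic p z)).
by apply: filterE => w; rewrite !fctE subrK.
Qed.

Definition derive_pfun F : pfun C := pfun_class (fun w => 'D_1 (repr F) w).

Lemma derive_class f : derive_pfun (pfun_class f) = pfun_class (fun w => 'D_1 f w).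
Proof.
apply/eqP/pfun_classP => z.
by apply: filterS (dnear_near (repr_class f z)) => w; exact: derive_ext.
Qed.

Lemma derive_translate a F : derive_pfun (translate a F) = translate a (derive_pfun F).
Proof.
have e : (fun w => 'D_1 (fun v => repr F (v + a)) w) = fun w => 'D_1 (repr F) (w + a).
  apply/funext => w; rewrite /derive; set k1 := (fun _ => _); set k2 := (fun _ => _).
  suff -> : k1 = k2 by [].
  by apply/funext => t; rewrite /k1 /k2 /= addrA.
have := derive_class (fun v => repr F (v + a)); rewrite e => h.
have := translate_class a (fun w => 'D_1 (repr F) w) => h2.
exact: (etrans h (esym h2)).
Qed.

Lemma derive_cstp c : derive_pfun (cstp c) = 0.
Proof.
rewrite derive_class -cstp0; congr pfun_class; apply/funext => w; exact: derive_cst.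
Qed.

Lemma derive_sub F G : meromorphic F -> meromorphic G ->
  derive_pfun (F - G) = derive_pfun F - derive_pfun G.
Proof.
move=> mF mG; have -> : F - G = pfun_class (repr F - repr G).
  by rewrite -[F in LHS]reprK -[G in LHS]reprK; symmetry; exact: pfun_classB.
rewrite derive_class -pfun_classB; apply/eqP/pfun_classP => z.
have h1 := sing_derivable (singular_partP z mF).
have h2 := sing_derivable (singular_partP z mG).
move: h1 h2; apply: filterS2 => w d1 d2; exact: (deriveB d1 d2).
Qed.

Lemma singular_part_derive F z : meromorphic F ->
  singular_part (derive_pfun F) z = dpolar (singular_part F z).
Proof.
by move=> mF; apply: singular_part_eq; apply/sing_class/sing_derive/singular_partP.
Qed.

Lemma meromorphic_derive F : meromorphic F -> meromorphic (derive_pfun F).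
Proof.
move=> mF; apply/meromorphic_class => z.
by apply: sing_meromorphic (sing_derive (singular_partP z mF)).
Qed.

Variable tau : C.
Local Notation Delta := (Delta tau).

Lemma derive_Delta F : meromorphic F -> derive_pfun (Delta F) = Delta (derive_pfun F).
Proof.
move=> mF; rewrite (derive_sub (meromorphic_translate tau mF) mF).
by rewrite derive_translate.
Qed.

Lemma derive_iterDelta n F : F \in SK tau ->
  derive_pfun (iter n Delta F) = iter n Delta (derive_pfun F).
Proof.
move=> hF; elim: n => // n IH; rewrite !iterS derive_Delta ?IH //.
by apply: SK_meromorphic; exact: SK_iterDelta hF.
Qed.

Lemma SK_derive F : F \in SK tau -> derive_pfun F \in SK tau.
Proof.
move=> hF; have mF := SK_meromorphic hF; have /asboolP[[k [_ pF kF]] sF] := hF.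
apply/asboolP; split.
  exists k; split; first exact: meromorphic_derive.
    by rewrite -derive_translate pF.
  by rewrite -derive_iterDelta // kF -cstp0 derive_cstp cstp0.
move=> z hz; apply: contrapT => nz; apply: hz.
apply/(regular_singular_part _ (meromorphic_derive mF)).
rewrite (singular_part_derive _ mF) (_ : singular_part F z = 0) ?dpolar0 //.
by apply/(regular_singular_part _ mF); exact: special_regular sF nz.
Qed.

End Derivative.

(** * The isomorphism by singular parts *)

Section SingularPartIsomorphism.
Variable R : realType.
Local Notation C := (complex_complex__canonical__Num_NumField R).
Local Notation Im := (@complex.Im R).
Variable tau : C.
Hypothesis tau0 : 0 < Im tau.
Local Notation c0 := (zstep tau).
Local Notation Delta := (Delta tau).
Local Notation sigma := (sigma tau).
Local Notation dz := (@dz C).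
Local Notation dpolar := (@dpolar R).
Local Notation derive_pfun := (@derive_pfun R).
Local Notation Z := (scrZ tau).
Implicit Types (F G : pfun C) (n k l N : nat) (z c : C) (s : nat -> int -> C) (p : {poly C}).

Lemma translate_near a c F : translate a F = F + cstp c ->
  forall z, \forall w \near z^', repr F (w + a) = repr F w + c.
Proof.
move=> e z; have h1 := repr_class (fun w => repr F (w + a)) z.
have h2 : \forall w \near z^', repr (translate a F) w = repr F w + c.
  have -> : translate a F = pfun_class (fun w => repr F w + c).
    by rewrite e -[F in LHS]reprK; symmetry; exact: pfun_classD.
  exact: repr_class.
by move: h1 h2; apply: filterS2 => w; rewrite /translate => ->.
Qed.

(** By induction Delta F is constant, so F is an entire solution of
    F (z + tau) = F z + c of period 1. *)
Lemma entire_quasi_elliptic_cst n F : (forall z, regular F z) -> translate 1 F = F ->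
  iter n Delta F = 0 -> exists c, F = cstp c.
Proof.
elim: n F => [|n IH] F rF pF nF; first by exists 0; rewrite cstp0; exact: nF.
have [c hc] : exists c, Delta F = cstp c.
  apply: IH; last by rewrite -iterSr.
    move=> z; have rT : regular (translate tau F) z by apply/regular_translate.
    have h := regularD rT (regN (rF z)).
    have -> : Delta F = pfun_class (repr (translate tau F) - repr F).
      rewrite /Defs.Delta -[translate tau F in LHS]reprK -[F in X in _ - X]reprK.
      by symmetry; exact: pfun_classB.
    by apply/regular_pfun_class.
  by rewrite /Defs.Delta rmorphB /= translateC pF.
have hT : translate tau F = F + cstp c by rewrite -hc /Defs.Delta addrC subrK.
have h1 : translate 1 F = F + cstp 0 by rewrite cstp0 addr0.
have [Q [dQ PQ]] := entire_extension rF.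
have e1 := extension_shift dQ PQ (translate_near h1).
have e2 := extension_shift dQ PQ (translate_near hT).
have [z|_ Q0] := quasi_periodic_entire tau0 dQ _ e2; first by rewrite e1 addr0.
exists (Q 0); rewrite -[F in LHS]reprK; apply/eqP/pfun_classP => z.
by apply: filterS (PQ z) => w ->; exact: Q0.
Qed.

Lemma singular_part_periodic F z (n : int) : translate 1 F = F -> meromorphic F ->
  singular_part F (z + n%:~R) = singular_part F z.
Proof.
move=> pF mF; apply/polyP => l.
have h w : (singular_part F (w + 1))`_l = (singular_part F w)`_l.
  by rewrite -(singular_part_translate _ _ mF) pF.
by have := int_period h n z; rewrite mulr1.
Qed.

(** The period 1 carries the regularity at the points m tau to the whole
    lattice. *)
Lemma sigma_eq0 F : F \in SK tau -> sigma F = (fun _ _ => 0) -> exists c, F = cstp c.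
Proof.
move=> hF s0; have mF := SK_meromorphic hF; have /asboolP[[n [_ pF nF]] sF] := hF.
apply: (entire_quasi_elliptic_cst (n := n)) => // z.
case: (pselect (lattice tau z)) => [[m [q ->]]|]; last exact: special_regular.
apply/regular_singular_part => //; rewrite addrC singular_part_periodic //.
by apply/polyP => l; rewrite coef0 -[LHS]/(sigma F l q) s0.
Qed.

Lemma singular_part_scrZ (m : int) : singular_part Z (m%:~R * tau) = 1.
Proof.
apply: singular_part_eq; apply/sing_class; apply: holomorphic_regular.
have := zfun_pole tau0 (0, m); rewrite /wp /= add0r.
rewrite (_ : (fun w => _) = fun w => zfun tau w - polar 1 (m%:~R * tau) w) //.
by apply/funext => w; rewrite /polar hornerC mulr1.
Qed.

Lemma iter_dpolar c n : iter n dpolar (c%:P) = (c * ((-1) ^+ n * n`!%:R)) *: 'X^n.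
Proof.
elim: n => [|n IH]; first by rewrite /= expr0 !mulr1 alg_polyC.
rewrite iterS IH dpolar_monomial; congr (_ *: _).
by rewrite factS natrM exprS; ring.
Qed.

(** The building blocks for the surjectivity: the k-th difference of Z^(k+1) is
    affine in Z, so that of its l-th derivative has at each m tau the same
    singular part, a multiple of (x - m tau)^-(l+1). *)
Definition pole_function k l : pfun C := iter l derive_pfun (Z ^+ k.+1).

Definition pole_coef k l : C := c0 ^+ k *+ k.+1`! * ((-1) ^+ l * l`!%:R).

Lemma pole_coef_neq0 k l : pole_coef k l != 0.
Proof.
rewrite /pole_coef -mulr_natr !mulf_neq0 ?expf_neq0 ?zstep_neq0 ?oppr_eq0 ?oner_eq0 //;
  by rewrite pnatr_eq0 -lt0n fact_gt0.
Qed.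

Lemma SK_iter_derive l F : F \in SK tau -> iter l derive_pfun F \in SK tau.
Proof. by move=> hF; elim: l => // l IH; exact: SK_derive. Qed.

Lemma SK_pole_function k l : pole_function k l \in SK tau.
Proof. by apply: SK_iter_derive; apply: rpredX; exact: scrZ_SK. Qed.

Lemma iter_derive_iterDelta n l F : F \in SK tau ->
  iter n Delta (iter l derive_pfun F) = iter l derive_pfun (iter n Delta F).
Proof.
move=> hF; elim: l => // l IH; rewrite !iterS -IH derive_iterDelta //.
exact: SK_iter_derive.
Qed.

Lemma singular_part_iter_derive l F z : F \in SK tau ->
  singular_part (iter l derive_pfun F) z = iter l dpolar (singular_part F z).
Proof.
move=> hF; elim: l => // l IH; rewrite !iterS -IH singular_part_derive //.
by apply: SK_meromorphic; exact: SK_iter_derive.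
Qed.

Lemma iter_dz_pole_function k l j :
  iter k dz (sigma (pole_function k l) j) = fun=> pole_coef k l *+ (j == l).
Proof.
have hZ : Z ^+ k.+1 \in SK tau by apply: rpredX; exact: scrZ_SK.
apply/funext => m; rewrite -sigma_iterDelta; last exact: SK_pole_function.
rewrite iter_derive_iterDelta // /Defs.sigma singular_part_iter_derive; last exact: SK_iterDelta.
have [q hq] := iterDelta_pow_succ k (translate_scrZ tau0).
have -> : singular_part (iter k Delta (Z ^+ k.+1)) (m%:~R * tau) = (c0 ^+ k *+ k.+1`!)%:P.
  have -> : iter k Delta (Z ^+ k.+1) =
      (c0 ^+ k *+ k.+1`!) *: Z + cstp (c0 ^+ k.+1 *+ q).
    by rewrite hq scale_cstp !cstpMn !cstpX.
  have mZ := SK_meromorphic (scrZ_SK tau0).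
  rewrite singular_partD; last 2 first.
  - by apply: (@SK_meromorphic _ tau); apply: rpredZ; exact: scrZ_SK.
  - exact: (SK_meromorphic (SK_cstp tau _)).
  by rewrite singular_partZ // singular_part_cst addr0 singular_part_scrZ alg_polyC.
by rewrite iter_dpolar coefZ coefXn mulr_natr.
Qed.

Lemma sigma_leading k N (v : nat -> C) : exists2 F, F \in SK tau &
  forall l, iter k dz (sigma F l) = fun=> v l *+ (l < N)%N.
Proof.
elim: N => [|N [F hF hl]].
  exists (cstp 0); first exact: SK_cstp.
  by move=> l; rewrite sigma_cst iter_dz0.
pose G := (v N / pole_coef k N) *: pole_function k N.
have hG : G \in SK tau by apply: rpredZ; exact: SK_pole_function.
exists (F + G); first exact: rpredD.
move=> l; rewrite (sigmaD tau (SK_meromorphic hF) (SK_meromorphic hG)).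
rewrite iter_dzD hl; apply/funext => m.
rewrite (sigmaZ tau _ (SK_meromorphic (SK_pole_function k N))) iter_dzZ.
rewrite iter_dz_pole_function ltnS [(l <= N)%N]leq_eqVlt.
case: eqP => [->|_] /=; last by rewrite mulr0 addr0.
by rewrite ltnn add0r divfK // pole_coef_neq0.
Qed.

(** Induction on the degree in m: a combination of derivatives of Z^(k+1) matches
    the k-th differences, leaving a map of lower degree. *)
Lemma sigma_onto k s : (exists N, forall l, (N <= l)%N -> s l = fun=> 0) ->
  (forall l, iter k dz (s l) = fun=> 0) -> exists2 F, F \in SK tau & sigma F = s.
Proof.
elim: k s => [|k IH] s [N sN] hs.
  exists (cstp 0); first exact: SK_cstp.
  by rewrite sigma_cst; apply/funext => l; rewrite (hs l : s l = _).
pose v l := iter k dz (s l) 0.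
have sv l : iter k dz (s l) = fun=> v l.
  by apply/funext => m; apply: (dz_eq0_cst (s := iter k dz (s l))); rewrite -iterS.
have vN l : (N <= l)%N -> v l = 0 by move=> /sN e; rewrite /v e iter_dz0.
have [E hE El] := sigma_leading k N v.
have /asboolP[[M sM] _] := sigma_PN hE.
have [||G hG Gs] := IH (fun l m => s l m - sigma E l m).
- exists (maxn N M) => l; rewrite geq_max => /andP[/sN e1 /sM e2].
  by apply/funext => m; rewrite e1 e2 subr0.
- move=> l; rewrite iter_dzB sv El; apply/funext => m.
  by case: ltnP => [_|/vN ->]; rewrite ?mulr1n ?subrr // mulr0n subr0.
exists (G + E); first exact: rpredD.
rewrite (sigmaD tau (SK_meromorphic hG) (SK_meromorphic hE)) Gs.
by apply/funext => l; apply/funext => m; rewrite subrK.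
Qed.

Lemma PN_killed s : s \in @PN C -> exists k, forall l, iter k dz (s l) = fun=> 0.
Proof.
move=> /asboolP[[N sN] sp].
have [k hk] : exists k, forall l, (l < N)%N -> iter k dz (s l) = fun=> 0.
  elim: N {sN} => [|N [k hk]]; first by exists 0%N.
  have [p hp] := sp N; have [k' hk'] := polynomial_killed p.
  exists (maxn k k') => l; rewrite ltnS leq_eqVlt => /orP[/eqP ->|/hk h].
    apply: iter_dz_leq (leq_maxr k k') _.
    by rewrite (_ : s N = fun m => p.[m%:~R]) //; apply/funext => m; exact: hp.
  exact: iter_dz_leq (leq_maxl k k') h.
exists k => l; case: (ltnP l N) => [/hk //|/sN ->].
exact: iter_dz0.
Qed.

Definition sigma_quot (x : SK_mod_C tau) : PN_type C :=
  PNType (sigma_PN (SKvalP (repr x))).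

Lemma sigma_quotE (f : SK_type tau) : PNval (sigma_quot (SK_class f)) = sigma f.
Proof.
have /SK_classP[c hc] : SK_class (repr (SK_class f)) = SK_class f.
  by rewrite /SK_class reprK.
have -> : PNval (sigma_quot (SK_class f)) = sigma (SKval (repr (SK_class f))) by [].
have -> : SKval (repr (SK_class f)) = cstp c + SKval f.
  have -> : repr (SK_class f) = c *: (1 : SK_type tau) + f by rewrite -hc subrK.
  by rewrite SKvalD SKvalZ SKval1 scale_cstp mulr1.
rewrite sigmaD; last 2 first.
- exact: (SK_meromorphic (SK_cstp tau c)).
- exact: (SK_meromorphic (SKvalP f)).
by rewrite sigma_cst; apply/funext => l; apply/funext => m; rewrite add0r.
Qed.

Lemma sigma_quot_linear : linear sigma_quot.
Proof.
move=> a x y; apply: val_inj.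
have [f ->] := SK_mod_CP x; have [g ->] := SK_mod_CP y.
have -> : a *: SK_class f + SK_class g = SK_class (a *: f + g).
  by rewrite SK_classD -SK_class_scale.
rewrite -[LHS]/(PNval _) sigma_quotE.
have -> : val (a *: sigma_quot (SK_class f) + sigma_quot (SK_class g)) =
  (fun l m => a * PNval (sigma_quot (SK_class f)) l m + PNval (sigma_quot (SK_class g)) l m) by [].
rewrite !sigma_quotE SKvalD SKvalZ sigmaD ?sigmaZ //; [exact: (SK_meromorphic (SKvalP f))| |exact: (SK_meromorphic (SKvalP g))].
by apply: (@SK_meromorphic _ tau); apply: rpredZ; exact: SKvalP.
Qed.

HB.instance Definition _ := GRing.isLinear.Build C (SK_mod_C tau) (PN_type C) _
  sigma_quot sigma_quot_linear.

Lemma sigma_quot_bij : bijective sigma_quot.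
Proof.
have ex (s : PN_type C) : exists x, sigma_quot x = s.
  have [k hk] := PN_killed (PNvalP s).
  have /asboolP[sN _] := PNvalP s.
  have [F hF Fs] := sigma_onto sN hk.
  by exists (SK_class (SKType hF)); apply: val_inj; exact: (etrans (sigma_quotE (SKType hF)) Fs).
have [g hg] := choice ex; exists g => // x.
have [f hf] := SK_mod_CP (g (sigma_quot x) - x).
have h0 : sigma_quot (SK_class f) = 0 by rewrite -hf raddfB /= hg subrr.
have [c hc] : exists c, SKval f = cstp c.
  by apply: sigma_eq0; [exact: SKvalP|rewrite -sigma_quotE h0].
apply/eqP; rewrite -subr_eq0 hf; apply/eqP.
have -> : 0 = SK_class (0 : SK_type tau).
  by apply: (addrI (SK_class (0 : SK_type tau))); rewrite -SK_classD !addr0.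
apply/SK_classP; exists c; apply: val_inj.
by rewrite subr0 -[RHS]/(c *: SKval 1) SKval1 scale_cstp mulr1.
Qed.

End SingularPartIsomorphism.

Theorem theorem1 (R : realType) (tau : R[i]) (tau_gt0 : 0 < complex.Im tau) :
  (* (a) *)
  (exists Z : SK_type tau,
     [/\ SKval Z = scrZ tau,
         bijective (fun p : {poly SK1_type tau} =>
           (map_poly (@SK1_SK _ tau) p).[Z])
       & @is_basis (SK1_type tau) (SK_module tau) (fun k => Z ^+ k)]) /\
  (* (b) *)
  (forall f : SK_type tau, sigma tau f \in @PN R[i]) /\
  (* (c) *)
  (exists phi : {linear SK_mod_C tau -> PN_type R[i]},
     (forall f : SK_type tau, PNval (phi (SK_class f)) = sigma tau f) /\
     bijective phi).
Proof.
split; last split.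
- exists (ZSK tau_gt0); split=> //; first exact: evalZ_bij.
  exact: ZSK_basis.
- by move=> f; exact: sigma_PN (SKvalP f).
- by exists (@sigma_quot R tau); split; [exact: sigma_quotE|exact: sigma_quot_bij].
Qed.
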